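(* Any DAG $G$ with vertex set $X$ and $m$ edges can be preprocessed in $O(m)$ time so that, given an unknown linear order $L$ on $X$ (accessible via comparisons) and the guarantee that every edge $x \to y$ of $G$ satisfies $x <_L y$, one can sort $X$ along $L$ in $O(\log e(G))$ time and $O(\log e(G))$ comparisons.
   Context: $e(G)$ denotes the number of linear orders on $X$ compatible with $G$, i.e. linear orders in which $x$ precedes $y$ for every edge $x \to y$. In the preprocessing phase the algorithm may access $G$ but may not make comparisons; in the sorting phase it may compare items with respect to $L$ and must output $X$ sorted along $L$. Logarithms are base 2. *)

(* Defs.v *)
From Stdlib Require Import Reals.
From mathcomp Require Import all_boot.

Set Implicit Arguments.
Unset Strict Implicit.
Unset Printing Implicit Defensive.

(* A directed graph on T is its set of edges: (x, y) \in G means x -> y.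
   A linear order is likewise its set of pairs (x, y) with x <_L y. *)

Definition acyclic (T : finType) (G : {set T * T}) : Prop :=
  forall c : seq T, cycle (fun x y => (x, y) \in G) c -> c = [::].

Definition linear_order (T : finType) (L : {set T * T}) : bool :=
  [&& [forall x, (x, x) \notin L],
      [forall x, forall y, forall z,
         ((x, y) \in L) && ((y, z) \in L) ==> ((x, z) \in L)]
    & [forall x, forall y, (x != y) ==> ((x, y) \in L) || ((y, x) \in L)]].

Definition compatible (T : finType) (G L : {set T * T}) : bool :=
  [forall x, forall y, ((x, y) \in G) ==> ((x, y) \in L)].

Definition num_ext (T : finType) (G : {set T * T}) : nat :=
  #|[set L : {set T * T} | linear_order L && compatible G L]|.

(* MathComp takes over the key %R for its ring_scope. *)
Delimit Scope R_scope with coqR.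

Definition log2 (x : R) : R := (ln x / ln 2)%coqR.

(* The machine model is a unit-cost word RAM with w-bit words, presented as a
   structured language.  The finitely many scalars that a program mentions are
   its registers, and the finitely many arrays that it mentions are disjoint
   regions of its memory.  Arithmetic is modulo 2 ^ w, except that subtraction
   is truncated at 0; tests return 0 or 1, and nonzero words count as true. *)

Inductive binop := OpAdd | OpSub | OpMul | OpDiv | OpLt | OpEq.

Inductive expr :=
  | Const of nat
  | Var of nat
  | Get of nat & expr
  | Op of binop & expr & expr.

Inductive cmd :=
  | Skip
  | Assign of nat & expr
  | Put of nat & expr & expr
  | Compare of nat & expr & expr
  | Seq of cmd & cmd
  | If of expr & cmd & cmd
  | While of expr & cmd.

Record state := State { vars : nat -> nat; arrs : nat -> nat -> nat }.

Definition set_var (s : state) (x v : nat) : state :=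
  State (fun y => if y == x then v else vars s y) (arrs s).

Definition set_arr (s : state) (a i v : nat) : state :=
  State (vars s)
    (fun b j => if (b == a) && (j == i) then v else arrs s b j).

Definition op_val (o : binop) (u v : nat) : nat :=
  match o with
  | OpAdd => u + v
  | OpSub => u - v
  | OpMul => u * v
  | OpDiv => u %/ v
  | OpLt => u < v
  | OpEq => u == v
  end.

Fixpoint eval (w : nat) (s : state) (e : expr) : nat :=
  match e with
  | Const k => k %% 2 ^ w
  | Var x => vars s x
  | Get a i => arrs s a (eval w s i)
  | Op o e1 e2 => op_val o (eval w s e1) (eval w s e2) %% 2 ^ w
  end.

Fixpoint cost (e : expr) : nat :=
  match e with
  | Const _ | Var _ => 1
  | Get _ i => (cost i).+1
  | Op _ e1 e2 => (cost e1 + cost e2).+1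
  end.

(* run w orc c s s' t k: started in state s, the command c halts in state s'
   after t elementary steps, k of which are comparisons answered by orc.
   When orc is None, no comparison can be executed. *)
Inductive run (w : nat) (orc : option (rel nat)) :
    cmd -> state -> state -> nat -> nat -> Prop :=
  | RunSkip s : run w orc Skip s s 1 0
  | RunAssign s x e :
      run w orc (Assign x e) s (set_var s x (eval w s e)) (cost e).+1 0
  | RunPut s a i e :
      run w orc (Put a i e) s (set_arr s a (eval w s i) (eval w s e))
        (cost i + cost e).+1 0
  | RunCompare s lt x e1 e2 :
      orc = Some lt ->
      run w orc (Compare x e1 e2) s
        (set_var s x (lt (eval w s e1) (eval w s e2)))
        (cost e1 + cost e2).+1 1
  | RunSeq s s' s'' c1 c2 t1 t2 k1 k2 :
      run w orc c1 s s' t1 k1 -> run w orc c2 s' s'' t2 k2 ->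
      run w orc (Seq c1 c2) s s'' (t1 + t2) (k1 + k2)
  | RunIf s s' e c1 c2 t k :
      run w orc (if eval w s e != 0 then c1 else c2) s s' t k ->
      run w orc (If e c1 c2) s s' ((cost e).+1 + t) k
  | RunWhileFalse s e c :
      eval w s e = 0 ->
      run w orc (While e c) s s (cost e).+1 0
  | RunWhileTrue s s' s'' e c t1 t2 k1 k2 :
      eval w s e <> 0 ->
      run w orc c s s' t1 k1 -> run w orc (While e c) s' s'' t2 k2 ->
      run w orc (While e c) s s'' ((cost e).+1 + t1 + t2) (k1 + k2).

(* The items are the numbers 0, ..., n - 1.  The input is an edge list E in
   arbitrary order: scalar 0 is n, scalar 1 is the number of edges, arrays 0
   and 1 hold the sources and the targets; everything else is 0. *)
Definition input (n : nat) (E : seq ('I_n * 'I_n)) : state :=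
  State
    (fun x => match x with 0 => n | 1 => size E | _ => 0 end)
    (fun a i => match a with
                | 0 => nth 0 [seq val e.1 | e <- E] i
                | 1 => nth 0 [seq val e.2 | e <- E] i
                | _ => 0
                end).

Definition oracle (n : nat) (L : {set 'I_n * 'I_n}) : rel nat :=
  fun i j => [exists x : 'I_n, exists y : 'I_n,
    [&& val x == i, val y == j & (x, y) \in L]].

Fixpoint linked_list (next : nat -> nat) (nil p : nat) (l : seq nat) : Prop :=
  match l with
  | [::] => p = nil
  | x :: l' => p = x /\ linked_list next nil (next x) l'
  end.

Definition sorted_along (n : nat) (L : {set 'I_n * 'I_n}) (l : seq 'I_n) :=
  perm_eq l (enum 'I_n) /\ sorted (fun x y => (x, y) \in L) l.

(* The output is a linked list (an array could not be updated in O(log e(G))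
   time, as this can be less than n): scalar 0 holds the first item, array 0
   maps each item to the next one, and n is the null pointer. *)
Definition outputs_sorted (n : nat) (L : {set 'I_n * 'I_n}) (s : state) :=
  exists l : seq 'I_n, sorted_along L l /\
    linked_list (arrs s 0) n (vars s 0) [seq val x | x <- l].

(* Main.v *)
(* Preprocessing sorts G topologically (queue order q), computes levels (longest
   path ending at a vertex) and a longest path, which has one vertex per level;
   S is the set of the k vertices off that path.  Putting each vertex of S before
   or after the path vertex of its level gives 2^k extensions, so k <= log e(G).

   Sorting first sorts S, then inserts its elements into the path by galloping
   from the last position known to be a lower bound.  Moving each element of S
   within the range that was searched for it gives prod (gap + 1) extensions,
   which pays for the galloping.

   S is sorted in phases with block sizes B = 16, 16^2, 16^4 and so on.  A phase
   sorts blocks of size B, keeps every fourth element, and repeats with B squared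
   until one block remains; going back up, each element is placed by a local
   search that starts at the sampled element before it.  Elements that are not
   found there are lost and go to the next phase.  Every subsequence that is
   increasing both in q and in L loses only O(k / B) elements.  Hence, if an
   element that survives j phases has weight 2^(2^j - 1), every chain of the
   intersection of q and L has weight O(k); shifting the elements of S along these
   chains shows that the product of the weights is at most e(G) 2^O(k), and its
   logarithm pays for the phases. *)

(* Sorting S outright takes time of order k log k, while e(G) can be as small as 2^k; the time spent
   on an item has to be limited by how far L can deviate from q around it. A phase costs log B per
   item, so squaring B doubles the price, and an item present in phases 0, ..., j pays 4 (1 + 2 +
   ... + 2^j) = 4 + 8 (2^j - 1): a constant plus 8 times the logarithm of its weight. Such an item
   was lost in phase j - 1, whose block size is B = 2^(2 * 2^j), and its weight is sqrt(B) / 2. One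
   chain loses O(k / B) items there, so their weights add up to O(k / sqrt(B)), and these terms sum
   geometrically over the phases. The first block size 16 also makes the recursion for the losses
   contract: an item lost from a sampled level drags at most 4 items of the finer level along, but
   the sampled level has blocks of size B^2 and so loses less by a factor of at least 16. Only
   chains of the intersection of q and L can be controlled in this way. That suffices, because the
   heaviest chains below the items give each item an interval of values as long as its weight, with
   the intervals of comparable items disjoint and in order. *)
Require Import Defs.
From Stdlib Require Import Reals.
From mathcomp Require Import all_boot zify.

Set Implicit Arguments.
Unset Strict Implicit.
Unset Printing Implicit Defensive.

(** * Hoare-style rules for the machine *)

Declare Scope cmd_scope.
Notation "a +! b" := (Op OpAdd a b) (at level 50, left associativity) : cmd_scope.
Notation "a -: b" := (Op OpSub a b) (at level 50, left associativity) : cmd_scope.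
Notation "a *! b" := (Op OpMul a b) (at level 40, left associativity) : cmd_scope.
Notation "a /! b" := (Op OpDiv a b) (at level 40, left associativity) : cmd_scope.
Notation "a <! b" := (Op OpLt a b) (at level 70) : cmd_scope.
Notation "a ==! b" := (Op OpEq a b) (at level 70) : cmd_scope.
Notation "x ::= e" := (Assign x e) (at level 75) : cmd_scope.
Notation "c1 ;; c2" := (Seq c1 c2) (at level 80, right associativity) : cmd_scope.
Notation V := Var.
Notation K := Const.
Open Scope cmd_scope.

Fixpoint mod_vars (c : cmd) : seq nat :=
  match c with
  | Skip | Put _ _ _ => [::]
  | Assign x _ | Compare x _ _ => [:: x]
  | Seq c1 c2 | If _ c1 c2 => mod_vars c1 ++ mod_vars c2
  | While _ c => mod_vars c
  end.

Fixpoint mod_arrs (c : cmd) : seq nat :=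
  match c with
  | Skip | Assign _ _ | Compare _ _ _ => [::]
  | Put a _ _ => [:: a]
  | Seq c1 c2 | If _ c1 c2 => mod_arrs c1 ++ mod_arrs c2
  | While _ c => mod_arrs c
  end.

Fixpoint no_compare (c : cmd) : bool :=
  match c with
  | Skip | Assign _ _ | Put _ _ _ => true
  | Compare _ _ _ => false
  | Seq c1 c2 | If _ c1 c2 => no_compare c1 && no_compare c2
  | While _ c => no_compare c
  end.

Definition same_but (xs ys : seq nat) (s s' : state) : Prop :=
  (forall x, x \notin xs -> vars s' x = vars s x) /\
  (forall a, a \notin ys -> arrs s' a = arrs s a).

Definition frame (c : cmd) (s s' : state) : Prop :=
  same_but (mod_vars c) (mod_arrs c) s s'.

Lemma same_but_refl xs ys s : same_but xs ys s s.
Proof. by []. Qed.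

Lemma same_but_trans xs ys s1 s2 s3 :
  same_but xs ys s1 s2 -> same_but xs ys s2 s3 -> same_but xs ys s1 s3.
Proof.
by move=> [v1 a1] [v2 a2]; split=> [x xN | a aN]; rewrite ?v2 ?a2 ?v1 ?a1.
Qed.

Lemma same_but_sub xs ys xs' ys' s s' :
  {subset xs <= xs'} -> {subset ys <= ys'} -> same_but xs ys s s' -> same_but xs' ys' s s'.
Proof.
move=> sx sy [v a]; split=> [x xN | b bN]; [apply: v|apply: a].
  by apply: contra xN => /sx.
by apply: contra bN => /sy.
Qed.

Lemma same_but_cat xs ys xs' ys' s1 s2 s3 :
  same_but xs ys s1 s2 -> same_but xs' ys' s2 s3 -> same_but (xs ++ xs') (ys ++ ys') s1 s3.
Proof.
move=> [v1 a1] [v2 a2].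
by split=> x; rewrite mem_cat negb_or => /andP[h1 h2]; rewrite ?v2 ?v1 ?a2 ?a1.
Qed.

Lemma same_but_set_var xs ys s s' x v :
  same_but xs ys (set_var s x v) s' -> same_but (x :: xs) ys s s'.
Proof.
by move=> [fv fa]; split=> // y; rewrite inE negb_or => /andP[/negbTE yx /fv->] /=; rewrite yx.
Qed.

Lemma same_but_set_arr xs ys s s' a i v :
  same_but xs ys (set_arr s a i v) s' -> same_but xs (a :: ys) s s'.
Proof.
by move=> [fv fa]; split=> // y; rewrite inE negb_or => /andP[/negbTE yx /fa->] /=; rewrite yx.
Qed.

Section Exec.
Variables (w : nat) (orc : option (rel nat)).
Notation run := (run w orc).
Notation eval := (eval w).
Notation W := (2 ^ w).

Lemma run_frame c s s' t k : run c s s' t k -> frame c s s'.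
Proof.
elim=> {c s s' t k} //=.
- by move=> s x e; split=> //= y; rewrite inE => /negbTE ->.
- move=> s a i e; split=> //= b; rewrite inE => bN.
  by rewrite (negbTE bN).
- by move=> s lt x e1 e2 _; split=> //= y; rewrite inE => /negbTE ->.
- move=> s s' s'' c1 c2 _ _ _ _ _ f1 _ f2; apply: same_but_trans.
    by apply: same_but_sub f1 => x xi; rewrite mem_cat xi.
  by apply: same_but_sub f2 => x xi; rewrite mem_cat xi orbT.
- move=> s s' e c1 c2 t k _; case: ifP => _ f; apply: same_but_sub f => x xi;
  by rewrite mem_cat xi ?orbT.
- by move=> s s' s'' e c _ _ _ _ _ _ f1 _ f2; apply: same_but_trans f1 f2.
Qed.

Lemma run_compares c s s' t k : run c s s' t k -> k <= t.
Proof.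
elim=> {c s s' t k} //=.
- by move=> s s' s'' c1 c2 t1 t2 k1 k2 _ h1 _ h2; lia.
- by move=> s s' e c1 c2 t k _ h; lia.
- by move=> s s' s'' e c t1 t2 k1 k2 _ _ h1 _ h2; lia.
Qed.

Lemma run_no_compare c s s' t k : run c s s' t k -> no_compare c -> k = 0.
Proof.
elim=> {c s s' t k} //=.
- by move=> s s' s'' c1 c2 t1 t2 k1 k2 _ h1 _ h2 /andP[/h1-> /h2->].
- by move=> s s' e c1 c2 t k _; case: ifP => _ h /andP[h1 h2]; apply: h.
- by move=> s s' s'' e c t1 t2 k1 k2 _ _ h1 _ h2 nc; rewrite h1 ?h2.
Qed.

(* [t] is the time already spent, so that bounds can be put in [Q]. *)
Definition ex (c : cmd) (Q : state -> nat -> Prop) (s : state) (t : nat) : Prop :=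
  exists s' u k, run c s s' u k /\ Q s' (t + u).

Lemma ex_conseq c (P Q : state -> nat -> Prop) s t :
  ex c P s t -> (forall s' t', frame c s s' -> P s' t' -> Q s' t') -> ex c Q s t.
Proof.
move=> [s' [u [k [r p]]]] PQ; exists s', u, k; split=> //.
by apply: PQ p; apply: run_frame r.
Qed.

Lemma ex_framed c (Q : state -> nat -> Prop) s t :
  ex c (fun s' t' => frame c s s' -> Q s' t') s t -> ex c Q s t.
Proof. by move/ex_conseq; apply=> s' t' f; apply. Qed.

Lemma ex_skip Q s t : Q s t.+1 -> ex Skip Q s t.
Proof. by exists s, 1, 0; split; [constructor | rewrite addn1]. Qed.

Lemma ex_assign x e (Q : state -> nat -> Prop) s t v :
  eval s e = v -> Q (set_var s x v) (t + (cost e).+1) -> ex (Assign x e) Q s t.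
Proof. by move=> <- q; exists (set_var s x (eval s e)), (cost e).+1, 0; split=> //; constructor. Qed.

Lemma ex_put a i e (Q : state -> nat -> Prop) s t vi v :
  eval s i = vi -> eval s e = v ->
  Q (set_arr s a vi v) (t + (cost i + cost e).+1) -> ex (Put a i e) Q s t.
Proof.
by move=> <- <- q; eexists _, _, 0; split; [constructor|].
Qed.

Lemma ex_compare lt x e1 e2 (Q : state -> nat -> Prop) s t v1 v2 :
  orc = Some lt -> eval s e1 = v1 -> eval s e2 = v2 ->
  Q (set_var s x (lt v1 v2)) (t + (cost e1 + cost e2).+1) -> ex (Compare x e1 e2) Q s t.
Proof.
by move=> o <- <- q; eexists _, _, 1; split; [exact: RunCompare o|].
Qed.

Lemma ex_seq c1 c2 Q s t : ex c1 (ex c2 Q) s t -> ex (Seq c1 c2) Q s t.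
Proof.
move=> [s1 [u1 [k1 [r1 [s2 [u2 [k2 [r2 q]]]]]]]].
by exists s2, (u1 + u2), (k1 + k2); split; [apply: RunSeq r1 r2|rewrite addnA].
Qed.

Lemma ex_if e c1 c2 Q s t v :
  eval s e = v -> ex (if v != 0 then c1 else c2) Q s (t + (cost e).+1) -> ex (If e c1 c2) Q s t.
Proof.
move=> <- [s' [u [k [r q]]]]; exists s', ((cost e).+1 + u), k.
by split; [constructor|rewrite addnA].
Qed.

(** Termination comes from [mu], so the invariant only has to carry facts and the time. Both
    premises receive the frame from [s0], which spares the invariant all unchanged registers and
    arrays. *)
Lemma ex_while (I : state -> nat -> Prop) (mu : state -> nat) e c Q s0 t0 :
  I s0 t0 ->
  (forall s t, frame c s0 s -> I s t -> eval s e != 0 ->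
     ex c (fun s' t' => I s' t' /\ mu s' < mu s) s (t + (cost e).+1)) ->
  (forall s t, frame c s0 s -> I s t -> eval s e = 0 -> Q s (t + (cost e).+1)) ->
  ex (While e c) Q s0 t0.
Proof.
move=> i0 body done_.
suff loop N : forall s t, frame c s0 s -> I s t -> mu s < N -> ex (While e c) Q s t.
  by apply: (loop (mu s0).+1) => //; apply: same_but_refl.
elim: N => [//|N IH] s t f i muN.
have [ev0|evN] := eqVneq (eval s e) 0.
  exists s, (cost e).+1, 0; split; first exact: RunWhileFalse.
  exact: done_.
have [s1 [u1 [k1 [r1 [i1 mu1]]]]] := body _ _ f i evN.
have f1 := same_but_trans f (run_frame r1).
have [|s2 [u2 [k2 [r2 q]]]] := IH s1 _ f1 i1; first by apply: leq_trans mu1 _.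
exists s2, ((cost e).+1 + u1 + u2), (k1 + k2).
split; last by rewrite !addnA.
by apply: RunWhileTrue r1 r2; apply/eqP.
Qed.

Lemma evC k s : k < W -> eval s (Const k) = k.
Proof. by move=> kW; rewrite /= modn_small. Qed.

Lemma evG a i s v : eval s i = v -> eval s (Get a i) = arrs s a v.
Proof. by move=> <-. Qed.

Lemma evO o a b s u v :
  eval s a = u -> eval s b = v -> op_val o u v < W -> eval s (Op o a b) = op_val o u v.
Proof. by move=> <- <- uvW; rewrite /= modn_small. Qed.

Lemma ev_add a b s u v : eval s a = u -> eval s b = v -> u + v < W -> eval s (a +! b) = u + v.
Proof. by move=> au bv; apply: (@evO OpAdd _ _ _ _ _ au bv). Qed.
Lemma ev_mul a b s u v : eval s a = u -> eval s b = v -> u * v < W -> eval s (a *! b) = u * v.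
Proof. by move=> au bv; apply: (@evO OpMul _ _ _ _ _ au bv). Qed.
Lemma ev_sub a b s u v : eval s a = u -> eval s b = v -> u < W -> eval s (a -: b) = u - v.
Proof.
by move=> au bv uW; apply: (@evO OpSub _ _ _ _ _ au bv); apply: leq_ltn_trans uW; apply: leq_subr.
Qed.
Lemma ev_div a b s u v : eval s a = u -> eval s b = v -> u < W -> eval s (a /! b) = u %/ v.
Proof.
by move=> au bv uW; apply: (@evO OpDiv _ _ _ _ _ au bv); apply: leq_ltn_trans uW; apply: leq_div.
Qed.
Lemma ev_lt a b s u v : eval s a = u -> eval s b = v -> 1 < W -> eval s (a <! b) = (u < v).
Proof.
by move=> au bv W1; apply: (@evO OpLt _ _ _ _ _ au bv); apply: leq_ltn_trans W1; apply: leq_b1.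
Qed.
Lemma ev_eq a b s u v : eval s a = u -> eval s b = v -> 1 < W -> eval s (a ==! b) = (u == v).
Proof.
by move=> au bv W1; apply: (@evO OpEq _ _ _ _ _ au bv); apply: leq_ltn_trans W1; apply: leq_b1.
Qed.

Definition For x lo hi body := x ::= lo ;; While (V x <! hi) (body ;; x ::= V x +! K 1).

(** The bound [hi] is evaluated anew at every test, hence the premise that it keeps the value b. The
    charges [cost hi + 3] and 4 are those of the test and of the increment. *)
Lemma ex_for (I : nat -> state -> nat -> Prop) a b x lo hi body Q s0 t0 :
  eval s0 lo = a -> a <= b -> b.+1 < W -> x \notin mod_vars body ->
  I a (set_var s0 x a) (t0 + (cost lo).+1) ->
  (forall s i t, same_but (x :: mod_vars body) (mod_arrs body) s0 s ->
     vars s x = i -> I i s t -> eval s hi = b) ->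
  (forall s i t, same_but (x :: mod_vars body) (mod_arrs body) s0 s ->
     a <= i < b -> vars s x = i -> I i s t ->
     ex body (fun s' t' => vars s' x = i -> I i.+1 (set_var s' x i.+1) (t' + 4))
        s (t + (cost hi + 3))) ->
  (forall s t, same_but (x :: mod_vars body) (mod_arrs body) s0 s ->
     vars s x = b -> I b s t -> Q s (t + (cost hi + 3))) ->
  ex (For x lo hi body) Q s0 t0.
Proof.
move=> e0 ab bW xN i0 hiP bodyP doneP.
apply: ex_seq; apply: ex_assign e0 _.
have f0 : same_but (x :: mod_vars body) (mod_arrs body) s0 (set_var s0 x a).
  by split=> // y; rewrite inE negb_or /= => /andP[/negbTE->].
have fT s : frame (body ;; x ::= V x +! K 1) (set_var s0 x a) s ->
    same_but (x :: mod_vars body) (mod_arrs body) s0 s.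
  move=> f; apply: same_but_trans f0 _; apply: same_but_sub f => y /=.
    by rewrite mem_cat !inE orbC.
  by rewrite cats0.
pose J s t := I (vars s x) s t /\ a <= vars s x <= b.
apply: (@ex_while J (fun s => b - vars s x)).
- by rewrite /J /= eqxx ab leqnn.
- move=> s t /fT f [i abx].
  have ehi := hiP _ _ _ f (erefl _) i.
  rewrite (ev_lt (u := vars s x) _ ehi) //; last lia.
  rewrite eqb0 negbK => xb.
  apply: ex_seq.
  have := bodyP s (vars s x) t f.
  rewrite xb; case/andP: (abx) => -> _ /(_ isT (erefl _) i).
  have -> : (cost (V x <! hi)).+1 = cost hi + 3 by rewrite /=; lia.
  move/ex_conseq; apply=> s' t' f' P.
  have xs' : vars s' x = vars s x by case: f' => ->.
  apply: (@ex_assign _ _ _ _ _ (vars s x).+1).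
    rewrite (ev_add (u := vars s x) (v := 1)) ?addn1 ?evC //; lia.
  split; last by rewrite /= eqxx; lia.
  split; last by rewrite /= eqxx; lia.
  by rewrite /= eqxx; apply: P.
- move=> s t /fT f [i abx].
  have ehi := hiP _ _ _ f (erefl _) i.
  rewrite (ev_lt (u := vars s x) _ ehi) //; last lia.
  move/eqP; rewrite eqb0 -leqNgt => bx.
  have xb : vars s x = b by lia.
  have -> : (cost (V x <! hi)).+1 = cost hi + 3 by rewrite /=; lia.
  by apply: doneP; rewrite ?xb // -{1}xb.
Qed.

End Exec.

(** * Merge sort in blocks *)

Ltac rwv := repeat match goal with
  | H : vars ?s ?x = _ |- context [vars ?s ?x] => rewrite H
  | H : arrs ?s ?x = _ |- context [arrs ?s ?x] => rewrite H
  end.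

Ltac side := rewrite /=; rwv; first [done | lia | nia].

Ltac ev := lazymatch goal with
  | |- eval _ _ (Const _) = _ => apply: evC; side
  | |- eval _ _ (Var _) = _ => rewrite /=; rwv; reflexivity
  | |- eval _ _ (Get _ _) = _ => eapply evG; ev
  | |- eval _ _ (Op OpAdd _ _) = _ => eapply ev_add; [ev|ev|side]
  | |- eval _ _ (Op OpSub _ _) = _ => eapply ev_sub; [ev|ev|side]
  | |- eval _ _ (Op OpMul _ _) = _ => eapply ev_mul; [ev|ev|side]
  | |- eval _ _ (Op OpDiv _ _) = _ => eapply ev_div; [ev|ev|side]
  | |- eval _ _ (Op OpLt _ _) = _ => eapply ev_lt; [ev|ev|side]
  | |- eval _ _ (Op OpEq _ _) = _ => eapply ev_eq; [ev|ev|side]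
  end.

Ltac step := lazymatch goal with
  | |- ex _ _ (Seq _ _) _ _ _ => apply: ex_seq; step
  | |- ex _ _ (Assign _ _) _ _ _ => eapply ex_assign; [ev | rewrite /=; rwv]
  | |- ex _ _ (Put _ _ _) _ _ _ => eapply ex_put; [ev | ev | rewrite /=; rwv]
  | |- ex _ _ (Compare _ _ _) _ _ _ => eapply ex_compare; [first [eassumption | reflexivity] | ev | ev | rewrite /=; rwv]
  | |- ex _ _ (If _ _ _) _ _ _ => eapply ex_if; [ev | rewrite /=; rwv]
  | |- ex _ _ Skip _ _ _ => apply: ex_skip; rewrite /=
  end.

(* Transfers the known values of registers and arrays along the frame [f]. *)
Ltac framev f := let fv := fresh "fv" in let fa := fresh "fa" in case: (f) => fv fa;
  repeat match goal with
  | H : vars ?s ?x = _ |- _ =>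
     match type of fv with forall y, _ -> vars ?s' y = vars s y =>
       lazymatch goal with
       | _ : vars s' x = _ |- _ => fail
       | _ => let E := fresh "E" in (have E : vars s' x = vars s x by apply: fv); rewrite H in E
       end
     end
  | H : arrs ?s ?x = _ |- _ =>
     match type of fa with forall y, _ -> arrs ?s' y = arrs s y =>
       lazymatch goal with
       | _ : arrs s' x = _ |- _ => fail
       | _ => let E := fresh "E" in (have E : arrs s' x = arrs s x by apply: fa); rewrite H in E
       end
     end
  end; clear fv fa.

(* Moves the assignments of the initial state of the frame [f] into its lists. *)
Ltac base f := repeat (let h := fresh in
  first [have h := same_but_set_var f | have h := same_but_set_arr f]; clear f; rename h into f).

Ltac weaken f := refine (same_but_sub _ _ f) => ? /=; first [done |
  rewrite ?mem_cat ?inE; do ?[case/orP]; first [done | by move=> ->; rewrite ?orbT]].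

(* Names in [v] are registers, names in [a] are arrays. *)
Notation aA := 11. Notation aT := 12.
Notation vlo := 30. Notation vlen := 31. Notation vb := 32. Notation vwd := 33.
Notation vst := 34. Notation vmid := 35. Notation ven := 36. Notation vi := 37.
Notation vj := 38. Notation vo := 39. Notation vf := 40. Notation vq := 41.
(* Subtraction is truncated, so this is the minimum. *)
Notation minE a b := (a -: (a -: b)).

Definition merge_cmd :=
  vi ::= V vst ;; vj ::= V vmid ;;
  For vo (V vst) (V ven) (
    (If (V vi <! V vmid)
      (If (V vj <! V ven) (Compare vf (Get aA (V vlo +! V vi)) (Get aA (V vlo +! V vj))) (vf ::= K 1))
      (vf ::= K 0)) ;;
    (If (V vf)
      (Put aT (V vo) (Get aA (V vlo +! V vi)) ;; vi ::= V vi +! K 1)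
      (Put aT (V vo) (Get aA (V vlo +! V vj)) ;; vj ::= V vj +! K 1))).

Definition pass_cmd :=
  vst ::= K 0 ;;
  While (V vst <! V vlen) (
    vmid ::= minE (V vst +! V vwd) (V vlen) ;;
    ven ::= minE (V vst +! K 2 *! V vwd) (V vlen) ;;
    merge_cmd ;;
    vst ::= V vst +! K 2 *! V vwd) ;;
  For vq (K 0) (V vlen) (Put aA (V vlo +! V vq) (Get aT (V vq))).

Definition sort_cmd :=
  vwd ::= K 1 ;; While (V vwd <! V vb) (pass_cmd ;; vwd ::= K 2 *! V vwd).

Lemma divn_eqP d p k : 0 < d -> (p %/ d == k) = (k * d <= p < k.+1 * d).
Proof. by move=> d0; rewrite eqn_leq -ltnS ltn_divLR // leq_divRL // andbC. Qed.

Section Sort.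
Variables (w : nat) (lt : rel nat) (n : nat) (rk : nat -> nat).
Hypothesis ltP : forall i j, i < n -> j < n -> lt i j = (rk i < rk j).
Notation ex := (ex w (Some lt)).
Notation W := (2 ^ w).

Definition valid (f : nat -> nat) a b := forall p, a <= p < b -> f p < n.
Definition distinct (f : nat -> nat) a b :=
  forall p q, a <= p < b -> a <= q < b -> rk (f p) = rk (f q) -> p = q.
Definition incr (f : nat -> nat) a b := forall p q, a <= p -> p < q -> q < b -> rk (f p) < rk (f q).
Definition image_in (f g : nat -> nat) a b c d :=
  forall p, a <= p < b -> exists2 q, c <= q < d & g q = f p.

Lemma merge_spec (Q : state -> nat -> Prop) s t lo st mid en (f := fun q => arrs s aA (lo + q)) :
  vars s vlo = lo -> vars s vst = st -> vars s vmid = mid -> vars s ven = en ->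
  st <= mid <= en -> lo + en + 2 < W ->
  valid f st en -> distinct f st en -> incr f st mid -> incr f mid en ->
  (forall s' t' (g := arrs s' aT), frame merge_cmd s s' ->
     t' <= t + 60 * (en - st) + 20 -> incr g st en ->
     image_in f g st en st en -> image_in g f st en st en ->
     (forall q, ~~ (st <= q < en) -> g q = arrs s aT q) -> Q s' t') ->
  ex merge_cmd Q s t.
Proof.
move=> Elo Est Emid Een /andP[sm me] WW fv fd fi1 fi2 QP.
rewrite /merge_cmd; step; step.
(* Everything written so far ranks below both heads, so that appending the smaller head keeps the
   output increasing. *)
pose I (o : nat) s' (t' : nat) := exists i j, let g := arrs s' aT in
  [/\ vars s' vi = i, vars s' vj = j, st <= i <= mid, mid <= j <= en & o + mid = i + j] /\
  [/\ incr g st o, forall p, st <= p < o -> (i < mid -> rk (g p) < rk (f i)) /\ (j < en -> rk (g p) < rk (f j)),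
     (forall p, st <= p < i \/ mid <= p < j -> exists2 q, st <= q < o & g q = f p),
     (forall p, st <= p < o -> exists2 q, (st <= q < i) || (mid <= q < j) & g p = f q) &
     (forall q, ~~ (st <= q < o) -> g q = arrs s aT q)] /\ t' <= t + 60 * (o - st) + 8.
apply: (@ex_for w (Some lt) I st en); [by ev|lia|lia|by []|..].
- exists st, mid; split; first by split=> //=; lia.
  split; last by rewrite /=; lia.
  by rewrite /incr; split=> //=; intros; exfalso; lia.
- by move=> s' o t' fr _ _; base fr; framev fr; ev.
- move=> s' o t' fr soe Eo [i [j [[Ei Ej im je oij] [[g1 g2 g3 g4 g5] tb]]]].
  base fr; framev fr.
  have EA : arrs s' aA = arrs s aA by case: fr => _; apply.
  apply: ex_seq; step.
  (* What the flag means is the same whether it comes from a comparison or from an exhausted half,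
     so the copying step is treated once for all three origins. *)
  pose R s2 (t2 : nat) := exists b : bool, [/\ s2 = set_var s' vf b, t2 <= t' + 30 &
     if b then i < mid /\ (j < en -> rk (f i) < rk (f j)) else j < en /\ (i < mid -> rk (f j) < rk (f i))].
  have RQ : forall s2 t2, R s2 t2 -> ex
     (If (V vf)
      (Put aT (V vo) (Get aA (V vlo +! V vi)) ;; vi ::= V vi +! K 1)
      (Put aT (V vo) (Get aA (V vlo +! V vj)) ;; vj ::= V vj +! K 1))
     (fun s' t' => vars s' vo = o -> I o.+1 (set_var s' vo o.+1) (t' + 4)) s2 t2.
    move=> s2 t2 [b [-> t2b cb]]; step.
    case: b cb => -[lti cmp]; rewrite eqb0 /=.
    - step; step; move=> _; exists i.+1, j; rewrite /=; split; first by split=> //; lia.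
      rewrite ?EA -/(f i).
      split; last by lia.
      split.
      + move=> p q; case: eqP => [->|]; case: eqP => [->|]; try lia.
          move=> _ sp po _; have [|h1 h2] := g2 p; [lia|exact: h1].
        by move=> qo po sp pq qo1; apply: g1; lia.
      + move=> p; case: eqP => [-> _|po pb].
          split=> h; last by apply: cmp.
          by apply: fi1; lia.
        have [|h1 h2] := g2 p; first lia.
        split=> h; last exact: h2.
        by apply: ltn_trans (h1 lti) _; apply: fi1; lia.
      + move=> p pb; have [->|pi] := eqVneq p i; first by exists o; rewrite ?eqxx //; lia.
        have [|q qb <-] := g3 p; first by lia.
        by exists q; [lia|case: eqP => //; lia].
      + move=> p pb; case: eqP => [_|po]; first by exists i => //; lia.
        have [|q qb ->] := g4 p; first by lia.
        by exists q => //; lia.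
      + by move=> q; case: eqP => [|_]; first lia; move=> qb; apply: g5; lia.
    - step; step; move=> _; exists i, j.+1; rewrite /=; split; first by split=> //; lia.
      rewrite ?EA -/(f j).
      split; last by lia.
      split.
      + move=> p q; case: eqP => [->|]; case: eqP => [->|]; try lia.
          move=> _ sp po _; have [|h1 h2] := g2 p; [lia|exact: h2].
        by move=> qo po sp pq qo1; apply: g1; lia.
      + move=> p; case: eqP => [-> _|po pb].
          split=> h; first by apply: cmp.
          by apply: fi2; lia.
        have [|h1 h2] := g2 p; first lia.
        split=> h; first exact: h1.
        by apply: ltn_trans (h2 lti) _; apply: fi2; lia.
      + move=> p pb; have [->|pi] := eqVneq p j; first by exists o; rewrite ?eqxx //; lia.
        have [|q qb <-] := g3 p; first by lia.
        by exists q; [lia|case: eqP => //; lia].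
      + move=> p pb; case: eqP => [_|po]; first by exists j => //; lia.
        have [|q qb ->] := g4 p; first by lia.
        by exists q => //; lia.
      + by move=> q; case: eqP => [|_]; first lia; move=> qb; apply: g5; lia.
  rewrite eqb0 negbK; case: (ltnP i mid) => im' /=.
    step; rewrite eqb0 negbK; case: (ltnP j en) => je' /=.
      step; apply: RQ; exists (rk (f i) < rk (f j)); rewrite ?EA ltP; [|by apply: fv; lia..].
      split=> //; first lia.
      case: ltnP => // ji; split=> // _; rewrite ltn_neqAle ji andbT.
      by apply/eqP => /esym/fd; lia.
    step; apply: RQ; exists true; split=> //; first lia.
    by split=> //; lia.
  step; apply: RQ; exists false; split=> //; first lia.
  by split; lia.
- move=> s' t' fr _ [i [j [[Ei Ej im je oij] [[g1 g2 g3 g4 g5] tb]]]].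
  apply: QP => //.
  + by base fr; weaken fr.
  + by rewrite /=; lia.
  + by move=> p pb; apply: g3; lia.
  + by move=> p /g4[q qb ->]; exists q => //; lia.
Qed.

Definition block_sorted f len b := forall p q, p < q -> q < len -> p %/ b = q %/ b -> rk (f p) < rk (f q).
(** One half of saying that both arrays hold the same items in each block. Used in both directions
    and together with distinctness, it takes the place of a permutation. *)
Definition block_map (f g : nat -> nat) len b :=
  forall p, p < len -> exists2 q, q < len /\ q %/ b = p %/ b & g q = f p.

Lemma pass_spec (Q : state -> nat -> Prop) s t lo len wd (f := fun q => arrs s aA (lo + q)) :
  vars s vlo = lo -> vars s vlen = len -> vars s vwd = wd -> 0 < wd ->
  lo + 2 * len + 4 * wd + 10 < W ->
  valid f 0 len -> distinct f 0 len -> block_sorted f len wd ->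
  (forall s' t' (g := fun q => arrs s' aA (lo + q)), frame pass_cmd s s' ->
     t' <= t + 150 * len + 50 -> block_sorted g len (2 * wd) ->
     block_map f g len (2 * wd) -> block_map g f len (2 * wd) ->
     (forall q, ~~ (lo <= q < lo + len) -> arrs s' aA q = arrs s aA q) -> Q s' t') ->
  ex pass_cmd Q s t.
Proof.
move=> Elo Elen Ewd wd0 WW fv fd fs QP.
have d0 : 0 < 2 * wd by lia.
apply: ex_framed; rewrite {1}/pass_cmd; step; apply: ex_seq.
(* k pairs of blocks have been merged into [aT]; the last pair may reach beyond [len], hence the
   minimum. *)
pose I s' (t' : nat) := exists k, let g := arrs s' aT in let o := minn (k * (2 * wd)) len in
  [/\ vars s' vst = k * (2 * wd), k = 0 \/ k.-1 * (2 * wd) < len, block_sorted g o (2 * wd),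
      block_map f g o (2 * wd) & block_map g f o (2 * wd)] /\ t' <= t + 120 * o + 4.
apply: (ex_while (I := I) (mu := fun s => len - vars s vst)).
- exists 0; rewrite /= !mul0n min0n; split; last by lia.
  by split=> //; left.
- move=> s1 t1 fr [k [[Est _ g1 g2 g3] tb]]; base fr; framev fr.
  have EA : arrs s1 aA = arrs s aA by case: fr => _; apply.
  have [lts|] := ltnP (k * (2 * wd)) len; last first.
    by move=> h; rewrite (ev_lt (u := k * (2 * wd)) (v := len)) //; lia.
  set st := k * (2 * wd) in Est lts *; move=> _.
  step; step.
  set mid := _ - (_ - _); set en := _ - (_ - _).
  have midE : mid = minn (st + wd) len by rewrite /mid; lia.
  have enE : en = minn (st + 2 * wd) len by rewrite /en; lia.
  have blk p : st <= p < en -> p %/ (2 * wd) = k.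
    by move=> pb; apply/eqP; rewrite divn_eqP // mulSn; rewrite /st in pb enE *; lia.
  have blo p : p < st -> p %/ (2 * wd) < k by rewrite ltn_divLR.
  have oE : minn st len = st by lia.
  have o1E : minn (k.+1 * (2 * wd)) len = en by rewrite enE mulSn /st addnC.
  have half p : (st <= p < mid -> p %/ wd = 2 * k) /\ (mid <= p < en -> p %/ wd = (2 * k).+1).
    by split=> pb; apply/eqP; rewrite divn_eqP // ?mulSn; rewrite /st in pb enE midE *; lia.
  apply: ex_seq; apply: (@merge_spec _ _ _ lo st mid en); rewrite /= ?Elo ?Est ?EA //.
  + by apply/andP; split; lia.
  + by lia.
  + by move=> p pb; apply: fv; lia.
  + by move=> p q pb qb; apply: fd; lia.
  + by move=> p q sp pq qm; apply: fs; rewrite ?(proj1 (half _)) //; lia.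
  + by move=> p q sp pq qm; apply: fs; rewrite ?(proj2 (half _)) //; lia.
  move=> s2 t2 fr2 t2b h1 h2 h3 h4; base fr2; framev fr2.
  step; split; last by rewrite ?Est; lia.
  exists k.+1; rewrite /= o1E; split; last first.
    by move: tb; rewrite oE; lia.
  split.
  + by rewrite mulSn /st addnC.
  + by right; rewrite -/st.
  + move=> p q pq qe pqb; have [qs|qs] := ltnP q st.
      by rewrite !h4; [apply: g1 => //; rewrite oE|lia|lia].
    have [ps|ps] := ltnP p st; last by apply: h1.
    by have := blo _ ps; rewrite pqb blk; lia.
  + move=> p pe; have [ps|ps] := ltnP p st.
      have [|q [qo qb] <-] := g2 p; first by rewrite oE.
      by rewrite oE in qo; exists q; [split; first lia|rewrite h4 //; lia].
    have [|q qb e] := h2 p; first by lia.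
    by exists q; [rewrite !blk //; lia|rewrite e].
  + move=> p pe; have [ps|ps] := ltnP p st.
      have [|q [qo qb] e] := g3 p; first by rewrite oE.
      by rewrite oE in qo; exists q; [split; first lia|rewrite h4 //; lia].
    have [|q qb e] := h3 p; first by lia.
    by exists q; [rewrite !blk //; lia|rewrite -e].
- move=> s1 t1 fr [k [[Est k0 g1 g2 g3] tb]] ev0; base fr; framev fr.
  have EA : arrs s1 aA = arrs s aA by case: fr => _; apply.
  move: ev0; rewrite (ev_lt (u := k * (2 * wd)) (v := len)) //; try lia.
  move/eqP; rewrite eqb0 -leqNgt => lts.
  have oE : minn (k * (2 * wd)) len = len by lia.
  rewrite oE in g1 g2 g3 tb.
  pose J (i : nat) s' (t' : nat) := t' <= t + 120 * len + 20 + 20 * i /\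
    (forall q, arrs s' aA q = if lo <= q < lo + i then arrs s1 aT (q - lo) else arrs s aA q).
  apply: (ex_for (I := J) (a := 0) (b := len)); [by ev|lia|lia|by []|..].
  + by split; [rewrite /=; lia|move=> q; rewrite /= EA; case: ifP => //; lia].
  + by move=> s2 i t2 f2 _ _; base f2; framev f2; ev.
  + move=> s2 i t2 f2 ib Ei [tb2 h]; base f2; framev f2.
    have ET : arrs s2 aT = arrs s1 aT by case: f2 => _; apply.
    step => _; split; first by rewrite /=; lia.
    move=> q /=; rewrite ?ET h; case: eqP => [->|ne]; first by rewrite ifT ?addKn //; lia.
    by congr (if _ then _ else _); lia.
  + move=> s2 t2 f2 _ [tb2 h] frm; apply: QP.
    * by [].
    * by rewrite /=; lia.
    * move=> p q pq ql e; rewrite !h !ifT ?addKn; [exact: g1|lia|lia].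
    * move=> p pl; have [q [ql qb] e] := g2 p pl; exists q; first by [].
      by rewrite h ifT ?addKn ?e //; lia.
    * move=> p pl; have [q [ql qb] e] := g3 p pl; exists q; first by [].
      by rewrite h ifT ?addKn -?e //; lia.
    * by move=> q qb; rewrite h ifF //; apply/negbTE.
Qed.

Lemma block_map_valid f g len b : block_map g f len b -> valid f 0 len -> valid g 0 len.
Proof. by move=> m v p /= /m[q [ql _] <-]; apply: v. Qed.

Lemma block_map_distinct f g len b :
  block_map g f len b -> block_sorted g len b -> distinct f 0 len -> distinct g 0 len.
Proof.
move=> m so d p q /= pl ql e.
have [p' [p'l pb] ep] := m p pl; have [q' [q'l qb] eq_] := m q ql.
have pq' : p' = q' by apply: d => //; rewrite ep eq_.
have pqb : p %/ b = q %/ b by rewrite -pb -qb pq'.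
by case: (ltngtP p q) => // h; [have := so p q h ql pqb | have := so q p h pl (esym pqb)];
  rewrite e ltnn.
Qed.

Lemma block_map_trans f g h len b c :
  0 < b -> b %| c -> block_map f g len b -> block_map g h len c -> block_map f h len c.
Proof.
move=> b0 /dvdnP[d ->] m1 m2 p pl; have [q [ql qb] e] := m1 p pl.
have [r [rl rb] e'] := m2 q ql; exists r; last by rewrite e'.
by split=> //; rewrite rb mulnC !divnMA qb.
Qed.

Lemma sort_spec (Q : state -> nat -> Prop) s t lo len be (f := fun q => arrs s aA (lo + q)) :
  vars s vlo = lo -> vars s vlen = len -> vars s vb = 2 ^ be ->
  lo + 2 * len + 4 * 2 ^ be + 10 < W -> valid f 0 len -> distinct f 0 len ->
  (forall s' t' (g := fun q => arrs s' aA (lo + q)), frame sort_cmd s s' ->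
     t' <= t + (150 * len + 80) * be + 20 -> block_sorted g len (2 ^ be) ->
     block_map f g len (2 ^ be) -> block_map g f len (2 ^ be) ->
     (forall q, ~~ (lo <= q < lo + len) -> arrs s' aA q = arrs s aA q) -> Q s' t') ->
  ex sort_cmd Q s t.
Proof.
move=> Elo Elen Eb WW fv fd QP.
apply: ex_framed; rewrite {1}/sort_cmd; step.
pose I s' (t' : nat) := exists r, let g := fun q => arrs s' aA (lo + q) in
  [/\ vars s' vwd = 2 ^ r /\ r <= be, block_sorted g len (2 ^ r), block_map f g len (2 ^ r),
      block_map g f len (2 ^ r) & forall q, ~~ (lo <= q < lo + len) -> arrs s' aA q = arrs s aA q]
  /\ t' <= t + (150 * len + 80) * r + 4.
apply: (ex_while (I := I) (mu := fun s => 2 ^ be - vars s vwd)).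
- exists 0; rewrite /= muln0; split; last by lia.
  split=> //.
  + by move=> p q pq _; rewrite !divn1; lia.
  + by move=> p pl; exists p.
  + by move=> p pl; exists p.
- move=> s1 t1 fr [r [[[Ewd rb] g1 g2 g3 g4] tb]]; base fr; framev fr.
  have p0 : 0 < 2 ^ r by rewrite expn_gt0.
  have pb : 2 ^ r <= 2 ^ be by rewrite leq_exp2l.
  rewrite (ev_lt (u := 2 ^ r) (v := 2 ^ be)) //; try lia.
  rewrite ltn_exp2l // eqb0 negbK => rlt.
  apply: ex_seq; apply: (@pass_spec _ _ _ lo len (2 ^ r)) => //.
  + by lia.
  + exact: block_map_valid g3 fv.
  + exact: block_map_distinct g3 g1 fd.
  move=> s2 t2 g fr2 t2b h1 h2 h3 h4; base fr2; framev fr2.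
  have pS : 2 * 2 ^ r <= 2 ^ be by rewrite -expnS leq_exp2l.
  step; split; last by rewrite /=; lia.
  rewrite /= in t2b; exists r.+1; rewrite /= !expnS; split; last by lia.
  split=> //.
  + by apply: block_map_trans g2 h2 => //; rewrite dvdn_mull.
  + move=> p pl; have [q [ql qb] e] := h3 p pl; have [q' [q'l q'b] e'] := g3 q ql.
    by exists q'; rewrite ?e' //; split=> //; rewrite -qb mulnC !divnMA q'b.
  + by move=> q qb; rewrite h4 // g4.
- move=> s1 t1 fr [r [[[Ewd rb] g1 g2 g3 g4] tb]] ev0 frm; base fr; framev fr.
  have pb : 2 ^ r <= 2 ^ be by rewrite leq_exp2l.
  move: ev0; rewrite (ev_lt (u := 2 ^ r) (v := 2 ^ be)) //; try lia.
  rewrite ltn_exp2l // => /eqP; rewrite eqb0 -leqNgt => br.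
  have er : r = be by apply/eqP; rewrite eqn_leq rb.
  by rewrite er in g1 g2 g3 tb; apply: QP => //=; lia.
Qed.
End Sort.

(** * Local search and placement in a sorted list *)

Notation vO := 50. Notation vNn := 51. Notation vBb := 52. Notation vR := 53.
Notation vcl := 54. Notation vp := 55. Notation vx := 56. Notation vg := 57.
Notation vd := 58. Notation vrun := 59. Notation vq2 := 60.
Notation aC := 13. Notation aPos := 14. Notation aCnt := 15. Notation aNC := 16.

(* Positions beyond the end count as larger than [vx]. *)
Definition probe_cmd arr len :=
  vf ::= K 1 ;;
  If (V vg +! V vd <! V len +! K 1) (Compare vf (V vx) (Get arr (V vg +! V vd -: K 1))) Skip.

Definition descend_cmd arr len :=
  While (K 1 <! V vd) (
    vd ::= V vd /! K 2 ;; probe_cmd arr len ;; If (V vf) Skip (vg ::= V vg +! V vd)).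

Section Search.
Variables (w : nat) (lt : rel nat) (n : nat) (rk : nat -> nat).
Hypothesis ltP : forall i j, i < n -> j < n -> lt i j = (rk i < rk j).
Notation ex := (ex w (Some lt)).
Notation W := (2 ^ w).
Variables (arr len : nat).
Hypothesis lenf : len != vf.

Lemma probe_spec (Q : state -> nat -> Prop) s t g d x l :
  vars s vg = g -> vars s vd = d -> vars s vx = x -> vars s len = l ->
  g + d + l + 10 < W -> valid n (arrs s arr) 0 l -> x < n -> 0 < d ->
  (forall s' t', frame (probe_cmd arr len) s s' ->
    vars s' vf = ((g + d <= l) ==> (rk x < rk (arrs s arr (g + d).-1))) ->
    t' <= t + 25 -> Q s' t') ->
  ex (probe_cmd arr len) Q s t.
Proof using ltP lenf.
move=> Eg Ed Ex El WW fv xn d0 QP; apply: ex_framed.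
rewrite {1}/probe_cmd; step.
have El' : vars (set_var s vf 1) len = l by rewrite /= (negbTE lenf).
eapply ex_if; first by eapply ev_lt; [ev | eapply ev_add; [exact: El' | ev | side] | side].
rewrite eqb0 negbK addn1 ltnS /=.
have [gl|gl] := leqP (g + d) l; rewrite /=.
  step => frm; apply: QP => //; rewrite /=; last by lia.
  by rewrite ltP ?subn1 ?gl ?implyTb //; apply: (fv); lia.
by step => frm; apply: QP => //=; lia.
Qed.

Hypothesis lend : (len != vd) && (len != vg).

(** Binary search by halving the step d: all positions below g hold ranks at most that of x, and
    position g + d - 1 holds a larger one or lies beyond the end. At d = 1 the position g itself is
    the boundary, so neither the length nor the start has to fit the power of 2. *)
Lemma descend_spec (Q : state -> nat -> Prop) s t g de x l (f := arrs s arr) :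
  vars s vg = g -> vars s vd = 2 ^ de -> vars s vx = x -> vars s len = l ->
  g <= l -> 2 * l + 3 * 2 ^ de + 10 < W -> valid n f 0 l -> incr rk f 0 l -> x < n ->
  (forall q, q < g -> rk (f q) <= rk x) ->
  (g + 2 ^ de <= l -> rk x < rk (f (g + 2 ^ de).-1)) ->
  (forall s' t' g', frame (descend_cmd arr len) s s' -> vars s' vg = g' ->
    g <= g' <= l -> (forall q, q < g' -> rk (f q) <= rk x) -> (g' < l -> rk x < rk (f g')) ->
    t' <= t + 60 * de + 10 -> Q s' t') ->
  ex (descend_cmd arr len) Q s t.
Proof using ltP lenf lend.
move=> Eg Ed Ex El gl WW fv fi xn lo hi QP; apply: ex_framed.
rewrite {1}/descend_cmd.
pose I s' (t' : nat) := exists g' r, [/\ vars s' vg = g', vars s' vd = 2 ^ r, g <= g' <= l /\ r <= de,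
   (forall q, q < g' -> rk (f q) <= rk x) & (g' + 2 ^ r <= l -> rk x < rk (f (g' + 2 ^ r).-1))]
  /\ t' + 60 * r <= t + 60 * de.
apply: (ex_while (I := I) (mu := fun s => vars s vd)).
- by exists g, de; split; [split=> //; lia|lia].
- move=> s1 t1 fr [g' [r [[Eg' Ed' [g'b rde] lo' hi'] tb]]].
  have El1 : vars s1 len = l.
    by case: fr => fr _; rewrite fr // !inE !negb_or lenf; move: lend => /andP[-> ->].
  framev fr; rewrite (ev_lt (u := 1) (v := 2 ^ r)) ?evC //; try lia.
  case: r => [|r] in Ed' rde hi' tb *; first by rewrite expn0.
  have p2 : 2 ^ r.+1 = 2 * 2 ^ r by rewrite expnS.
  have pde : 2 ^ r.+1 <= 2 ^ de by rewrite leq_exp2l.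
  have p0 : 0 < 2 ^ r by rewrite expn_gt0.
  move=> _; step; rewrite p2 mulKn //; apply: ex_seq.
  have Ef1 : arrs s1 arr = f by case: fr => _; apply.
  have len1 : vars (set_var s1 vd (2 ^ r)) len = l.
    by move: lend => /andP[/negbTE h _] /=; rewrite h.
  apply: (@probe_spec _ _ _ g' (2 ^ r) x l) => //=; try first [lia | by rewrite Ef1].
  move=> s2 t2 fr2 Ef t2b.
  have [E1 E2 E3] : [/\ vars s2 vg = g', vars s2 vd = 2 ^ r & vars s2 vx = x].
    by case: fr2 => fr2 _; rewrite !fr2.
  rewrite Ef1 in Ef.
  step; rewrite eqb0 negbK.
  case: ifPn => c.
    step; split; last by rewrite ?E2; lia.
    exists g', r; split; last by rewrite /= in t2b; lia.
    by split=> //; [lia|move/implyP: c].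
  step; split; last by rewrite /= ?E2; lia.
  move: c; rewrite negb_imply -leqNgt => /andP[c1 c2].
  exists (g' + 2 ^ r), r; split; last by rewrite /= in t2b *; lia.
  split=> //=; first by lia.
    move=> q qb; have [->|ne] := eqVneq q (g' + 2 ^ r).-1; first exact: c2.
    by apply: leq_trans c2; apply: ltnW; apply: fi; lia.
  move=> h; have e : (g' + 2 ^ r + 2 ^ r).-1 = (g' + 2 ^ r.+1).-1 by lia.
  by rewrite e; apply: hi'; lia.
- move=> s1 t1 fr [g' [r [[Eg' Ed' [g'b rde] lo' hi'] tb]]] ev0 frm.
  move: ev0; rewrite (ev_lt (u := 1) (v := 2 ^ r)) ?evC //; try lia.
  case: r => [|r] in Ed' rde hi' tb *; last by rewrite (@ltn_exp2l 2 0).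
  move=> _; apply: (QP _ _ g') => //=; last by lia.
  by rewrite expn0 addn1 in hi'.
Qed.
End Search.

(* [aPos] holds 1 + the position in [aC], and 0 for absent items.  The buckets of
   the elements placed after position g are stored in [aA] from [vR + g * vBb]. *)
Definition place_body :=
  vx ::= Get aA (V vO +! V vp) ;;
  vg ::= Get aPos (Get aA (V vO +! K 4 *! (V vp /! K 4))) ;;
  If (V vg) (
    vd ::= V vBb *! V vBb ;;
    probe_cmd aC vcl ;;
    If (V vf) (
      descend_cmd aC vcl ;;
      If (Get aCnt (V vg) <! V vBb) (
        Put aA (V vR +! V vg *! V vBb +! Get aCnt (V vg)) (V vx) ;;
        Put aCnt (V vg) (Get aCnt (V vg) +! K 1)) Skip)
    Skip)
  Skip.

(** The old list is not copied: its items occur in the level as well and have gone through the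
    placement like all others. *)
Definition place_collect :=
  vrun ::= K 0 ;;
  For vp (K 1) (V vcl +! K 1) (
    vlo ::= V vR +! V vp *! V vBb ;; vlen ::= Get aCnt (V vp) ;; vb ::= V vBb ;; sort_cmd ;;
    For vq2 (K 0) (V vlen) (
      Put aNC (V vrun) (Get aA (V vlo +! V vq2)) ;; vrun ::= V vrun +! K 1)).

(** The items of the old list all belong to the level, so clearing the entries of the level clears
    every nonzero one, in time that depends on the level and not on n. *)
Definition place_reset := For vp (K 0) (V vNn) (Put aPos (Get aA (V vO +! V vp)) (K 0)).

Definition load_cmd src base :=
  For vp (K 0) (V vcl) (
    Put aC (V vp) (Get src (base +! V vp)) ;;
    Put aPos (Get src (base +! V vp)) (V vp +! K 1)).

Definition place_cmd :=
  For vp (K 0) (V vcl +! K 1) (Put aCnt (V vp) (K 0)) ;;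
  For vp (K 0) (V vNn) place_body ;;
  place_collect ;; place_reset ;;
  vcl ::= V vrun ;; load_cmd aNC (K 0).

Lemma incr_card rk f m (T : nat -> nat) nn :
  incr rk f 0 m -> (forall r, r < m -> exists2 q, q < nn & f r = T q) -> m <= nn.
Proof.
move=> fi fT; have <- : size (map f (iota 0 m)) = m by rewrite size_map size_iota.
have <- : size (map T (iota 0 nn)) = nn by rewrite size_map size_iota.

have inj : {in iota 0 m &, injective f}.
  move=> p q; rewrite !mem_iota !add0n /= => pm qm e.
  by case: (ltngtP p q) => // h; [have := fi p q isT h qm|have := fi q p isT h pm]; rewrite e ltnn.
apply: uniq_leq_size; first by rewrite (map_inj_in_uniq inj) iota_uniq.
move=> x /mapP[r]; rewrite mem_iota add0n /= => /fT[q qn ->] ->.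
by rewrite map_f // mem_iota.
Qed.

Section Place.
Variables (w : nat) (lt : rel nat) (n : nat) (rk : nat -> nat).
Hypothesis ltP : forall i j, i < n -> j < n -> lt i j = (rk i < rk j).
Notation ex := (ex w (Some lt)).
Notation W := (2 ^ w).

Variables (o nn be R cl : nat) (T C : nat -> nat).
Notation b := (2 ^ be).
Hypothesis be2 : 2 <= be.
Hypothesis Tv : valid n T 0 nn.
Hypothesis Td : distinct rk T 0 nn.
Hypothesis Tseed : forall p, p < nn -> rk (T (4 * (p %/ 4))) <= rk (T p).
Hypothesis Cv : valid n C 0 cl.
Hypothesis Ci : incr rk C 0 cl.
Hypothesis oR : o + nn <= R.
Hypothesis clnn : cl <= nn.
Hypothesis WW : 4 * (R + (cl + 2) * b + 4 * (b * b) + nn + 100) < W.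

(** For 0 < g <= cl: exactly the first g items of C have rank at most that of x. *)
Definition floor_at g x := rk (C g.-1) <= rk x /\ (g < cl -> rk x < rk (C g)).

(* An element is lost if the sampled element before it is absent, if it lies too
   far beyond that element, or if its bucket is full. *)
Definition lost_reason p :=
  [\/ forall r, r < cl -> C r <> T (4 * (p %/ 4)),
      exists g, [/\ 0 < g <= cl, C g.-1 = T (4 * (p %/ 4)), g + b * b <= cl
                  & rk (C (g + b * b).-1) <= rk (T p)]
    | exists g l, [/\ 0 < g <= cl, floor_at g (T p), sorted ltn l, size l = b
                  & forall q, q \in l -> q < nn /\ floor_at g (T q)]].

Definition pos_ok (pos C : nat -> nat) cl x :=
  (pos x = 0 /\ forall r, r < cl -> C r <> x) \/ (0 < pos x <= cl /\ C (pos x).-1 = x).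

(** [bk g] lists positions in T rather than items, in order of arrival; it is therefore increasing,
    which gives distinctness for free. *)
Definition placed (bk : nat -> seq nat) i := forall g, 0 < g <= cl ->
  [/\ size (bk g) <= b, sorted ltn (bk g) & forall q, q \in bk g -> q < i /\ floor_at g (T q)].

Definition decided (bk : nat -> seq nat) i := forall p, p < i ->
  (exists2 g, 0 < g <= cl & p \in bk g) \/ lost_reason p.

Definition stored (s : state) (bk : nat -> seq nat) := forall g, 0 < g <= cl ->
  arrs s aCnt g = size (bk g) /\
  forall r, r < size (bk g) -> arrs s aA (R + g * b + r) = T (nth 0 (bk g) r).

Definition place_loop := For vp (K 0) (V vNn) place_body.

(** An item is searched only within distance b^2 of its sampled item, so the descent takes 2 be
    rounds and the time per item is O(log b), however long C is. *)
Lemma place_loop_spec (Q : state -> nat -> Prop) s t :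
  vars s vO = o -> vars s vNn = nn -> vars s vBb = b -> vars s vR = R -> vars s vcl = cl ->
  arrs s aC = C -> (forall p, p < nn -> arrs s aA (o + p) = T p) ->
  (forall p, p < nn -> pos_ok (arrs s aPos) C cl (T p)) ->
  (forall g, g <= cl -> arrs s aCnt g = 0) ->
  (forall s' t' bk, frame place_loop s s' -> placed bk nn -> decided bk nn -> stored s' bk ->
    (forall q, q < R -> arrs s' aA q = arrs s aA q) ->
    t' <= t + nn * (120 * be + 150) + 10 -> Q s' t') ->
  ex place_loop Q s t.
Proof.
move=> EO EN EB ER Ecl EC EA pok cnt0 QP; apply: ex_framed; rewrite {1}/place_loop.
have b0 : 0 < b by rewrite expn_gt0.
pose I (i : nat) s' (t' : nat) := exists bk, [/\ placed bk i, decided bk i, stored s' bk,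
  (forall q, q < R -> arrs s' aA q = arrs s aA q) & t' <= t + i * (120 * be + 150) + 5].
apply: (ex_for (I := I) (a := 0) (b := nn)); [by ev|lia|lia|by []|..].
- exists (fun=> [::]); split=> //=; last by lia.
  by move=> g gb; split=> //=; rewrite cnt0 //; lia.
- by move=> s1 i t1 fr _ _; base fr; framev fr; ev.
- move=> s1 i t1 fr ib Ei [bk [h1 h2 h3 h4 tb]]; base fr; framev fr.
  have h2' : decided bk i -> lost_reason i -> decided bk i.+1.
    move=> d li p; rewrite ltnS leq_eqVlt => /predU1P[->|pi]; first by right.
    exact: d.
  have h1' : placed bk i.+1.
    move=> g gb; have [? ? q] := h1 g gb; split=> // p /q[]; split=> //; lia.
  have mb : 4 * (i %/ 4) <= i by rewrite mulnC leq_divM.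
  have EAi p : p < nn -> arrs s1 aA (o + p) = T p by move=> pn; rewrite h4 ?EA //; lia.
  have EPos : arrs s1 aPos = arrs s aPos by case: fr => _; apply.
  rewrite /place_body; step; rewrite EAi //; step.
  rewrite EAi; last by lia.
  rewrite -/(arrs s1 _); set g0 := arrs s aPos _.
  step.
  (* All three ways of losing the item leave the buckets as they were. *)
  have fin s2 t2 : lost_reason i -> same_but [:: vx; vg; vd; vf] [::] s1 s2 -> t2 <= t1 + 120 * be + 140 ->
      vars s2 vp = i -> I i.+1 (set_var s2 vp i.+1) (t2 + 4).
    move=> li f2 tb2 _; exists bk; split=> //; first by apply: h2'.
    - move=> g gb; have [c d] := h3 g gb; case: (f2) => _ fa; rewrite /= !fa //.
    - by move=> q qR; case: (f2) => _ fa; rewrite /= fa // h4.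
    - by rewrite mulSn /=; lia.
  have := pok (4 * (i %/ 4)) ltac:(lia); rewrite /pos_ok -/g0.
  case=> [[-> nC] | [g0b Cg0]] /=.
    rewrite /=; step; apply: fin; first by constructor 1.
      by split=> // x; rewrite !inE /= => /norP[/negbTE-> /norP[/negbTE-> _]].
    by lia.
  have -> : g0 != 0 by lia.
  rewrite /=; step.
  have xn : T i < n by apply: Tv; lia.
  have EC1 : arrs s1 aC = C by case: fr => _ h; rewrite h.
  apply: ex_seq; apply: (@probe_spec w lt n rk ltP aC vcl isT _ _ _ g0 (b * b) (T i) cl); rewrite /= ?EC1 //; try lia.
  move=> s2 t2 f2 Ef t2b.
  have [Hg Hd Hx] : [/\ vars s2 vg = g0, vars s2 vd = b * b & vars s2 vx = T i].
    by case: f2 => h _; rewrite !h.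
  base f2; framev f2; rewrite /= in t2b.
  have x2 : b * b = 2 ^ (2 * be) by rewrite -expnD; congr (2 ^ _); lia.
  step; rewrite eqb0 negbK; case: ifPn => [/implyP c|]; last first.
    rewrite negb_imply -leqNgt => /andP[c1 c2].
    step; apply: fin => //; last by lia.
      by constructor 2; exists g0.
    by weaken f2.
  have EC2 : arrs s2 aC = C by case: f2 => _ h; rewrite h.
  apply: ex_seq.
  apply: (@descend_spec w lt n rk ltP aC vcl isT isT _ _ _ g0 (2 * be) (T i) cl); rewrite /= ?EC2 -?x2 //; try lia.
  - move=> q qg; have hs : rk (C g0.-1) <= rk (T i) by rewrite Cg0; apply: Tseed; lia.
    apply: leq_trans hs; have [->//|ne] := eqVneq q g0.-1.
    by apply: ltnW; apply: Ci; lia.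
  move=> s3 t3 g f3 Eg gb lo hi t3b.
  have Hx3 : vars s3 vx = T i by case: (f3) => h _; rewrite h.
  have Hc3 : arrs s3 aCnt = arrs s1 aCnt by case: (f3) => _ h; rewrite h //; case: f2 => _ h2''; rewrite h2''.
  have HA3 : arrs s3 aA = arrs s1 aA by case: (f3) => _ h; rewrite h //; case: f2 => _ h2''; rewrite h2''.
  have gb' : 0 < g <= cl by lia.
  have [cg Ag] := h3 g gb'; have [sb so mem] := h1 g gb'.
  framev f3.
  have fl : floor_at g (T i) by split; [apply: lo; lia|exact: hi].
  step; rewrite ?Hc3 cg eqb0 negbK; case: ltnP => c'; last first.
    step; apply: fin => //; last by lia.
      constructor 3; exists g, (bk g); split=> //; first by apply/eqP; rewrite eqn_leq sb.
      by move=> q /mem[qi fq]; split=> //; lia.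
    by have f23 := same_but_cat f2 f3; weaken f23.
  have gbb : g * b + size (bk g) < (cl + 2) * b.
    by have : g * b <= cl * b; [rewrite leq_mul2r; lia|rewrite mulnDl; lia].
  step; step => _.
  exists (fun h => if h == g then rcons (bk g) i else bk h); rewrite /=; split.
  - move=> h hb; case: eqP => [->|_]; last exact: h1'.
    rewrite size_rcons; split=> //.
      rewrite (sorted_pairwise ltn_trans) pairwise_rcons -(sorted_pairwise ltn_trans) so andbT.
      by apply/allP => q /mem[].
    move=> q; rewrite mem_rcons inE => /orP[/eqP->|/mem[]]; split=> //; lia.
  - move=> p; rewrite ltnS leq_eqVlt => /predU1P[->|pi].
      by left; exists g; rewrite // eqxx mem_rcons mem_head.
    have [[h hb ph]|] := h2 p pi; last by right.
    by left; exists h => //; case: eqP => // <-; rewrite mem_rcons inE ph orbT.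
  - move=> h hb; have [ch Ah] := h3 h hb; rewrite /= ?HA3 ?Hc3; case: eqP => [hg|hg].
      rewrite hg size_rcons; split; first by rewrite addn1 cg.
      move=> r; rewrite ltnS leq_eqVlt nth_rcons => /predU1P[->|rs].
        by rewrite cg eqxx ltnn eqxx.
      rewrite rs ifF ?Ag //; apply/eqP; lia.
    split=> // r rs; rewrite ifF ?Ah //; apply/eqP => e.
    have [sbh _ _] := h1 h hb.
    have rb : r < b by lia.
    have sb' : size (bk g) < b by [].
    suff : h = g by [].
    (* A bucket with room has its free slot inside its own b cells, so dividing the address by b
       recovers the bucket: the new entry overwrites nothing stored. *)
    have e' : h * b + r = g * b + size (bk g) by rewrite cg in e; lia.
    by have := congr1 (fun z => z %/ b) e'; rewrite !divnMDl ?expn_gt0 // !divn_small // !addn0.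
  - by move=> q qR; rewrite /= ifF ?HA3 ?h4 //; apply/eqP; lia.
  - by rewrite mulSn; lia.
- move=> s1 t1 fr _ [bk [h1 h2 h3 h4 tb]] frm; apply: (QP _ _ bk) => //.
  by rewrite /=; lia.
Qed.

(** Some item of C lies between different buckets, so sorting each bucket and concatenating them
    yields an increasing list. *)
Lemma floor_lt g g' x y : 0 < g -> g < g' -> g' <= cl -> floor_at g x -> floor_at g' y ->
  rk x < rk y.
Proof.
clear -Ci; move=> g0 gg gcl [_ x1] [y1 _]; have {}x1 := x1 ltac:(lia).
apply: leq_trans x1 _; apply: leq_trans y1.
have [->|ne] := eqVneq g g'.-1; first by [].
by apply: ltnW; apply: Ci; lia.
Qed.

Lemma place_collect_spec (Q : state -> nat -> Prop) s t bk :
  vars s vBb = b -> vars s vR = R -> vars s vcl = cl ->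
  placed bk nn -> stored s bk ->
  (forall s' t' run (f := arrs s' aNC), frame place_collect s s' -> vars s' vrun = run ->
    incr rk f 0 run -> (forall r, r < run -> exists2 q, q < nn & f r = T q) ->
    (forall g q, 0 < g <= cl -> q \in bk g -> exists2 r, r < run & f r = T q) ->
    (forall q, q < R -> arrs s' aA q = arrs s aA q) ->
    t' <= t + 180 * be * (nn + cl) + 20 -> Q s' t') ->
  ex place_collect Q s t.
Proof.
move=> EB ER Ecl pl st0 QP; apply: ex_framed; rewrite {1}/place_collect; step.
have b0 : 0 < b by rewrite expn_gt0.
pose I (g : nat) s' (t' : nat) := exists run, let f := arrs s' aNC in
  [/\ vars s' vrun = run, incr rk f 0 run,
     forall r, r < run -> exists q, [/\ q < nn, f r = T q &
       exists2 g', 0 < g' < g & floor_at g' (f r)],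
     forall g' q, 0 < g' < g -> q \in bk g' -> exists2 r, r < run & f r = T q &
     forall q, ~~ (R + b <= q < R + g * b) -> arrs s' aA q = arrs s aA q]
  /\ t' <= t + 180 * be * run + 180 * be * g.-1 + 6.
apply: (ex_for (I := I) (a := 1) (b := cl.+1)); [by ev|lia|nia|by []|..].
- exists 0; rewrite /=; split; last by lia.
  by split=> // g' q; lia.
- by move=> s1 i t1 fr _ _; base fr; framev fr; rewrite -[cl.+1]addn1; ev.
- move=> s1 g t1 fr gb Eg [run [[Erun f1 f2 f3 f4] tb]]; base fr; framev fr.
  have runn : run <= nn.
    by apply: (incr_card (T := T) f1) => r /f2[q [qn e _]]; exists q.
  have gcl : 0 < g <= cl by lia.
  have [sb so mem] := pl g gcl; have [cg Ag] := st0 g gcl.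
  have EC1 : arrs s1 aCnt = arrs s aCnt by case: fr => _ h; rewrite h.
  have gB : g * b <= cl * b by rewrite leq_mul2r; lia.
  have gB1 : b <= g * b by rewrite leq_pmull; lia.
  have gB2 : (cl + 2) * b = cl * b + 2 * b by rewrite mulnDl.
  have bb : b <= b * b by rewrite leq_pmull.
  have nthlt q : q < size (bk g) -> nth 0 (bk g) q < nn by move=> h; case: (mem _ (mem_nth 0 h)).
  have ub : uniq (bk g) by apply: (sorted_uniq ltn_trans ltnn).
  have Asz q : q < size (bk g) -> arrs s1 aA (R + g * b + q) = T (nth 0 (bk g) q).
    by move=> h; rewrite f4 ?Ag //; lia.
  have ib : g.+1 * b = g * b + b by rewrite mulSn addnC.
  step; step; step; rewrite ?EC1 cg.
  apply: ex_seq; apply: (@sort_spec w lt n rk ltP _ _ _ (R + g * b) (size (bk g)) be);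
    rewrite /= ?EC1 //; try lia.
  + by move=> q qs; rewrite Asz //; apply: Tv; rewrite nthlt.
  + move=> p q ps qs; rewrite !Asz // => /Td e; apply/eqP.
    by rewrite -(nth_uniq 0 ps qs ub); apply/eqP; apply: e; rewrite /= nthlt.
  move=> s2 t2 fs t2b; set f := fun q => arrs s2 aA _; move=> srt m1 m2 out; rewrite /= in t2b.
  have [Elen Elo] : vars s2 vlen = size (bk g) /\ vars s2 vlo = R + g * b.
    by case: fs => h _; rewrite !h.
  base fs; framev fs.
  have ENC2 : arrs s2 aNC = arrs s1 aNC by case: fs => _ h; rewrite h.
  have srt' p q : p < q -> q < size (bk g) -> rk (f p) < rk (f q).
    by move=> pq qs; apply: srt => //; rewrite !divn_small //; lia.
  have fT q : q < size (bk g) -> exists2 p, p < nn & f q = T p /\ floor_at g (f q).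
    move=> qs; have [p [ps _] e] := m2 q qs; rewrite Asz // in e.
    have [pn fl] := mem _ (mem_nth 0 ps).
    by exists (nth 0 (bk g) p); rewrite // -e.
  pose J (i : nat) s' (t' : nat) := let h := arrs s' aNC in
    [/\ vars s' vrun = run + i, incr rk h 0 (run + i), forall r, r < run -> h r = arrs s1 aNC r,
       forall r, r < i -> h (run + r) = f r & t' <= t2 + 25 * i + 10].
  apply: (ex_for (I := J) (a := 0) (b := size (bk g))); [by ev|lia|lia|by []|..].
  + split; rewrite /= ?addn0 ?ENC2 //; lia.
  + by move=> s3 i t3 f3' _ _; base f3'; framev f3'; ev.
  + move=> s3 i t3 f3' ii Ei [Er j1 j2 j3 tb3]; base f3'; framev f3'.
    have EA3 : arrs s3 aA = arrs s2 aA by case: f3' => _ h; rewrite h.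
    step; step => _; split; rewrite /= ?EA3.
    * by lia.
    * rewrite addnS => p q _ pq; rewrite ltnS leq_eqVlt => /predU1P[eq_|qr]; last first.
        by rewrite !ifF; [apply: j1|apply/eqP; lia|apply/eqP; lia].
      rewrite eq_ eqxx ifF; last by apply/eqP; lia.
      have [pr|rp] := ltnP p run; last first.
        have -> : p = run + (p - run) by lia.
        by rewrite j3; [apply: srt'; lia|lia].
      rewrite j2 //; have [q' [_ _ [g' g'b fl']]] := f2 p pr.
      have [|q2 _ [_ fl2]] := fT i; first by lia.
      by apply: floor_lt fl' fl2; lia.
    * by move=> r rr; rewrite ifF ?j2 //; apply/eqP; lia.
    * move=> r; rewrite ltnS leq_eqVlt => /predU1P[->|ri]; first by rewrite eqxx.
      by rewrite ifF ?j3 //; apply/eqP; lia.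
    * by lia.
  + move=> s3 t3 f3' _ [Er j1 j2 j3 tb3]; base f3'; framev f3' => _.
    exists (run + size (bk g)); rewrite /=; split; last first.
      have : (150 * size (bk g) + 80) * be = 150 * be * size (bk g) + 80 * be by rewrite mulnDl mulnAC.
      have : size (bk g) <= be * size (bk g) by rewrite leq_pmull; lia.
      have : 180 * be * g = 180 * be * g.-1 + 180 * be by rewrite -mulnSr prednK; lia.
      move: tb; rewrite /= mulnDr.
      by move: (180 * be * g) (180 * be * g.-1) => z z'; lia.
    have EA3 : arrs s3 aA = arrs s2 aA by case: f3' => _ h; rewrite h.
    split=> //.
    * move=> r rs; have [rr|rr] := ltnP r run.
        have [q [qn e [g' g'b fl]]] := f2 r rr; exists q; rewrite j2 //; split=> //.
        by exists g' => //; lia.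
      have e : arrs s3 aNC r = f (r - run) by rewrite -j3; [congr (arrs _ _ _)|]; lia.
      have [|q qn [e' fl]] := fT (r - run); first by lia.
      by exists q; rewrite e; split=> //; exists g => //; lia.
    * move=> g' q g'b qg; have [gg|ne] := eqVneq g' g; last first.
        have [|r rr e] := f3 g' q _ qg; first by lia.
        by exists r; [lia|rewrite j2].
      rewrite gg in qg; have := m1 (index q (bk g)); rewrite index_mem qg => /(_ isT)[r [rr _] e].
      exists (run + r); first by lia.
      by rewrite j3 // -[RHS]/(T q) e Asz ?index_mem // nth_index.
    * by move=> q qb; rewrite EA3 out ?f4 //; lia.
- move=> s1 t1 fr _ [run [[Erun f1 f2 f3 f4] tb]] frm.
  have runn : run <= nn.
    by apply: (incr_card (T := T) f1) => r /f2[q [qn e _]]; exists q.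
  apply: (QP _ _ run) => //.
  + by move=> r /f2[q [qn e _]]; exists q.
  + by move=> q qR; apply: f4; lia.
  + by rewrite /= in tb *; nia.
Qed.

Lemma load_spec (Q : state -> nat -> Prop) s t src base B0 m (f := fun r => arrs s src (B0 + r)) :
  src \notin [:: aC; aPos] -> vars s vcl = m -> B0 + m + 10 < W ->
  (forall s', same_but [:: vp] [:: aC; aPos] s s' -> eval w s' base = B0) -> cost base <= 1 ->
  incr rk f 0 m ->
  (forall s' t' (g := arrs s' aC), frame (load_cmd src base) s s' ->
    (forall r, r < m -> g r = f r) ->
    (forall x, arrs s aPos x = 0 -> pos_ok (arrs s' aPos) g m x) ->
    t' <= t + 40 * m + 10 -> Q s' t') ->
  ex (load_cmd src base) Q s t.
Proof.
clear -base; move=> srcN Ecl BW eb cb fi QP; apply: ex_framed; rewrite {1}/load_cmd.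
pose I (i : nat) s' (t' : nat) := [/\ forall r, r < i -> arrs s' aC r = f r,
  forall r, r < i -> arrs s' aPos (f r) = r.+1,
  forall x, (forall r, r < i -> f r <> x) -> arrs s' aPos x = arrs s aPos x & t' <= t + 40 * i + 2].
apply: (ex_for (I := I) (a := 0) (b := m)); [by ev|lia|lia|by []|..].
- by split=> //=; lia.
- by move=> s1 i t1 fr _ _; base fr; framev fr; ev.
- move=> s1 i t1 fr ib Ei [h1 h2 h3 tb]; base fr; framev fr.
  have ES : arrs s1 src = arrs s src by case: fr => _ h; rewrite h.
  have EB1 : eval w s1 base = B0 by apply: eb; weaken fr.
  apply: ex_seq; eapply ex_put; first by ev.
    by eapply evG; eapply ev_add; [exact: EB1|ev|lia].
  eapply ex_put.
  + eapply evG; eapply ev_add; [apply: eb|ev|lia].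
    by have h := same_but_set_arr; split=> x xN; case: fr => fv fa /=; rewrite ?fv ?fa //;
      move: xN; rewrite !inE ?negb_or => /andP[/negbTE-> //].
  + by ev.
  rewrite /= => _.
  have -> : (src == 13) = false by move: srcN; rewrite !inE negb_or => /andP[/negbTE].
  rewrite /= ES -/(f i); rwv.
  split; rewrite /=; last by lia.
  + move=> r; rewrite ltnS leq_eqVlt => /predU1P[->|ri]; first by rewrite eqxx.
    by rewrite ifF ?h1 //; apply/eqP; lia.
  + move=> r; rewrite ltnS leq_eqVlt => /predU1P[->|ri]; first by rewrite eqxx addn1.
    rewrite ifF ?h2 //; apply/eqP => e.
    by have := fi r i isT ri ltac:(lia); rewrite e ltnn.
  + move=> x hx; rewrite ifF ?h3 // => [r ri|]; first by apply: hx; lia.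
    by apply/eqP => e; apply: (hx i) => //.
- move=> s1 t1 fr Ei [h1 h2 h3 tb] frm; apply: QP => //=; last by lia.
  move=> x px.
  have [[r rm e]|nx] : (exists2 r, r < m & f r = x) \/ forall r, r < m -> f r <> x.
    case: (boolP (x \in map f (iota 0 m))) => [/mapP[r]|nin].
      by rewrite mem_iota => rm ->; left; exists r.
    by right=> r rm e; move/negP: nin; apply; rewrite -e map_f // mem_iota.
  right; rewrite -e h2 //=; split; [lia|exact: h1].
left; rewrite h3 //; split=> // r rm; rewrite h1 //; exact: nx.
Qed.

(** [D] holds the items whose entries in [aPos] must stay valid. It is larger than the level at
    hand, because the next finer level looks up items that are absent from this one. *)
Lemma place_spec (Q : state -> nat -> Prop) s t (D : nat -> Prop) :
  vars s vO = o -> vars s vNn = nn -> vars s vBb = b -> vars s vR = R -> vars s vcl = cl ->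
  arrs s aC = C -> (forall p, p < nn -> arrs s aA (o + p) = T p) ->
  (forall p, p < nn -> D (T p)) -> (forall r, r < cl -> exists2 p, p < nn & C r = T p) ->
  (forall x, D x -> pos_ok (arrs s aPos) C cl x) ->
  (forall s' t' cl' (C' := arrs s' aC), frame place_cmd s s' -> vars s' vcl = cl' ->
    incr rk C' 0 cl' -> (forall r, r < cl' -> exists2 p, p < nn & C' r = T p) ->
    (forall x, D x -> pos_ok (arrs s' aPos) C' cl' x) ->
    (forall p, p < nn -> (exists2 r, r < cl' & C' r = T p) \/ lost_reason p) ->
    (forall q, q < R -> arrs s' aA q = arrs s aA q) ->
    t' <= t + 600 * be * nn + 300 * be -> Q s' t') ->
  ex place_cmd Q s t.
Proof.
move=> EO EN EB ER Ecl EC EA DT CT pok QP; apply: ex_framed; rewrite {1}/place_cmd.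
have b0 : 0 < b by rewrite expn_gt0.
have clb : cl <= cl * b by rewrite leq_pmulr.
have WW' := WW; rewrite mulnDl in WW'.
apply: ex_seq.
pose I0 (i : nat) s' (t' : nat) := (forall g, g < i -> arrs s' aCnt g = 0) /\ t' <= t + 15 * i + 2.
apply: (ex_for (I := I0) (a := 0) (b := cl.+1)); [by ev|lia|lia|by []|..].
- by split=> //=; lia.
- by move=> s1 i t1 fr _ _; base fr; framev fr; rewrite -[cl.+1]addn1; ev.
- move=> s1 i t1 fr ib Ei [h tb]; base fr; framev fr; step => _.
  split; last by rewrite /=; lia.
  move=> g; rewrite ltnS leq_eqVlt /= => /predU1P[->|gi]; first by rewrite eqxx.
  by rewrite ifF ?h //; apply/eqP; lia.
move=> s1 t1 fr1 _ [cnt0 tb1]; base fr1; framev fr1.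
have EA1 : arrs s1 aA = arrs s aA by case: fr1 => _ h; rewrite h.
have EP1 : arrs s1 aPos = arrs s aPos by case: fr1 => _ h; rewrite h.
apply: ex_seq; apply: place_loop_spec => //.
- by move=> p pn; rewrite EA1 EA.
- by move=> p pn; rewrite EP1; apply: pok; apply: DT.
move=> s2 t2 bk fr2 pl dec st2 A2 t2b; framev fr2.
have EP2 : arrs s2 aPos = arrs s aPos by case: fr2 => _ h; rewrite h ?EP1.
apply: ex_seq; apply: (place_collect_spec _ _ _ pl) => //.
move=> s3 t3 run f fr3 Erun f1 f2 f3 A3 t3b; framev fr3.
have EP3 : arrs s3 aPos = arrs s aPos by case: fr3 => _ h; rewrite h.
have EA3 p : p < nn -> arrs s3 aA (o + p) = T p.
  by move=> pn; rewrite A3 ?A2 ?EA1 ?EA //; lia.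
have runn : run <= nn by apply: incr_card f1 f2.
apply: ex_seq; rewrite {1}/place_reset.
pose I1 (i : nat) s' (t' : nat) := [/\ forall p, p < i -> arrs s' aPos (T p) = 0,
  forall x, (forall p, p < nn -> T p <> x) -> arrs s' aPos x = arrs s aPos x & t' <= t3 + 15 * i + 2].
apply: (ex_for (I := I1) (a := 0) (b := nn)); [by ev|lia|lia|by []|..].
- by split=> //=; [move=> x _; rewrite EP3|lia].
- by move=> s4 i t4 fr _ _; base fr; framev fr; ev.
- move=> s4 i t4 fr ib Ei [h1 h2 tb]; base fr; framev fr.
  have EA4 : arrs s4 aA = arrs s3 aA by case: fr => _ h; rewrite h.
  step => _; rewrite ?EA4 EA3; last by lia.
  split; rewrite /=; last by lia.
    move=> p; rewrite ltnS leq_eqVlt => /predU1P[->|pi]; first by rewrite eqxx.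
    by case: eqP => // _; apply: h1.
  by move=> x hx; case: eqP => [e|_]; [case: (hx i); first lia|apply: h2].
move=> s4 t4 fr4 _ [h1 h2 tb4]; base fr4; framev fr4.
have ER4 : vars s4 vrun = run by case: fr4 => h _; rewrite h.
have EA4 : arrs s4 aA = arrs s3 aA by case: fr4 => _ h; rewrite h.
have EN4 : arrs s4 aNC = f by case: fr4 => _ h; rewrite h.
have P4 x : D x -> arrs s4 aPos x = 0.
  move=> Dx; have [/mapP[p]|nin] := boolP (x \in map T (iota 0 nn)).
    by rewrite mem_iota => pn ->; apply: h1.
  rewrite h2; last by move=> p pn e; move/negP: nin; apply; rewrite -e map_f // mem_iota.
  have [[]//|[xc e]] := pok x Dx.
  have [|p pn e'] := CT (arrs s aPos x).-1; first by lia.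
  by case/negP: nin; rewrite -e e' map_f // mem_iota.
step; apply: (@load_spec _ _ _ _ _ 0 run) => //=.
- by lia.
- by move=> s' _; rewrite mod0n.
- by move=> p q p0 pq qr; rewrite EN4; apply: f1.
move=> s5 t5 fr5 c5 p5 t5b frm.
have Ecl5 : vars s5 vcl = run by case: fr5 => h _; rewrite h.
have EA5 : arrs s5 aA = arrs s3 aA by case: fr5 => _ h; rewrite h.
have c5' r : r < run -> arrs s5 aC r = f r by move=> rr; rewrite c5 // EN4.
apply: (QP _ _ run) => //.
- by move=> p q p0 pq qr; rewrite !c5' //; [apply: f1|lia].
- by move=> r rr; rewrite c5' //; apply: f2.
- by move=> x /P4; apply: p5.
- move=> p pn; have [[g gb pg]|] := dec p pn; last by right.
  by left; have [r rr e] := f3 g p gb pg; exists r; rewrite ?c5'.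
- by move=> q qR; rewrite EA5 A3 ?A2 ?EA1.
- rewrite /= in t2b t3b tb1 t5b.
  have h : 2 * nn <= be * nn by rewrite leq_mul2r be2 orbT.
  have hc : be * cl <= be * nn by rewrite leq_mul2l clnn orbT.
  have e1 : nn * (120 * be + 150) = 120 * (be * nn) + 150 * nn by lia.
  have e2 : 180 * be * (nn + cl) = 180 * (be * nn) + 180 * (be * cl) by lia.
  by rewrite -?mulnA; lia.
Qed.
End Place.

(** * Few elements of an increasing subsequence are lost *)

(** A charging argument: every value of f is hit from within a single block of c consecutive
    positions, so at most c times. *)
Lemma count_fiber (P P' : pred nat) (f : nat -> nat) N c nn :
  0 < c -> (forall p, p < nn -> P p -> f p < N /\ P' (f p)) ->
  (forall p q, p < nn -> q < nn -> P p -> P q -> f p = f q -> p %/ c = q %/ c) ->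
  count P (iota 0 nn) <= c * count P' (iota 0 N).
Proof.
move=> c0 fP fib; rewrite -!sum1_count big_distrr /= muln1.
have -> : \sum_(p <- iota 0 nn | P p) 1 =
    \sum_(y <- iota 0 N | P' y) \sum_(p <- iota 0 nn | P p && (f p == y)) 1.
  rewrite (exchange_big_dep P) /=; last by move=> y p _ /andP[].
  rewrite big_seq_cond [RHS]big_seq_cond; apply: eq_bigr => p; rewrite mem_iota /= => /andP[pn Pp].
  have [fN Pf] := fP p pn Pp.
  rewrite sum1_count (eq_count (a2 := pred1 (f p))) => [|y /=].
    by rewrite count_uniq_mem ?iota_uniq // mem_iota fN.
  by rewrite Pp eq_sym; case: eqP => [->|]; rewrite ?Pf ?andbF.
apply: leq_sum => y _; rewrite sum1_count -size_filter.
set s := filter _ _.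
case E: s => [//|p s']; rewrite -E.
have ps : p \in s by rewrite E mem_head.
have sub : {subset s <= iota (p %/ c * c) c}.
  move=> q; rewrite mem_filter mem_iota => /andP[/andP[Pq /eqP fq] qn].
  move: ps; rewrite mem_filter mem_iota => /andP[/andP[Pp /eqP fp] pn].
  have e : p %/ c = q %/ c by apply: fib => //; rewrite fq.
  by rewrite mem_iota e leq_divM -mulSnr ltn_ceil.
by rewrite -[leqRHS](size_iota (p %/ c * c)); apply: uniq_leq_size => //; rewrite filter_uniq ?iota_uniq.
Qed.

Lemma count_inject (P P' : pred nat) (A B : nat -> nat) m m' :
  (forall p q, p < m -> q < m -> A p = A q -> p = q) ->
  (forall p, p < m -> P p -> exists q, [/\ q < m', P' q & B q = A p]) ->
  count P (iota 0 m) <= count P' (iota 0 m').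
Proof.
move=> Ai AB; rewrite -!size_filter -(size_map A) -[leqRHS](size_map B).
apply: uniq_leq_size.
  have inj : {in filter P (iota 0 m) &, injective A}.
    by move=> p q; rewrite !mem_filter !mem_iota => /andP[_ pm] /andP[_ qm]; apply: Ai.
  by rewrite (map_inj_in_uniq inj) filter_uniq ?iota_uniq.
move=> x /mapP[p]; rewrite mem_filter mem_iota => /andP[Pp pm] ->.
by have [q [qm Pq <-]] := AB p pm Pp; rewrite map_f // mem_filter Pq mem_iota.
Qed.

(** Double counting of the pairs (b, r) with r in [I b]: each r occurs in at most one pair. *)
Lemma count_threshold (P : pred nat) (I : nat -> pred nat) D N m :
  (forall b, P b -> D <= count (I b) (iota 0 m)) ->
  (forall b b' r, r < m -> I b r -> I b' r -> b = b') ->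
  D * count P (iota 0 N) <= m.
Proof.
move=> PD dis; rewrite -sum1_count big_distrr /= muln1.
have h1 : \sum_(b <- iota 0 N | P b) D <= \sum_(b <- iota 0 N | P b) \sum_(r <- iota 0 m | I b r) 1.
  by apply: leq_sum => b Pb; rewrite sum1_count PD.
apply: (leq_trans h1); rewrite (exchange_big_dep predT) //=.
rewrite -[leqRHS](size_iota 0) -sum1_size big_seq [leqRHS]big_seq.
apply: leq_sum => r; rewrite mem_iota => rm.
have [/hasP[b bN /andP[Pb Ib]]|] := boolP (has (fun b => P b && I b r) (iota 0 N)); last first.
  by move/hasPn => h; rewrite big1_seq // => b /andP[PI /h]; rewrite PI.
rewrite sum1_count.
rewrite -size_filter -[leqRHS](size_nseq 1 b); apply: uniq_leq_size; first by rewrite filter_uniq ?iota_uniq.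
by move=> b'; rewrite mem_filter inE => /andP[/andP[_ Ib'] _]; apply/eqP; apply: dis Ib' Ib.
Qed.

(** Turns a count into a threshold: a downward closed set of positions is an initial segment, whose
    length is its cardinality. *)
Lemma count_prefix (P : pred nat) m :
  (forall r r', r <= r' -> r' < m -> P r' -> P r) ->
  forall r, r < m -> P r = (r < count P (iota 0 m)).
Proof.
elim: m => [//|m IH] Pm r rm; rewrite -[m.+1]addn1 iotaD count_cat /= addn0.
have Pm' x y : x <= y -> y < m -> P y -> P x by move=> xy ym; apply: Pm => //; lia.
have cm : count P (iota 0 m) <= m by rewrite -[leqRHS](size_iota 0) count_size.
case Em: (P m).
  have -> : count P (iota 0 m) = m.
    rewrite -[RHS](size_iota 0 m); apply/eqP; rewrite -all_count; apply/allP => x.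
    by rewrite mem_iota => xm; apply: Pm Em; lia.
  by rewrite addn1 rm; apply: Pm Em; lia.
rewrite addn0; move: rm; rewrite ltnS leq_eqVlt => /predU1P[->|]; last exact: IH.
by rewrite Em; lia.
Qed.

Section Loss.
Variables (rk : nat -> nat).

Definition member (C : nat -> nat) cl x := x \in map C (iota 0 cl).

Lemma memberP C cl x : reflect (exists2 r, r < cl & C r = x) (member C cl x).
Proof.
apply: (iffP mapP) => [[r]|[r rc <-]]; first by rewrite mem_iota => rc ->; exists r.
by exists r; rewrite ?mem_iota.
Qed.

(* The thresholds [Th] stand for an increasing subsequence: its elements in block
   i of T have ranks between [Th i] and [Th i.+1]. *)
Definition in_window (T : nat -> nat) b (Th : nat -> nat) p :=
  Th (p %/ b) <= rk (T p) < Th (p %/ b).+1.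

Definition lost_count T nn b Th C cl :=
  count (fun p => in_window T b Th p && ~~ member C cl (T p)) (iota 0 nn).

Variables (nn be cl cl' N : nat) (T T1 C C' : nat -> nat).
Notation b := (2 ^ be).
Hypothesis be4 : 4 <= be.
Hypothesis bn : b <= nn.
Hypothesis nN : nn <= N.
Hypothesis Td : distinct rk T 0 nn.
Hypothesis Ts : block_sorted rk T nn b.
Hypothesis Ci : incr rk C 0 cl.
Hypothesis cln : cl <= nn.
Hypothesis T1T : block_map (fun r => T (4 * r)) T1 ((nn + 3) %/ 4) (b * b).
Hypothesis T1loss : forall Th, {homo Th : x y / x <= y} ->
  b * b * lost_count T1 ((nn + 3) %/ 4) (b * b) Th C cl <= 22 * N.
Hypothesis C'P : forall p, p < nn -> member C' cl' (T p) \/ lost_reason rk nn be cl T C p.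

(* At most 4 elements per block have their sampled element outside the window; at
   most 4 per lost sampled element; elements too far away come from blocks whose
   window contains b^2 elements of C; full buckets contain b elements each. *)
Lemma loss_step Th : {homo Th : x y / x <= y} -> b * lost_count T nn b Th C' cl' <= 22 * N.
Proof.
move=> Thm.
have b16 : 16 <= b by rewrite (@leq_exp2l 2 4).
have b0 : 0 < b by lia.
have b4 p : p %/ b = (4 * (p %/ 4)) %/ b.
  have -> : b = 4 * 2 ^ (be - 2) by rewrite -(@expnD 2 2); congr (2 ^ _); lia.
  by rewrite !divnMA mulKn.
have s4 p : 4 * (p %/ 4) <= p by rewrite mulnC leq_divM.
have sle p : p < nn -> rk (T (4 * (p %/ 4))) <= rk (T p).
  move=> pn; have := s4 p; rewrite leq_eqVlt => /predU1P[->//|h].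
  by apply: ltnW; apply: Ts => //; rewrite -b4.
have Ts' p q : p < q -> q < nn -> p %/ b = q %/ b -> rk (T p) < rk (T q) by exact: Ts.
pose E := in_window T b Th.
(* The bucket that x belongs to. *)
pose fl x := count (fun r => rk (C r) <= rk x) (iota 0 cl).
have flP x r : r < cl -> (rk (C r) <= rk x) = (r < fl x).
  apply: count_prefix => r1 r2 rr r2c; apply: leq_trans.
  by have [->//|ne] := eqVneq r1 r2; apply: ltnW; apply: Ci; lia.
have fl_le x : fl x <= cl by rewrite /fl -[leqRHS](size_iota 0 cl) count_size.
have flE g x : 0 < g <= cl -> floor_at rk cl C g x -> fl x = g.
  move=> gb [h1 h2]; have := flP x g.-1; rewrite h1 => /(_ ltac:(lia)) h3.
  have [gc|gc] := ltnP g cl; last by have := fl_le x; lia.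
  by have := flP x g gc; rewrite leqNgt (h2 gc) /=; lia.
pose Dn := b * b.
pose cnt bl := count (fun r => Th bl <= rk (C r) < Th bl.+1) (iota 0 cl).
pose cand g q := fl (T q) == g.
pose PA p := E p && ~~ E (4 * (p %/ 4)).
pose PB p := E (4 * (p %/ 4)) && ~~ member C cl (T (4 * (p %/ 4))).
pose PC p := E p && (Dn <= cnt (p %/ b)).
pose PD p := [&& E p, E (4 * (p %/ 4)), member C cl (T (4 * (p %/ 4))), 0 < fl (T p) &
                 b <= count (cand (fl (T p))) (iota 0 nn)].
have cover p : p < nn -> E p -> ~~ member C' cl' (T p) -> [|| PA p, PB p, PC p | PD p].
  move=> pn Ep nm; rewrite /PA /PB /PC /PD Ep /=.
  case Es: (E _) => //=; case Ms: (member _ _ _) => //=.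
  have [h|[h|[g [gb eC gD hD]]|[g [l [gb flg sl szl lq]]]]] := C'P pn.
  - by rewrite h in nm.
  - by case/memberP: Ms => r rc e; case: (h r rc).
  - apply/orP; left; rewrite /Dn /cnt.
    have sub : {subset iota g.-1 (b * b) <= [seq r <- iota 0 cl | Th (p %/ b) <= rk (C r) < Th (p %/ b).+1]}.
      move=> r; rewrite mem_iota mem_filter mem_iota => rb.
      apply/andP; split; last by lia.
      apply/andP; split.
        move: Es; rewrite /E /in_window -b4 -eC => /andP[h _]; apply: leq_trans h _.
        by have [->//|ne] := eqVneq r g.-1; apply: ltnW; apply: Ci; lia.
      case/andP: Ep => _; apply: leq_ltn_trans; apply: leq_trans hD.
      by have [->//|ne] := eqVneq r (g + b * b).-1; apply: ltnW; apply: Ci; lia.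
    by rewrite -size_filter -[leqLHS](size_iota g.-1); apply: uniq_leq_size (iota_uniq _ _) sub.
  - apply/orP; right; rewrite (flE g) //; apply/andP; split; first by lia.
    rewrite -size_filter -szl; apply: uniq_leq_size.
      by apply: (sorted_uniq ltn_trans ltnn).
    by move=> q /lq[qn fq]; rewrite mem_filter mem_iota /cand (flE g) ?eqxx.
have total : lost_count T nn b Th C' cl' <=
    count PA (iota 0 nn) + count PB (iota 0 nn) + count PC (iota 0 nn) + count PD (iota 0 nn).
  have le1 P Q : count (predU P Q) (iota 0 nn) <= count P (iota 0 nn) + count Q (iota 0 nn).
    by rewrite -count_predUI leq_addr.
  apply: (@leq_trans (count (predU (predU (predU PA PB) PC) PD) (iota 0 nn))).
    rewrite /lost_count -!size_filter; apply: uniq_leq_size; first by rewrite filter_uniq ?iota_uniq.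
    move=> p; rewrite !mem_filter mem_iota add0n => /andP[/andP[Ep nm] pn].
    by rewrite pn andbT /= -!orbA; apply: cover.
  apply: (leq_trans (le1 _ _)); rewrite leq_add2r.
  by apply: (leq_trans (le1 _ _)); rewrite leq_add2r; apply: le1.
(* If p < q are positions of one block, both inside the window, and in different groups of four,
   then the sampled item of q lies between them in the sorted block and is inside the window too. So
   the items of a block counted by [PA] share one group. *)
have cA : count PA (iota 0 nn) <= 4 * count predT (iota 0 (nn %/ b).+1).
  apply: (@count_fiber _ _ (fun p => p %/ b)) => //.
    by move=> p pn _; rewrite ltnS leq_div2r // ltnW.
  suff h p q : p < q -> q < nn -> PA p -> PA q -> p %/ b = q %/ b -> p %/ 4 = q %/ 4.
    move=> p q pn qn Pp Pq e; case: (ltngtP p q) => [pq|qp|->//]; first exact: h.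
    by apply/esym; apply: h.
  move=> pq qn /andP[/andP[Ep _] _] /andP[/andP[_ Eq] nE] e.
  have le4 : p %/ 4 <= q %/ 4 by rewrite leq_div2r // ltnW.
  apply/eqP; rewrite eqn_leq le4 leqNgt; apply/negP => lt4.
  case/negP: nE; rewrite /E /in_window -b4 -e; apply/andP; split; last first.
    by rewrite e; apply: leq_ltn_trans (sle q qn) Eq.
  apply: (leq_trans Ep); apply: ltnW; apply: Ts'; rewrite -?b4 //; last by have := s4 q; lia.
  by have := divn_eq p 4; have := ltn_pmod p (isT : 0 < 4); lia.
have cB : count PB (iota 0 nn) <= 4 * count (fun r => E (4 * r) && ~~ member C cl (T (4 * r)))
                                        (iota 0 ((nn + 3) %/ 4)).
  apply: (@count_fiber _ _ (fun p => p %/ 4)) => // p pn Pp; split=> //; lia.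
have cC : count PC (iota 0 nn) <= b * count (fun bl => Dn <= cnt bl) (iota 0 (nn %/ b).+1).
  apply: (@count_fiber _ _ (fun p => p %/ b)) => // p pn /andP[_ h]; split=> //.
  by rewrite ltnS leq_div2r // ltnW.
have cC2 : Dn * count (fun bl => Dn <= cnt bl) (iota 0 (nn %/ b).+1) <= cl.
  apply: (@count_threshold _ (fun bl r => Th bl <= rk (C r) < Th bl.+1)) => //.
  move=> x y r _ /andP[h1 h2] /andP[h3 h4].
  by case: (ltngtP x y) => // h; [have := Thm _ _ h|have := Thm _ _ h]; lia.
(* Since its sampled item is present in C, the last item of C not above an element of bucket g lies
   between that sampled item and the element. If p < q in the same bucket had different groups, T p
   would rank below the sampled item of q, which is at most this item of C, which is at most T p.
   The windows rule out that p and q lie in different blocks. *)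
have cD : count PD (iota 0 nn) <= 4 * count (fun g => b <= count (cand g) (iota 0 nn)) (iota 0 cl.+1).
  apply: (@count_fiber _ _ (fun p => fl (T p))) => //.
    move=> p pn /and5P[_ _ _ _ h]; split=> //.
    by rewrite ltnS /fl -[leqRHS](size_iota 0 cl) count_size.
  have key p : p < nn -> PD p -> let g := (fl (T p)).-1 in
      rk (T (4 * (p %/ 4))) <= rk (C g) <= rk (T p) /\ g < cl.
    move=> pn /and5P[_ _ /memberP[r rc e] f0 _].
    have flcl := fl_le (T p).
    have rf : r < fl (T p) by rewrite -flP // e sle.
    split; last by lia.
    apply/andP; split; last first.
      by rewrite flP; lia.
    by rewrite -e; have [->//|ne] := eqVneq r (fl (T p)).-1; apply: ltnW; apply: Ci; lia.
  suff h p q : p < q -> q < nn -> PD p -> PD q -> fl (T p) = fl (T q) -> p %/ 4 = q %/ 4.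
    move=> p q pn qn Pp Pq e; case: (ltngtP p q) => [pq|qp|->//]; first exact: h.
    by apply/esym; apply: h.
  move=> pq qn Dp Dq e; have pn := ltn_trans pq qn.
  have [] := key p pn Dp; have [] := key q qn Dq; rewrite /= e; set g := _.-1.
  move=> /andP[q1 q2] gc /andP[p1 p2] _.
  case/and5P: Dp => /andP[Ep Ep'] /andP[Esp Esp'] _ _ _.
  case/and5P: Dq => /andP[Eq Eq'] /andP[Esq Esq'] _ _ _.
  rewrite -(b4 p) in Esp Esp'; rewrite -(b4 q) in Esq Esq'.
  have bpq : p %/ b = q %/ b.
    have : p %/ b <= q %/ b by rewrite leq_div2r // ltnW.
    rewrite leq_eqVlt => /predU1P[//|h]; have := Thm _ _ h; lia.
  have le4 : p %/ 4 <= q %/ 4 by rewrite leq_div2r // ltnW.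
  apply/eqP; rewrite eqn_leq le4 leqNgt; apply/negP => lt4.
  have psq : p < 4 * (q %/ 4) by have := divn_eq p 4; have := ltn_pmod p (isT : 0 < 4); lia.
  have := Ts' p (4 * (q %/ 4)) psq; rewrite -b4 -bpq => /(_ _ (erefl _)).
  by have := s4 q; lia.
have cD2 : b * count (fun g => b <= count (cand g) (iota 0 nn)) (iota 0 cl.+1) <= nn.
  apply: (@count_threshold _ cand) => // x y r _ /eqP <- /eqP; done.
(* A block of b^2 sampled items covers 4 b^2 positions of T, that is 4 b blocks, so the sampled
   level sees every (4 b)-th threshold. *)
pose Th1 k := Th (k * (4 * b)).
have Th1m : {homo Th1 : x y / x <= y} by move=> x y xy; apply: Thm; rewrite leq_mul2r xy orbT.
have cB2 : count (fun r => E (4 * r) && ~~ member C cl (T (4 * r))) (iota 0 ((nn + 3) %/ 4))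
    <= lost_count T1 ((nn + 3) %/ 4) (b * b) Th1 C cl.
  apply: (@count_inject _ _ (fun r => T (4 * r)) T1).
    move=> p q pn qn e; have : 4 * p = 4 * q by apply: Td; rewrite ?e //; lia.
    by lia.
  move=> r rn /andP[/andP[w1 w2] nm]; have [r' [rn' rb] e] := T1T rn.
  exists r'; split=> //; rewrite /in_window e nm andbT rb.
  have lo4 : r %/ (b * b) * (4 * b) <= (4 * r) %/ b.
    by rewrite leq_divRL // -mulnA -mulnA mulnCA leq_mul2l /= leq_divM.
  have hi4 : ((4 * r) %/ b).+1 <= (r %/ (b * b)).+1 * (4 * b).
    rewrite ltn_divLR // -mulnA -mulnA mulnCA ltn_mul2l /=.
    by rewrite ltn_ceil // muln_gt0 b0.
  by apply/andP; split; [apply: leq_trans w1; apply: Thm|apply: leq_trans w2 _; apply: Thm].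
have L1 := T1loss Th1m.
set X := lost_count T1 _ _ _ _ _ in cB2 L1.
rewrite count_predT size_iota in cA.
have q1 : nn %/ b * b <= nn by exact: leq_divM.
(* In multiples of N, after multiplication by b: 8 for [PA] because b <= nn, 22 / 4 for [PB] because
   b >= 16, 1 for [PC] and 4 for [PD]. The sum 18.5 stays below 22. *)
have h1 := leq_mul (leqnn b) total.
have h2 := leq_mul (leqnn b) cA.
have h3 := leq_mul (leqnn b) cB.
have h4 := leq_mul (leqnn b) cC.
have h5 := leq_mul (leqnn b) cD.
have h6 : b * (b * count (fun bl => Dn <= cnt bl) (iota 0 (nn %/ b).+1)) <= cl by rewrite mulnA.
have h7 : 16 * (b * X) <= 22 * N.
  by apply: leq_trans L1; rewrite -mulnA leq_mul2r b16 orbT.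
have h8 := leq_mul (leqnn b) cB2.
lia.
Qed.
End Loss.

(** * One phase *)

Notation vX := 61. Notation vB := 62. Notation vlev := 63.
Notation aLO := 19. Notation aLN := 20. Notation aLB := 21.

Definition sort_level := vlo ::= V vO ;; vlen ::= V vNn ;; vb ::= V vBb ;; sort_cmd.

Definition sample_cmd :=
  Put aLO (V vlev) (V vO) ;; Put aLN (V vlev) (V vNn) ;; Put aLB (V vlev) (V vBb) ;;
  vlev ::= V vlev +! K 1 ;;
  vx ::= (V vNn +! K 3) /! K 4 ;;
  For vp (K 0) (V vx) (Put aA (V vO +! V vNn +! V vp) (Get aA (V vO +! K 4 *! V vp))) ;;
  vO ::= V vO +! V vNn ;; vNn ::= V vx ;; vBb ::= V vBb *! V vBb.

Definition down_cmd :=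
  vO ::= K 0 ;; vNn ::= V vX ;; vBb ::= V vB ;; vlev ::= K 0 ;;
  While (V vBb <! V vNn) (sort_level ;; sample_cmd) ;;
  sort_level.

Definition up_cmd :=
  For vp (K 0) (V vX) (Put aPos (Get aA (V vp)) (K 0)) ;;
  vcl ::= V vNn ;; load_cmd aA (V vO) ;;
  While (K 0 <! V vlev) (
    vlev ::= V vlev -: K 1 ;;
    vO ::= Get aLO (V vlev) ;; vNn ::= Get aLN (V vlev) ;; vBb ::= Get aLB (V vlev) ;;
    place_cmd).

(** Stated in M and M * M alone, so that linear arithmetic can treat these two as atoms. *)
Lemma word_facts w n (M := n.+2 * n.+2) : 5000 * (M * M) < 2 ^ w ->
  [/\ n.+2 <= M, 4 <= M & 4000 * M + 1000 * (M * M) < 2 ^ w].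
Proof.
move=> HW; have n3 : 2 <= n.+2 by [].
have M9 : 4 <= M by apply: (leq_mul n3 n3).
have MM : M * 1 <= M * M by rewrite leq_mul2l (leq_trans _ M9) ?orbT.
split; [by rewrite leq_pmulr|by []|].
by clearbody M; clear n3; lia.
Qed.

(* Offset, size, logarithm of the block size, and contents of a sampled level. *)
Record level := Level { lO : nat; lN : nat; lE : nat; lT : nat -> nat }.

Section Phase.
Variables (w : nat) (lt : rel nat) (n : nat) (rk : nat -> nat).
Hypothesis ltP : forall i j, i < n -> j < n -> lt i j = (rk i < rk j).
Notation ex := (ex w (Some lt)).
Notation W := (2 ^ w).

Variables (n0 e0 : nat) (X : nat -> nat).
Hypothesis n0n : 0 < n0 <= n.
Hypothesis e04 : 4 <= e0.
Hypothesis Xv : valid n X 0 n0.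
Hypothesis Xd : distinct rk X 0 n0.
Hypothesis HB : 2 ^ e0 <= 16 * (n.+2 * n.+2).
Hypothesis HW : 5000 * (n.+2 * n.+2 * (n.+2 * n.+2)) < W.

Definition good_level l :=
  [/\ 2 ^ lE l < lN l, valid n (lT l) 0 (lN l), distinct rk (lT l) 0 (lN l)
    & block_sorted rk (lT l) (lN l) (2 ^ lE l)].

Definition same_blocks f g m b := block_map f g m b /\ block_map g f m b.

(** The stack of levels from the current one down to X: every level consists of each fourth item of
    the next finer one, rearranged within its own, larger blocks. *)
Fixpoint chain (o m e : nat) (T : nat -> nat) (ls : seq level) : Prop :=
  if ls is l :: ls' then
    [/\ good_level l, [/\ o = lO l + lN l, m = (lN l + 3) %/ 4 & e = 2 * lE l],
        same_blocks (fun r => lT l (4 * r)) T m (2 ^ e)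
      & chain (lO l) (lN l) (lE l) (lT l) ls']
  else [/\ o = 0, m = n0, e = e0 & same_blocks X T n0 (2 ^ e0)].

Fixpoint slots (A : nat -> nat -> nat) (ls : seq level) : Prop :=
  if ls is l :: ls' then
    [/\ [/\ A aLO (size ls') = lO l, A aLN (size ls') = lN l
          & A aLB (size ls') = 2 ^ lE l],
        forall p, p < lN l -> A aA (lO l + p) = lT l p
      & slots A ls']
  else True.

Definition work ls := sumn [seq lN l * lE l | l <- ls].

(** A level that gets sampled has N > 16 items, so its sample has at most N / 3 of them, with the
    exponent doubled: N e + 3 (N / 3) (2 e) = 3 N e. Hence all levels together cost no more than a
    constant times the first. The sizes decrease geometrically as well, which bounds the space. *)
Lemma chain_bound o m e T ls : chain o m e T ls ->
  [/\ o + 2 * m <= 2 * n0, 4 <= e, 0 < m <= n0, work ls + 3 * (m * e) <= 3 * (n0 * e0)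
    & 2 ^ e <= 16 * (n.+2 * n.+2)].
Proof.
elim: ls o m e T => [|l ls IH] o m e T /=.
  move=> [-> -> -> _]; split=> //; lia.
move=> [[bn _ _ _] [-> -> ->] _ /IH[h1 h2 h3 h4 h5]].
have l16 : 2 ^ 4 <= 2 ^ lE l by rewrite leq_exp2l.
have m3 : 3 * ((lN l + 3) %/ 4) <= lN l by lia.
split; [lia|lia|lia| |].
  have : 3 * ((lN l + 3) %/ 4) * lE l <= lN l * lE l by rewrite leq_mul2r m3 orbT.
  rewrite /work /= -/(work ls); move: h4; rewrite mulnCA -mulnA; lia.
rewrite mul2n -addnn expnD; apply: (@leq_trans (lN l * lN l)).
  by apply: leq_mul; apply: ltnW.
apply: (@leq_trans (n.+2 * n.+2)); last by lia.
by apply: leq_mul; lia.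
Qed.

Lemma chain_size o m e T ls : chain o m e T ls -> size ls <= o.
Proof.
elim: ls o m e T => //= l ls IH o m e T [[h _ _ _] [-> _ _] _ /IH h'].
lia.
Qed.

Lemma chain_sub o m e T ls : chain o m e T ls ->
  forall p, p < m -> exists2 q, q < n0 & X q = T p.
Proof.
elim: ls o m e T => [|l ls IH] o m e T /=.
  by move=> [_ -> _ [_ h]] p /h[q [qn _] e']; exists q.
move=> [[bn _ _ _] [_ -> _] [_ h] /IH IHl] p /h[q [qm _] <-]; apply: IHl.
have : 2 ^ lE l > 0 by rewrite expn_gt0.
by move: qm bn; lia.
Qed.

Lemma chain_valid o m e T ls : chain o m e T ls -> valid n T 0 m.
Proof. by move=> /chain_sub h p /= /h[q qn <-]; apply: Xv. Qed.

Lemma chain_base o m e T ls A : chain o m e T ls -> slots A ls ->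
  (forall p, p < m -> A aA (o + p) = T p) ->
  exists2 T0, same_blocks X T0 n0 (2 ^ e0) & forall p, p < n0 -> A aA p = T0 p.
Proof.
elim: ls o m e T => [|l ls IH] o m e T /=; first by move=> [-> -> _ sb] _; exists T.
by move=> [_ _ _ c] [_ h sl] _; apply: IH c sl h.
Qed.

Lemma slots_frame o m e T ls s s' : chain o m e T ls -> slots (arrs s) ls ->
  (forall i, i < size ls -> [/\ arrs s' aLO i = arrs s aLO i, arrs s' aLN i = arrs s aLN i
     & arrs s' aLB i = arrs s aLB i]) ->
  (forall q, q < o -> arrs s' aA q = arrs s aA q) -> slots (arrs s') ls.
Proof.
elim: ls o m e T => [//|l ls IH] o m e T /= [_ [-> _ _] _ c] [[h1 h2 h3] h4 h5] H1 H2.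
have [-> -> ->] := H1 _ (leqnn _); split=> //.
  by move=> p pl; rewrite H2 ?h4 // ltn_add2l.
by apply: (IH _ _ _ _ c) => // [i il|q ql]; [apply: H1; lia|apply: H2; lia].
Qed.

Lemma sort_level_spec (Q : state -> nat -> Prop) s t o m e ls (U : nat -> nat) :
  vars s vO = o -> vars s vNn = m -> vars s vBb = 2 ^ e ->
  chain o m e U ls -> distinct rk U 0 m ->
  (forall p, p < m -> arrs s aA (o + p) = U p) ->
  (forall s' t' T, frame sort_level s s' -> chain o m e T ls -> distinct rk T 0 m ->
    block_sorted rk T m (2 ^ e) -> (forall p, p < m -> arrs s' aA (o + p) = T p) ->
    (forall q, ~~ (o <= q < o + m) -> arrs s' aA q = arrs s aA q) ->
    t' <= t + 150 * (m * e) + 80 * e + 40 -> Q s' t') ->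
  ex sort_level Q s t.
Proof.
move=> EO EN EB ch Ud EA QP; have [omn e4 m0 _ hB] := chain_bound ch.
have Uv := chain_valid ch.
apply: ex_framed; rewrite {1}/sort_level; step; step; step.
have [M1 M2 M3] := word_facts HW; move: HB; move: (n.+2 * n.+2) (2 ^ e0) M1 M2 M3 hB => M B0 M1 M2 M3 hB HB'.
apply: (@sort_spec w lt n rk ltP _ _ _ o m e) => //=.
- by move: hB M1 M2 M3 omn m0 n0n; move: (2 ^ e) (2 ^ w) (M * M); clear; lia.
- by move=> p pm; rewrite EA //; apply: Uv.
- by move=> p q pm qm; rewrite !EA //; apply: Ud.
move=> s1 t1 fr t1b srt m1 m2 out frm; set f := fun q => arrs s1 aA _ in srt m1 m2.
have m1' : block_map U f m (2 ^ e).
  by move=> p pm; have [q qm e'] := m1 p pm; exists q; rewrite // e' EA.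
have m2' : block_map f U m (2 ^ e).
  by move=> p pm; have [q [qm qb] e'] := m2 p pm; exists q; rewrite // -e' EA.
have b0 : 0 < 2 ^ e by rewrite expn_gt0.
apply: (QP _ _ f) => //.
- clear QP; case: ls ch => [|l ls] /=.
    move=> [-> mE eE [c1 c2]]; rewrite mE eE in m1' m2' b0 *.
    by split=> //; split; [apply: (block_map_trans b0 (dvdnn _) c1)|apply: (block_map_trans b0 (dvdnn _) m2' c2)].
  move=> [h1 h2 [c1 c2] h3]; split=> //.
  by split; [apply: (block_map_trans b0 (dvdnn _) c1)|apply: (block_map_trans b0 (dvdnn _) m2' c2)].
- exact: block_map_distinct m2' srt Ud.
- by move: t1b; rewrite /= mulnDl -mulnA; lia.
Qed.

Definition at_level (s : state) o m e ls T :=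
  [/\ [/\ vars s vO = o, vars s vNn = m, vars s vBb = 2 ^ e & vars s vlev = size ls],
      chain o m e T ls, slots (arrs s) ls, distinct rk T 0 m
    & forall p, p < m -> arrs s aA (o + p) = T p].

Lemma at_level_sort (Q : state -> nat -> Prop) s t o m e ls U :
  at_level s o m e ls U ->
  (forall s' t' T, frame sort_level s s' -> at_level s' o m e ls T ->
    block_sorted rk T m (2 ^ e) -> t' <= t + 150 * (m * e) + 80 * e + 40 -> Q s' t') ->
  ex sort_level Q s t.
Proof.
move=> [[EO EN EB El] ch sl Ud EA] QP; apply: (sort_level_spec EO EN EB ch Ud EA).
move=> s' t' T fr ch' Td srt EA' out tb; apply: (QP _ _ T) => //.
have sl' : slots (arrs s') ls.
  by apply: slots_frame ch' sl _ _ => [i _|q qo]; [case: fr => _ h; rewrite !h|apply: out; lia].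
by framev fr; split.
Qed.

Lemma sample_spec (Q : state -> nat -> Prop) s t o m e ls T :
  at_level s o m e ls T -> block_sorted rk T m (2 ^ e) -> 2 ^ e < m ->
  (forall s' t', frame sample_cmd s s' ->
    at_level s' (o + m) ((m + 3) %/ 4) (2 * e) (Level o m e T :: ls) (fun r => T (4 * r)) ->
    t' <= t + 30 * m + 100 -> Q s' t') ->
  ex sample_cmd Q s t.
Proof.
move=> [[EO EN EB El] ch sl Td EA] srt bm QP; have [omn e4 m0 _ hB] := chain_bound ch.
have [M1 M2 M3] := word_facts HW.
have szls := chain_size ch.
have bb : 2 ^ e * 2 ^ e < 2 ^ w.
  have : 2 ^ e * 2 ^ e <= n.+2 * n.+2 by apply: leq_mul; lia.
  by move: M3; move: (2 ^ e * 2 ^ e) (n.+2 * n.+2) => x y; lia.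
have WW : 2 * n + 100 < 2 ^ w by move: M1 M2 M3; move: (n.+2 * n.+2) => y; lia.
apply: ex_framed; rewrite {1}/sample_cmd.
step; step; step; step; step.
set m1 := (m + 3) %/ 4; have m1b : 3 * m1 <= m + 9 by rewrite /m1; lia.
pose I (i : nat) s' (t' : nat) := [/\ forall q, q < o + m -> arrs s' aA q = arrs s aA q,
  forall p, p < i -> arrs s' aA (o + m + p) = T (4 * p) & t' <= t + 40 + 20 * i].
apply: ex_seq; apply: (ex_for (I := I) (a := 0) (b := m1)); [by ev|lia|lia|by []|..].
- by split=> //=; lia.
- by move=> s1 i t1 fr _ _; case: fr => fv _ /=; rewrite fv.
- move=> s1 i t1 fr ib Ei [h1 h2 tb]; base fr; framev fr.
  have im : 4 * i < m by move: ib; rewrite /m1; lia.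
  step => _; rewrite h1; last by lia.
  rewrite EA //.
  split; rewrite /=; last by lia.
    by move=> q qo; rewrite ifF ?h1 //; apply/eqP; lia.
  move=> p; rewrite ltnS leq_eqVlt => /predU1P[->|pi]; first by rewrite eqxx.
  by rewrite ifF ?h2 //; apply/eqP; lia.
- move=> s1 t1 fr _ [h1 h2 tb].
  have [F1 F2 F3] : [/\ arrs s1 aLO (size ls) = o, arrs s1 aLN (size ls) = m & arrs s1 aLB (size ls) = 2 ^ e].
    by case: fr => _ fa; rewrite !fa //= !eqxx.
  have sl' : slots (arrs s1) ls.
    apply: slots_frame ch sl _ _ => [i il|q qo]; last by rewrite h1; lia.
    by case: fr => _ fa; rewrite !fa //= !ltn_eqF.
  have F4 : vars s1 vlev = size ls + 1 by case: fr => fv _; rewrite fv //= addn1.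
  have F5 : vars s1 vx = m1 by case: fr => fv _; rewrite fv.
  base fr; framev fr.
  step; step; step => frm; apply: QP => //; rewrite -/m1; last by lia.
  split=> //=.
  + by split; rewrite ?E ?F4 ?addn1 ?mul2n -?addnn ?expnD.
  + split=> //; [split=> //; exact: chain_valid ch|].
    by split=> p pm; exists p.
  + by split=> // p pm; rewrite h1 ?EA; lia.
  + move=> p q pm qm e'; suff : 4 * p = 4 * q by lia.
    by apply: Td => //; move: pm qm; rewrite /m1; lia.
Qed.

Lemma down_spec (Q : state -> nat -> Prop) s t :
  vars s vX = n0 -> vars s vB = 2 ^ e0 -> (forall p, p < n0 -> arrs s aA p = X p) ->
  (forall s' t' o m e ls T, frame down_cmd s s' -> at_level s' o m e ls T -> m <= 2 ^ e ->
    block_sorted rk T m (2 ^ e) -> t' <= t + 250 * (work ls + m * e) + 100 -> Q s' t') ->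
  ex down_cmd Q s t.
Proof.
move=> EX EBv EA QP; apply: ex_framed; rewrite {1}/down_cmd.
have [M1 M2 M3] := word_facts HW.
have WW : 2 < 2 ^ w by move: M1 M2 M3; move: (n.+2 * n.+2) => y; lia.
step; step; step; step.
apply: ex_seq.
pose I s' (t' : nat) := exists o m e ls T, at_level s' o m e ls T /\
  t' <= t + 250 * work ls + 20.
apply: (ex_while (I := I) (mu := fun s => vars s vNn)).
- exists 0, n0, e0, [::], X; split; last by rewrite /=; lia.
  by split=> //=; split=> //; split=> p pm; exists p.
- move=> s1 t1 fr [o [m [e [ls [T [al tb]]]]]].
  have [[EO EN EB El] ch _ _ _] := al.
  have [omn e4 m0 _ hB] := chain_bound ch.
  rewrite (ev_lt (u := 2 ^ e) (v := m)) //; last by lia.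
  rewrite eqb0 negbK => bm; apply: ex_seq; apply: at_level_sort al _.
  move=> s2 t2 T2 fr2 al2 srt2 t2b.
  have l16 : 16 <= 2 ^ e by rewrite (@leq_exp2l 2 4).
  apply: (sample_spec al2 srt2 bm) => s3 t3 fr3 al3 t3b.
  split; first last.
    by case: al3 => [[_ e3 _ _] _ _ _ _]; rewrite /= e3 EN; lia.
  do 5 eexists; split; first exact: al3.
  rewrite /work /= -/(work ls); rewrite /= in t2b t3b.
  (* As m > 16 and e >= 4, the terms in e alone and in m alone are absorbed by m * e. *)
  have h1 : 16 * e <= m * e by rewrite leq_mul2r; lia.
  have h2 : m * 4 <= m * e by rewrite leq_mul2l e4 orbT.
  by lia.
- move=> s1 t1 fr [o [m [e [ls [T [al tb]]]]]].
  have [[EO EN EB El] ch _ _ _] := al.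
  have [omn e4 m0 _ hB] := chain_bound ch.
  rewrite (ev_lt (u := 2 ^ e) (v := m)) //; last by lia.
  move/eqP; rewrite eqb0 -leqNgt => mb; apply: at_level_sort al _.
  move=> s2 t2 T2 fr2 al2 srt2 t2b frm; apply: QP al2 mb srt2 _ => //.
  rewrite /= in t2b.
  have h1 : 1 * e <= m * e by rewrite leq_mul2r; lia.
  by lia.
Qed.

(** The third clause is what ends the phases: a level that fits into one block loses nothing. *)
Definition sublist (C : nat -> nat) cl T m e :=
  [/\ incr rk C 0 cl, forall r, r < cl -> exists2 p, p < m & C r = T p,
      m <= 2 ^ e -> forall p, p < m -> member C cl (T p)
    & forall Th, {homo Th : x y / x <= y} ->
        2 ^ e * lost_count rk T m (2 ^ e) Th C cl <= 22 * n0].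

Definition up_inv (s : state) ls T :=
  exists o m e cl,
    [/\ at_level s o m e ls T, block_sorted rk T m (2 ^ e), vars s vcl = cl,
        sublist (arrs s aC) cl T m e
      & forall p, p < n0 -> pos_ok (arrs s aPos) (arrs s aC) cl (X p)].

(** The start of the way up: the coarsest level is a single sorted block. *)
Lemma sublist_refl C T m e : incr rk T 0 m -> (forall r, r < m -> C r = T r) ->
  sublist C m T m e.
Proof.
move=> Ti CT; have mem p : p < m -> member C m (T p).
  by move=> pm; apply/memberP; exists p; rewrite // CT.
split=> //.
- by move=> p q p0 pq qm; rewrite !CT //; [apply: Ti|lia].
- by move=> r rm; exists r; rewrite ?CT.
- move=> Th _; rewrite (_ : lost_count _ _ _ _ _ _ _ = 0) ?muln0 //.
  rewrite /lost_count -(@eq_in_count _ pred0) ?count_pred0 // => p.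
  by rewrite mem_iota add0n /= => pm; rewrite mem ?andbF.
Qed.

Lemma up_place (Q : state -> nat -> Prop) s t l ls T :
  up_inv s (l :: ls) T -> vars s vR = 4 * n ->
  (forall s' t', up_inv s' ls (lT l) -> vars s' vlev = size ls ->
    t' <= t + 650 * (lN l * lE l) -> Q s' t') ->
  ex (vlev ::= V vlev -: K 1 ;;
    vO ::= Get aLO (V vlev) ;; vNn ::= Get aLN (V vlev) ;; vBb ::= Get aLB (V vlev) ;;
    place_cmd) Q s t.
Proof.
move=> [o [m [e [cl [[[EO EN EB El] ch sl Td EA] srt Ecl [Ci CT _ Closs] pok]]]]] ER QP.
have [omn e4 m0 _ hB] := chain_bound ch.
case: (ch) => [[bl lv ld ls_] [oE mE eE] [sb1 sb2] chl].
case: (sl) => [[E1 E2 E3] EAl sl'].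
have [omn' e4' m0' _ hB'] := chain_bound chl.
have [M1 M2 M3] := word_facts HW.
have l16 : 16 <= 2 ^ lE l by rewrite (@leq_exp2l 2 4).
have clm : cl <= m := incr_card Ci CT.
have sls := chain_size chl.
have W2 : 2 * n + 10 < 2 ^ w by move: M1 M2 M3; move: (n.+2 * n.+2) => y; lia.
rewrite /= in El.
step; rewrite subn1 /=.
step; rewrite E1; step; rewrite E2; step; rewrite E3.
have b4 p : p %/ 2 ^ lE l = (4 * (p %/ 4)) %/ 2 ^ lE l.
  have -> : 2 ^ lE l = 4 * 2 ^ (lE l - 2) by rewrite -(@expnD 2 2); congr (2 ^ _); lia.
  by rewrite !divnMA mulKn.
have sub p : p < m -> exists2 q, q < lN l & lT l q = T p.
  move=> /sb2[q [qm _] <-]; exists (4 * q) => //; lia.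
apply: (@place_spec w lt n rk ltP (lO l) (lN l) (lE l) (4 * n) cl (lT l) (arrs s aC) _ _ _ _ _ _ _ _ _
  _ _ _ (fun x => exists2 p, p < n0 & X p = x)) => //.
- by lia.
- move=> p pl; have s4 : 4 * (p %/ 4) <= p by rewrite mulnC leq_divM.
  move: s4; rewrite leq_eqVlt => /predU1P[->//|h].
  by apply: ltnW; apply: ls_ => //; rewrite -b4.
- by move=> r /= rc; have [p pm ->] := CT r rc; apply: (chain_valid ch).
- by lia.
- by lia.
- have h1 : (cl + 2) * 2 ^ lE l <= n.+2 * n.+2 by apply: leq_mul; lia.
  have h2 : 2 ^ lE l * 2 ^ lE l <= n.+2 * n.+2 by apply: leq_mul; lia.
  move: h1 h2 M1 M2 M3 m0' n0n.
  move: (n.+2 * n.+2) ((cl + 2) * _) (2 ^ lE l * _) (2 ^ w) => y z z' W; clear; lia.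
- exact: chain_sub chl.
- by move=> r rc; have [p pm ->] := CT r rc; have [q qm <-] := sub p pm; exists q.
- by move=> x [p pn <-]; apply: pok.
move=> s1 t1 cl1 /= fr Ecl1 Ci1 CT1 pok1 lost1 A1 t1b.
apply: QP; last 1 first.
- have h : 16 * lE l <= lN l * lE l by rewrite leq_mul2r; lia.
  have h' : lN l * 4 <= lN l * lE l by rewrite leq_mul2l e4' orbT.
  by move: t1b; rewrite /= -!mulnA [lE l * _]mulnC; lia.
- exists (lO l), (lN l), (lE l), cl1; split=> //.
  + split=> //.
    * by case: fr => fv _; rewrite !fv.
    * apply: slots_frame chl sl' _ _ => [i _|q qo]; first by case: fr => _ fa; rewrite !fa.
      by rewrite A1; lia.
    * by move=> p pl; rewrite A1 ?EAl; lia.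
  + split=> //; first by rewrite leqNgt bl.
    have e2 : 2 ^ lE l * 2 ^ lE l = 2 ^ e by rewrite eE mul2n -addnn expnD.
    apply: (@loss_step rk (lN l) (lE l) cl cl1 n0 (lT l) T (arrs s aC)) => //.
    * by lia.
    * by lia.
    * by lia.
    * by rewrite e2 -mE.
    * by rewrite e2 -mE.
    * move=> p /lost1[[r rc e']|]; [left|by right].
      by apply/memberP; exists r.
  + by move=> p pn; apply: pok1; exists p.
- by case: fr => fv _; rewrite fv.
Qed.

Lemma up_spec (Q : state -> nat -> Prop) s t o m e ls T :
  at_level s o m e ls T -> block_sorted rk T m (2 ^ e) -> m <= 2 ^ e ->
  vars s vX = n0 -> vars s vR = 4 * n ->
  (forall p, p < n0 -> exists2 q, q < n0 & arrs s aA p = X q) ->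
  (forall p, p < n0 -> exists2 q, q < n0 & arrs s aA q = X p) ->
  (forall s' t' T', frame up_cmd s s' -> up_inv s' [::] T' ->
    t' <= t + 700 * work ls + 70 * n0 + 60 -> Q s' t') ->
  ex up_cmd Q s t.
Proof.
move=> al srt me EX ER AX XA QP; apply: ex_framed; rewrite {1}/up_cmd.
have [[EO EN EB El] ch sl Td EA] := al.
have [omn e4 m0 _ hB] := chain_bound ch.
have szls := chain_size ch.
have [M1 M2 M3] := word_facts HW.
have WW : 4 * n + 100 < 2 ^ w by move: M1 M2 M3; move: (n.+2 * n.+2) => y; lia.
apply: ex_seq.
pose I (i : nat) s' (t' : nat) := (forall p, p < i -> arrs s' aPos (arrs s aA p) = 0) /\ t' <= t + 15 * i + 2.
apply: (ex_for (I := I) (a := 0) (b := n0)); [by ev|lia|lia|by []|..].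
- by split=> //=; lia.
- by move=> s1 i t1 fr _ _; base fr; framev fr; ev.
- move=> s1 i t1 fr ib Ei [h tb]; base fr; framev fr.
  have EA1 : arrs s1 aA = arrs s aA by case: fr => _ ->.
  step => _; split; last by rewrite /=; lia.
  move=> p; rewrite ltnS leq_eqVlt /= => /predU1P[->|pi]; rewrite ?EA1 ?eqxx //.
  by case: eqP => // _; apply: h.
move=> s1 t1 fr1 _ [P0 tb1]; base fr1; framev fr1.
have EA1 : arrs s1 aA = arrs s aA by case: fr1 => _ h; rewrite h.
step; apply: ex_seq.
have W0 : 0 < 2 ^ w by rewrite expn_gt0.
have Ti : incr rk T 0 m.
  by move=> p q _ pq qm; apply: srt => //; rewrite !divn_small //; lia.
apply: (@load_spec w lt rk _ _ _ aA _ o m) => //=.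
- by lia.
- by move=> s' fr; base fr; framev fr.
- by move=> p q _ pq qm; rewrite /= EA1 !EA; [apply: Ti|lia|lia].
move=> s2 t2 fr2 c2 p2 t2b.
have [Ecl2 F1 F2 F3] : [/\ vars s2 vcl = m, vars s2 vlev = size ls, vars s2 vR = 4 * n & vars s2 vX = n0].
  by split; case: fr2 => fv _; rewrite fv.
base fr2; framev fr2.
have up2 : up_inv s2 ls T.
  have EA2 : arrs s2 aA = arrs s aA by case: fr2 => _ h; rewrite h.
  exists o, m, e, m; split=> //.
  - split=> //; last by move=> p pm; rewrite EA2 EA.
    apply: slots_frame ch sl _ _ => [i _|q _]; last by rewrite EA2.
    by case: fr2 => _ h; rewrite !h //; case: fr1 => _ h'; rewrite !h'.
  - by apply: sublist_refl => // r rm; rewrite c2 // EA1 EA.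
  - move=> p pn; apply: p2; have [q qn <-] := XA p pn; exact: P0.
pose J s' (t' : nat) := exists ls' T', [/\ up_inv s' ls' T', vars s' vlev = size ls' &
  t' + 700 * work ls' <= t2 + 700 * work ls].
apply: (ex_while (I := J) (mu := fun s => vars s vlev)).
- by exists ls, T.
- move=> s3 t3 fr3 [ls3 [T3 [up3 El3 tb3]]]; framev fr3.
  have [o3 [m3 [e3 [cl3 [[_ ch3 _ _ _] _ _ _ _]]]]] := up3.
  have sz3 := chain_size ch3; have [omn3 _ _ _ _] := chain_bound ch3.
  rewrite (ev_lt (u := 0) (v := size ls3)) ?evC //; last by lia.
  case: ls3 => [//|l ls3] in up3 El3 tb3 ch3 sz3 *; move=> _.
  apply: up_place up3 _ _ => // s4 t4 up4 El4 t4b.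
  rewrite El4 El3; split=> //; exists ls3, (lT l); split=> //.
  have [_ e4' lN0 _ _] : [/\ True, 4 <= lE l, 0 < lN l, True & True].
    by case: ch3 => _ _ _ /chain_bound[_ h /andP[h' _] _ _].
  have h : 1 * 4 <= lN l * lE l by apply: leq_mul.
  by move: tb3 t4b; rewrite /work /= -/(work ls3); lia.
- move=> s3 t3 fr3 [ls3 [T3 [up3 El3 tb3]]]; framev fr3.
  have [o3 [m3 [e3 [cl3 [[_ ch3 _ _ _] _ _ _ _]]]]] := up3.
  have sz3 := chain_size ch3; have [omn3 _ _ _ _] := chain_bound ch3.
  rewrite (ev_lt (u := 0) (v := size ls3)) ?evC //; last by lia.
  case: ls3 => [|l ls3] in up3 El3 tb3 ch3 sz3 *; last by [].
  move=> _ frm; apply: QP up3 _ => //.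
  by move: tb3 t2b; rewrite /work /=; lia.
Qed.

End Phase.

(** * Iterating the phases *)

Notation vz := 64. Notation vnz := 65. Notation vc := 66.
Notation aZ := 17. Notation aZl := 18.

Definition save_cmd :=
  For vp (K 0) (V vcl) (Put aZ (V vz +! V vp) (Get aC (V vp))) ;;
  vz ::= V vz +! V vcl ;; Put aZl (V vnz) (V vcl) ;; vnz ::= V vnz +! K 1.

Definition compact_cmd :=
  vc ::= K 0 ;;
  For vp (K 0) (V vX) (
    vx ::= Get aA (V vp) ;;
    If (Get aPos (V vx)) Skip (Put aA (V vc) (V vx) ;; vc ::= V vc +! K 1)) ;;
  vX ::= V vc.

Definition phase_cmd := down_cmd ;; up_cmd ;; save_cmd ;; compact_cmd ;; vB ::= V vB *! V vB.

Definition holds (f : nat -> nat) (l : seq nat) := forall p, p < size l -> f p = nth 0 l p.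

Lemma index_filter_lt (T : eqType) (P : pred T) (s : seq T) x y :
  P x -> P y -> (index x (filter P s) < index y (filter P s)) = (index x s < index y s).
Proof.
move=> Px Py; elim: s => //= a s IH; case: ifPn => Pa /=; first by do 2 case: eqP.
have [xa ya] : a <> x /\ a <> y by split=> e; rewrite e ?Px ?Py in Pa.
by move/eqP/negbTE: xa => ->; move/eqP/negbTE: ya => ->.
Qed.

Definition lt_by (rk : nat -> nat) x y := rk x < rk y.

(** A phase rearranges the items it leaves over. Pairs that are in the same order in X and in L must
    keep it, so that a chain remains a chain in the next phase. *)
Definition agree (rk : nat -> nat) (X Y : seq nat) := forall x y, x \in Y -> y \in Y ->
  rk x < rk y -> index x X < index y X -> index x Y < index y Y.

(** K is a chain of the intersection of L with the order of X. *)
Definition consistent (rk : nat -> nat) (X K : seq nat) :=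
  forall x y, x \in K -> y \in K -> rk x < rk y -> index x X < index y X.

Section Phases.
Variables (w : nat) (lt : rel nat) (n : nat) (rk : nat -> nat).
Hypothesis ltP : forall i j, i < n -> j < n -> lt i j = (rk i < rk j).
Hypothesis rkI : forall i j, i < n -> j < n -> rk i = rk j -> i = j.
Hypothesis HW : 5000 * (n.+2 * n.+2 * (n.+2 * n.+2)) < 2 ^ w.
Notation ex := (ex w (Some lt)).

Lemma save_spec (Q : state -> nat -> Prop) s t cl z nz :
  vars s vcl = cl -> vars s vz = z -> vars s vnz = nz -> z + cl <= n -> nz <= n ->
  (forall s' t', frame save_cmd s s' -> vars s' vz = z + cl -> vars s' vnz = nz.+1 ->
    (forall q, q < z -> arrs s' aZ q = arrs s aZ q) ->
    (forall q, q < cl -> arrs s' aZ (z + q) = arrs s aC q) ->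
    arrs s' aZl nz = cl -> (forall q, q < nz -> arrs s' aZl q = arrs s aZl q) ->
    t' <= t + 20 * cl + 30 -> Q s' t') ->
  ex save_cmd Q s t.
Proof.
move=> Ecl Ez Enz zn nzn QP; apply: ex_framed; rewrite {1}/save_cmd.
have [M1 M2 M3] := word_facts HW.
have WW : 4 * n + 100 < 2 ^ w by move: M1 M2 M3; move: (n.+2 * n.+2) => y; clear -zn; lia.
apply: ex_seq.
pose I (i : nat) s' (t' : nat) := [/\ forall q, q < z -> arrs s' aZ q = arrs s aZ q,
  forall q, q < i -> arrs s' aZ (z + q) = arrs s aC q & t' <= t + 20 * i + 2].
apply: (ex_for (I := I) (a := 0) (b := cl)); [by ev|lia|lia|by []|..].
- by split=> //=; lia.
- by move=> s1 i t1 fr _ _; base fr; framev fr; ev.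
- move=> s1 i t1 fr ib Ei [h1 h2 tb]; base fr; framev fr.
  have EC1 : arrs s1 aC = arrs s aC by case: fr => _ ->.
  step => _; split; rewrite /=; last by lia.
    by move=> q qz; rewrite ifF ?h1 //; apply/eqP; lia.
  move=> q; rewrite ltnS leq_eqVlt => /predU1P[->|qi]; first by rewrite eqxx -?EC1.
  by rewrite ifF ?h2 //; apply/eqP; lia.
move=> s1 t1 fr _ [h1 h2 tb]; base fr; framev fr.
have EZl : arrs s1 aZl = arrs s aZl by case: fr => _ ->.
step; step; step => frm; apply: QP => //=; rewrite ?eqxx //.
- by rewrite addn1.
- by move=> q qn; rewrite EZl ltn_eqF.
- by lia.
Qed.

Lemma compact_spec (Q : state -> nat -> Prop) s t T :
  vars s vX = size T -> size T <= n -> holds (arrs s aA) T ->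
  (forall s' t' (T' := [seq x <- T | arrs s aPos x == 0]), frame compact_cmd s s' ->
    vars s' vX = size T' -> holds (arrs s' aA) T' -> t' <= t + 40 * size T + 20 -> Q s' t') ->
  ex compact_cmd Q s t.
Proof.
move=> EX Tn HA QP; apply: ex_framed; rewrite {1}/compact_cmd.
have [M1 M2 M3] := word_facts HW.
have WW : 4 * n + 100 < 2 ^ w by move: M1 M2 M3; move: (n.+2 * n.+2) => y; clear; lia.
step; apply: ex_seq.
pose T' i := [seq x <- take i T | arrs s aPos x == 0].
have szT i : i <= size T -> size (T' i) <= i.
  by move=> iT; rewrite size_filter (leq_trans (count_size _ _)) // size_take_min geq_minl.
pose I (i : nat) s' (t' : nat) := [/\ vars s' vc = size (T' i), holds (arrs s' aA) (T' i),
  forall q, i <= q -> q < size T -> arrs s' aA q = nth 0 T q & t' <= t + 40 * i + 4].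
apply: (ex_for (I := I) (a := 0) (b := size T)); [by ev|lia|lia|by []|..].
- by rewrite /I /T' take0; split=> //=; [move=> q _; apply: HA|lia].
- by move=> s1 i t1 fr _ _; base fr; framev fr; ev.
- move=> s1 i t1 fr ib Ei [h1 h2 h3 tb]; base fr; framev fr.
  have EP1 : arrs s1 aPos = arrs s aPos by case: fr => _ ->.
  have Ti : T' i.+1 = if arrs s aPos (nth 0 T i) == 0 then rcons (T' i) (nth 0 T i) else T' i.
    by rewrite /T' (take_nth 0) ?filter_rcons //; case/andP: ib.
  have sz := szT i ltac:(lia).
  step; rewrite h3 //.
  step; rewrite ?EP1; case: eqP Ti => _ Ti /=.
    step; step => _; rewrite /I Ti size_rcons; split=> /=; rewrite ?h1 ?addn1 //.
    - move=> p; rewrite size_rcons ltnS leq_eqVlt nth_rcons => /predU1P[->|pi].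
        by rewrite !eqxx ltnn.
      by rewrite pi ifF ?h2 //; apply/eqP; lia.
    - move=> q iq qT; rewrite ifF ?h3 //; [lia|apply/eqP; lia].
    - by lia.
  step => _; rewrite /I Ti; split=> //=; last by lia.
  by move=> q iq qT; rewrite h3 //; lia.
move=> s1 t1 fr _ [h1 h2 h3 tb]; base fr; framev fr.
step => frm; apply: QP => //=.
- by rewrite ?h1 /T' take_size.
- by move: h2; rewrite /T' take_size.
- by lia.
Qed.

Definition phase_result be X Cs X' :=
  [/\ perm_eq (Cs ++ X') X, sorted (lt_by rk) Cs, agree rk X X',
      size X <= 2 ^ be -> X' = [::]
    & forall K, uniq K -> {subset K <= X'} -> consistent rk X' K -> size K * 2 ^ be <= 22 * size X].

Lemma phase_facts be X T C cl pos (m := size X) :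
  {in X, forall x, x < n} -> uniq X -> same_blocks (nth 0 X) T m (2 ^ be) ->
  block_sorted rk T m (2 ^ be) -> distinct rk T 0 m -> sublist rk m C cl T m be ->
  (forall p, p < m -> pos_ok pos C cl (nth 0 X p)) ->
  phase_result be X (mkseq C cl) [seq x <- mkseq T m | pos x == 0].
Proof.
move=> Xn Xu [XT TX] srt Td [Ci CT full loss] pok.
set Cs := mkseq C cl; set Ts := mkseq T m; set X' := filter _ _.
have b0 : 0 < 2 ^ be by rewrite expn_gt0.
have Tsu : uniq Ts.
  rewrite map_inj_in_uniq ?iota_uniq // => p q; rewrite !mem_iota => pm qm e.
  by apply: Td => //; rewrite e.
have idT p : p < m -> index (T p) Ts = p.
  move=> pm; have -> : T p = nth 0 Ts p by rewrite nth_mkseq.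
  by rewrite index_uniq ?size_mkseq.
have inT x : x \in Ts -> T (index x Ts) = x /\ index x Ts < m.
  move=> xT; have h : index x Ts < m by rewrite -index_mem size_mkseq in xT.
  by split=> //; rewrite -[RHS](nth_index 0 xT) nth_mkseq.
have TsX x : (x \in Ts) = (x \in X).
  apply/idP/idP => [/inT[e /TX[q [qm _] e']]|xX].
    by rewrite -e -e' mem_nth.
  have [q [qm _] e] := XT (index x X) ltac:(by rewrite index_mem).
  by rewrite nth_index // in e; apply/mapP; exists q; rewrite ?mem_iota.
have pokX x : x \in X -> pos_ok pos C cl x by move=> xX; rewrite -(nth_index 0 xX); apply: pok; rewrite index_mem.
have CsX x : x \in Cs -> x \in X.
  by move/mapP=> [r]; rewrite mem_iota => /CT[p pm ->] ->; rewrite -TsX map_f // mem_iota.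
have posC x : x \in Cs -> pos x != 0.
  move=> xC; have [[_ h]|[h _]] := pokX x (CsX x xC); last by lia.
  by case/mapP: xC => r; rewrite mem_iota => rc e; case: (h r rc).
have Csu : uniq Cs.
  rewrite map_inj_in_uniq ?iota_uniq // => p q; rewrite !mem_iota => pm qm e.
  by case: (ltngtP p q) => // h; [have := Ci p q isT h qm|have := Ci q p isT h pm]; rewrite e ltnn.
have X'X x : x \in X' -> x \in X /\ ~~ member C cl x.
  rewrite mem_filter TsX => /andP[/eqP p0 xX]; split=> //.
  by apply: contraL (posC x) _; rewrite p0.
split.
- apply: uniq_perm => //.
    rewrite cat_uniq Csu filter_uniq // andbT; apply/hasPn => x /X'X[_]; exact.
  move=> x; rewrite mem_cat mem_filter TsX; apply/orP/idP => [[/CsX//|/andP[]//]|xX].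
  case: (boolP (pos x == 0)) => p0; first by right.
  left; have [[e _]|[h e]] := pokX x xX; first by rewrite e in p0.
  by rewrite -e map_f // mem_iota; lia.
- apply/(sortedP 0) => i; rewrite size_mkseq => ic.
  by rewrite /lt_by !nth_mkseq ?(ltnW ic) //; apply: Ci.
- move=> x y xX' yX' rxy ixy.
  move: (xX') (yX'); rewrite !mem_filter => /andP[px xT] /andP[py yT].
  rewrite index_filter_lt //.
  have [xX yX] : x \in X /\ y \in X by rewrite -!TsX.
  have [p1 [p1m b1] e1] := XT (index x X) ltac:(by rewrite index_mem).
  have [p2 [p2m b2] e2] := XT (index y X) ltac:(by rewrite index_mem).
  rewrite !nth_index // in e1 e2; rewrite -e1 -e2 !idT //.
  (* T differs from X only within blocks, and there it is sorted by rank: a pair in order in both X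
     and L cannot get inverted. *)
  rewrite ltnNge leq_eqVlt; apply/negP => /predU1P[e|h].
    by move: rxy; rewrite -e1 -e2 e ltnn.
  have bb : index x X %/ 2 ^ be <= index y X %/ 2 ^ be by rewrite leq_div2r // ltnW.
  have bb' : p2 %/ 2 ^ be <= p1 %/ 2 ^ be by rewrite leq_div2r // ltnW.
  have bE : p2 %/ 2 ^ be = p1 %/ 2 ^ be by apply/eqP; rewrite eqn_leq bb' b1 b2 bb.
  by have := srt p2 p1 h p1m bE; rewrite e1 e2 ltnNge (ltnW rxy).
- move=> mb; apply/eqP; rewrite -size_eq0 -leqn0 leqNgt; apply/negP => h.
  have xX' : nth 0 X' 0 \in X' by apply: mem_nth.
  have [xX] := X'X _ xX'; apply/negP; rewrite negbK.
  move: xX'; rewrite mem_filter => /andP[_ /inT[e im]]; rewrite -e; exact: full.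
move=> K Ku KX' Kc.
pose pT x := index x Ts.
have Kpos x y : x \in K -> y \in K -> rk x < rk y -> pT x < pT y.
  move=> xK yK rxy; have := Kc x y xK yK rxy.
  by move: (KX' x xK) (KX' y yK); rewrite !mem_filter => /andP[px _] /andP[py _]; rewrite index_filter_lt.
have KT x : x \in K -> T (pT x) = x /\ pT x < m.
  by move=> /KX'; rewrite mem_filter => /andP[_ /inT].
(* The chain K is increasing in T as well, so its items in blocks before k rank below its later
   items; one more than the largest of their ranks separates the two, and all of K lies in the
   windows. *)
pose Th k := \max_(x <- K | pT x < k * 2 ^ be) (rk x).+1.
have Thm : {homo Th : x y / x <= y}.
  move=> x y xy; apply/bigmax_leqP_seq => z zK zb.
  apply: (@leq_bigmax_seq _ K _ _ z) => //; apply: leq_trans zb _.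
  by rewrite leq_mul2r xy orbT.
have := loss Th Thm; apply: leq_trans; rewrite mulnC leq_mul2l; apply/orP; right.
rewrite -(size_map pT) /lost_count -size_filter; apply: uniq_leq_size.
  rewrite map_inj_in_uniq // => x y xK yK e.
  by have [<- _] := KT x xK; have [<- _] := KT y yK; rewrite e.
move=> p /mapP[x xK ->]; have [xT xm] := KT x xK; have [xX xnC] := X'X x (KX' x xK).
rewrite mem_filter mem_iota xm xT xnC /= andbT /in_window xT; apply/andP; split=> //.
apply/andP; split; last first.
  by apply: (@leq_bigmax_seq _ K _ _ x) => //; apply: ltn_ceil.
apply/bigmax_leqP_seq => y yK yb; rewrite ltnNge leq_eqVlt; apply/negP => /predU1P[e|h].
  have [yX _] := X'X y (KX' y yK).
  have exy : x = y by apply: rkI; rewrite ?Xn.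
  by move: yb; rewrite -exy ltnNge leq_divM.
have h' := leq_trans yb (leq_divM (pT x) (2 ^ be)).
by have := ltn_trans h' (Kpos x y xK yK h); rewrite ltnn.
Qed.

Lemma phase_spec (Q : state -> nat -> Prop) s t be (X : seq nat) z nz :
  {in X, forall x, x < n} -> uniq X -> 0 < size X -> 4 <= be -> 2 ^ be <= 16 * (n.+2 * n.+2) ->
  vars s vX = size X -> vars s vB = 2 ^ be -> holds (arrs s aA) X -> vars s vR = 4 * n ->
  vars s vz = z -> vars s vnz = nz -> z + size X <= n -> nz <= n ->
  (forall s' t' Cs X', frame phase_cmd s s' -> phase_result be X Cs X' ->
    vars s' vX = size X' -> vars s' vB = 2 ^ (2 * be) -> holds (arrs s' aA) X' ->
    vars s' vz = z + size Cs -> vars s' vnz = nz.+1 ->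
    (forall q, q < z -> arrs s' aZ q = arrs s aZ q) ->
    holds (fun q => arrs s' aZ (z + q)) Cs ->
    arrs s' aZl nz = size Cs -> (forall q, q < nz -> arrs s' aZl q = arrs s aZl q) ->
    t' <= t + 3000 * (size X * be) -> Q s' t') ->
  ex phase_cmd Q s t.
Proof.
move=> Xn Xu X0 be4 HB EX EBv EA ER Ez Enz zX nzn QP; apply: ex_framed; rewrite {1}/phase_cmd.
have [M1 M2 M3] := word_facts HW.
have Xsz : 0 < size X <= n by lia.
have Xv : valid n (nth 0 X) 0 (size X) by move=> p ps; apply: Xn; apply: mem_nth.
have Xd : distinct rk (nth 0 X) 0 (size X).
  by move=> p q ps qs /rkI e; apply/eqP; rewrite -(nth_uniq 0 ps qs Xu); apply/eqP; apply: e; apply: Xv.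
apply: ex_seq; apply: (@down_spec w lt n rk ltP (size X) be (nth 0 X)) => //.
move=> s1 t1 o m e ls T fr1 al1 me srt1 t1b; have [_ ch1 _ _ EA1] := al1.
have [omn e4 m0 wb _] := chain_bound Xsz be4 HB HW ch1.
have [F1 F2 F3] : [/\ vars s1 vX = size X, vars s1 vR = 4 * n & vars s1 vB = 2 ^ be].
  by case: fr1 => fv _; rewrite !fv.
have [F4 F5] : vars s1 vz = z /\ vars s1 vnz = nz by case: fr1 => fv _; rewrite !fv.
have [T0 [sb1a sb1b] B1] : exists2 T0, same_blocks (nth 0 X) T0 (size X) (2 ^ be)
    & forall p, p < size X -> arrs s1 aA p = T0 p.
  by case: al1 => _ c sl _ h; apply: chain_base c sl h.
apply: ex_seq; apply: (up_spec ltP Xsz be4 Xv HB HW al1 srt1 me F1 F2).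
- move=> p pm; rewrite B1 //; have [q [qm _] <-] := sb1b p pm; by exists q.
- move=> p pm; have [q [qm _] <-] := sb1a p pm; by exists q; rewrite ?B1.
move=> s2 t2 T2 fr2 up2 t2b.
have [o2 [m2 [e2 [cl [[[_ _ _ _] [oE mE eE sb] _ Td2 EA2] srt2 Ecl2 sub2 pok2]]]]] := up2.
subst o2 m2 e2; framev fr2.
have [Ci CT _ _] := sub2.
have clX : cl <= size X := incr_card Ci CT.
have PR := phase_facts Xn Xu sb srt2 Td2 sub2 pok2.
apply: ex_seq; apply: (save_spec (cl := cl) (z := z) (nz := nz)) => //; first by lia.
move=> s3 t3 fr3 Ez3 Enz3 Z3 Z3' l3 l3' t3b; framev fr3.
have EA3 : arrs s3 aA = arrs s2 aA by case: fr3 => _ fa; rewrite fa.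
have EP3 : arrs s3 aPos = arrs s2 aPos by case: fr3 => _ fa; rewrite fa.
apply: ex_seq; apply: (compact_spec (T := mkseq T2 (size X))); rewrite ?size_mkseq //; first by lia.
  by move=> p; rewrite size_mkseq => pm; rewrite EA3 nth_mkseq // EA2.
rewrite EP3; move=> s4 t4 /= fr4 Ex4 EA4 t4b.
have [F6 F7] : vars s4 vz = z + cl /\ vars s4 vnz = nz.+1 by case: fr4 => fv _; rewrite !fv.
framev fr4.
have bb : 2 ^ be * 2 ^ be <= 256 * (n.+2 * n.+2 * (n.+2 * n.+2)).
  by have := leq_mul HB HB; rewrite mulnACA.
step.
have e4Z : arrs s4 aZ = arrs s3 aZ by case: fr4 => _ fa; rewrite fa.
have e4l : arrs s4 aZl = arrs s3 aZl by case: fr4 => _ fa; rewrite fa.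
have eZ : arrs s2 aZ = arrs s aZ by case: fr2 => _ fa; rewrite fa //; case: fr1 => _ fa'; rewrite fa'.
have el : arrs s2 aZl = arrs s aZl by case: fr2 => _ fa; rewrite fa //; case: fr1 => _ fa'; rewrite fa'.
move=> frm; apply: QP PR _ _ _ _ _ _ _ _ _ _ => //=; rewrite ?size_mkseq //.
- by rewrite mul2n -addnn expnD.
- by move=> q qz; rewrite e4Z Z3 // eZ.
- by move=> q; rewrite size_mkseq => qc; rewrite e4Z Z3' // nth_mkseq.
- by rewrite e4l.
- by move=> q qz; rewrite e4l l3' // el.
- have h : 1 * 4 <= size X * be by apply: leq_mul.
  have h' : size X * 4 <= size X * be by rewrite leq_mul2l be4 orbT.
  by move: t1b t2b t3b t4b wb; rewrite /=; clear -h h' clX; lia.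
Qed.

End Phases.

(** * Running all phases and merging the lists that they leave *)

Notation va := 67. Notation aQ := 22.

Definition copy_cmd dst de len src se := For vp (K 0) (V len) (Put dst de (Get src se)).

Definition merge_last_cmd :=
  vnz ::= V vnz -: K 1 ;; vcl ::= Get aZl (V vnz) ;; vz ::= V vz -: V vcl ;;
  copy_cmd aA (V vp) vcl aZ (V vz +! V vp) ;;
  copy_cmd aA (V vcl +! V vp) va aQ (V vp) ;;
  vlo ::= K 0 ;; vst ::= K 0 ;; vmid ::= V vcl ;; ven ::= V vcl +! V va ;; merge_cmd ;;
  va ::= V ven ;;
  copy_cmd aQ (V vp) va aT (V vp).

Definition phases_cmd :=
  vB ::= K 16 ;; vz ::= K 0 ;; vnz ::= K 0 ;; While (K 0 <! V vX) phase_cmd.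

Definition adaptive_sort_cmd := phases_cmd ;; va ::= K 0 ;; While (K 0 <! V vnz) merge_last_cmd.

Section Copy.
Variables (w : nat) (orc : option (rel nat)).

Lemma copy_spec (Q : state -> nat -> Prop) s t dst de len src se D O m :
  vars s len = m -> len != vp -> src != dst -> m + 2 < 2 ^ w -> cost de + cost se <= 6 ->
  (forall s' i, same_but [:: vp] [:: dst] s s' -> vars s' vp = i -> i < m ->
     eval w s' de = D + i /\ eval w s' se = O + i) ->
  (forall s' t', frame (copy_cmd dst de len src se) s s' ->
    (forall p, p < m -> arrs s' dst (D + p) = arrs s src (O + p)) ->
    (forall q, ~~ (D <= q < D + m) -> arrs s' dst q = arrs s dst q) ->
    t' <= t + 20 * m + 10 -> Q s' t') ->
  ex w orc (copy_cmd dst de len src se) Q s t.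
Proof.
move=> Em lenN sd mW cc EV QP; apply: ex_framed; rewrite {1}/copy_cmd.
pose I (i : nat) s' (t' : nat) := [/\ forall p, p < i -> arrs s' dst (D + p) = arrs s src (O + p),
    forall q, ~~ (D <= q < D + i) -> arrs s' dst q = arrs s dst q & t' <= t + 20 * i + 2].
apply: (ex_for (I := I) (a := 0) (b := m)); [by ev|lia|lia|by []|..].
- by split=> //=; lia.
- move=> s1 i t1 fr _ _ /=; by case: fr => fv _; rewrite fv // mem_seq1.
- move=> s1 i t1 fr ib Ei [h1 h2 tb].
  have fr' : same_but [:: vp] [:: dst] s s1 by weaken fr.
  have [e1 e2] := EV s1 i fr' Ei ib.
  have ES : arrs s1 src = arrs s src by case: fr' => _ fa; rewrite fa // inE.
  eapply ex_put; [exact: e1 | eapply evG; exact: e2 |] => _.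
  split; rewrite /= ?ES; last by lia.
    move=> p; rewrite eqxx ltnS leq_eqVlt => /predU1P[->|pi]; first by rewrite eqxx.
    by rewrite ifF ?h1 //; apply/eqP; lia.
  by move=> q qN; rewrite eqxx ifF ?h2 //; [lia|apply/eqP; lia].
- move=> s1 t1 fr _ [h1 h2 tb] frm; apply: QP => //=; lia.
Qed.
End Copy.

Section Merges.
Variables (w : nat) (lt : rel nat) (n : nat) (rk : nat -> nat).
Hypothesis ltP : forall i j, i < n -> j < n -> lt i j = (rk i < rk j).
Hypothesis rkI : forall i j, i < n -> j < n -> rk i = rk j -> i = j.
Hypothesis HW : 5000 * (n.+2 * n.+2 * (n.+2 * n.+2)) < 2 ^ w.
Notation ex := (ex w (Some lt)).
Notation W := (2 ^ w).

Lemma merge_last_spec (Q : state -> nat -> Prop) s t nz z (C acc : seq nat) :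
  vars s vnz = nz.+1 -> arrs s aZl nz = size C -> vars s vz = z + size C -> vars s va = size acc ->
  holds (fun q => arrs s aZ (z + q)) C -> holds (arrs s aQ) acc ->
  sorted (lt_by rk) C -> sorted (lt_by rk) acc -> uniq (C ++ acc) ->
  {in C ++ acc, forall x, x < n} -> z + size C + size acc <= n -> nz <= n ->
  (forall s' t' acc', frame merge_last_cmd s s' ->
    vars s' vnz = nz -> vars s' vz = z -> vars s' va = size acc' -> holds (arrs s' aQ) acc' ->
    sorted (lt_by rk) acc' -> perm_eq acc' (C ++ acc) ->
    t' <= t + 150 * (size C + size acc) + 100 -> Q s' t') ->
  ex merge_last_cmd Q s t.
Proof.
move=> Enz El Ez Ea hC hacc sC sacc u vn zn nzn QP; apply: ex_framed; rewrite {1}/merge_last_cmd.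
have [M1 M2 M3] := word_facts HW.
have WW : 10 * n + 100 < W by move: M1 M2 M3; move: (n.+2 * n.+2) => y; clear; lia.
set c := size C in El Ez zn *; set a := size acc in Ea zn *.
step; rewrite subn1 /=; step; step; rewrite El addnK.
apply: ex_seq; apply: (@copy_spec _ _ _ _ _ _ _ _ _ _ 0 z (c)) => //; first by lia.
  move=> s' i fr Ei ic; have G : vars s' vz = z by case: fr => fv _; rewrite fv.
  by split; ev.
move=> s1 t1 fr1 A1 _ t1b.
have [F1 F2 F3] : [/\ vars s1 vnz = nz, vars s1 vcl = c & vars s1 vz = z].
  by case: fr1 => fv _; rewrite !fv.
base fr1; framev fr1.
apply: ex_seq; apply: (@copy_spec _ _ _ _ _ _ _ _ _ _ c 0 (a)) => //; first by lia.
  by move=> s' i fr Ei ic; framev fr; split; ev.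
move=> s2 t2 fr2 A2 A2' t2b; framev fr2.
have EQ1 : arrs s1 aQ = arrs s aQ by case: fr1 => _ fa; rewrite fa.
pose l := C ++ acc.
have sl : size l = c + a by rewrite size_cat.
have Al p : p < c + a -> arrs s2 aA p = nth 0 l p.
  move=> pl; rewrite nth_cat -/c; case: ltnP => pc.
    by rewrite A2' ?A1 ?hC //; lia.
  have -> : p = c + (p - c) by lia.
  by rewrite A2 ?EQ1 ?add0n ?hacc -/a ?addKn //; lia.
have srt (L : seq nat) p q : sorted (lt_by rk) L -> p < q -> q < size L -> rk (nth 0 L p) < rk (nth 0 L q).
  move=> sL pq qL; have tr : transitive (lt_by rk) by move=> y x z'; apply: ltn_trans.
  by apply: (sorted_ltn_nth tr) => //; rewrite inE; lia.
step; step; step; step.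
apply: ex_seq; apply: (@merge_spec w lt n rk ltP _ _ _ 0 0 c (c + a)) => //=.
- by lia.
- by lia.
- by move=> p /= pl; rewrite Al //; apply: vn; apply: mem_nth; rewrite sl.
- move=> p q /= pl ql; rewrite !Al // => e; apply/eqP; rewrite -(nth_uniq 0 _ _ u) -/l ?sl //.
  by apply/eqP/rkI => //; apply: vn; apply: mem_nth; rewrite sl.
- move=> p q _ pq qc; rewrite !Al; try lia.
  by rewrite !nth_cat -/c qc (ltn_trans pq qc); apply: srt.
- move=> p q cp pq qc; rewrite !Al; try lia.
  have [pF qF] : (p < c) = false /\ (q < c) = false by split; lia.
  rewrite !nth_cat -/c pF qF.
  by apply: srt => //; rewrite -/a; lia.
move=> s3 t3 /= fr3 t3b gi ifg igf _.
have [F4 F5] : vars s3 ven = c + a /\ vars s3 vcl = c by case: fr3 => fv _; rewrite !fv.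
base fr3; framev fr3; step.
apply: (@copy_spec _ _ _ _ _ _ _ _ _ _ 0 0 (c + a)) => //; first by lia.
move=> s4 t4 fr4 A4 _ t4b frm.
have [F6 F7] : vars s4 va = c + a /\ True by case: fr4 => fv _; rewrite !fv.
base fr4; framev fr4.
apply: (QP _ _ (mkseq (arrs s3 aT) (c + a))) => //; rewrite ?size_mkseq //.
- by move=> p; rewrite size_mkseq => pl; rewrite nth_mkseq // A4.
- apply/(sortedP 0) => i; rewrite size_mkseq => ic.
  by rewrite /lt_by !nth_mkseq ?(ltnW ic) //; apply: gi.
- apply: uniq_perm => //.
    rewrite map_inj_in_uniq ?iota_uniq // => p q; rewrite !mem_iota => pm qm e.
    by case: (ltngtP p q) => // h; [have := gi p q isT h qm|have := gi q p isT h pm]; rewrite e ltnn.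
  move=> x; apply/mapP/idP => [[p]|xl].
    rewrite mem_iota => pl ->; have [q ql <-] := igf p pl.
    by rewrite Al // mem_nth // sl.
  have il : index x l < c + a by rewrite -sl index_mem.
  have [q ql e] := ifg _ il; exists q; first by rewrite mem_iota.
  by rewrite e Al // nth_index.
- by move: t1b t2b t3b t4b; rewrite /=; clear; lia.
Qed.

(** The trace of the phases, kept for the analysis: each entry pairs the items that entered a phase
    with the list that it managed to sort. *)
Fixpoint steps (be : nat) (X : seq nat) (r : seq (seq nat * seq nat)) (X' : seq nat) : Prop :=
  if r is (Y, C) :: r' then
    [/\ Y = X, 0 < size X & exists2 X1, phase_result rk be X C X1 & steps (2 * be) X1 r' X']
  else X' = X.

Fixpoint steps_cost be (r : seq (seq nat * seq nat)) :=
  if r is (Y, _) :: r' then size Y * be + steps_cost (2 * be) r' else 0.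

Lemma steps_rcons be X r X' C X'' :
  steps be X r X' -> 0 < size X' -> phase_result rk (be * 2 ^ size r) X' C X'' ->
  steps be X (rcons r (X', C)) X''.
Proof.
elim: r be X => [|[Y D] r IH] be X /=.
  by move=> -> X0; rewrite muln1 => pr; split=> //; exists X''.
move=> [-> X0 [X1 pr st]] X'0; rewrite expnS mulnCA mulnA => pr'; split=> //.
by exists X1 => //; apply: IH.
Qed.

Lemma steps_cost_rcons be r X C :
  steps_cost be (rcons r (X, C)) = steps_cost be r + size X * (be * 2 ^ size r).
Proof.
elim: r be => [|[Y D] r IH] be /=; first by rewrite muln1 addn0.
by rewrite IH expnS addnA (mulnCA be) (mulnA 2 be).
Qed.

Lemma steps_perm be X r X' : steps be X r X' -> perm_eq (flatten (unzip2 r) ++ X') X.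
Proof.
elim: r be X => [|[Y D] r IH] be X /=; first by move=> ->.
move=> [_ X0 [X1 [pr _ _ fin loss] /IH p]].
by rewrite -catA (perm_trans _ pr) // perm_cat2l.
Qed.

Fixpoint merge_cost (Cs : seq (seq nat)) :=
  if Cs is _ :: Cs' then (size (flatten Cs)).+1 + merge_cost Cs' else 0.

(** The lists are merged from the last to the first, so the merge that adds the list of a phase
    touches just the items that entered this phase and is no dearer than the phase itself. *)
Lemma merge_cost_le be X r : 2 <= be -> steps be X r [::] -> merge_cost (unzip2 r) <= steps_cost be r.
Proof.
elim: r be X => [//|[Y D] r IH] be X be2 st.
have /perm_size := steps_perm st; rewrite cats0 => sz.
case: st => -> X0 [X1 _ /IH h]; apply: leq_add; last by apply: h; lia.
rewrite sz; apply: (@leq_trans (size X * 2)); first by rewrite muln2 -addnn -addn1 leq_add2l.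
by rewrite leq_mul2l be2 orbT.
Qed.

Lemma phases_spec (Q : state -> nat -> Prop) s t (S : seq nat) :
  {in S, forall x, x < n} -> uniq S -> size S <= n -> vars s vX = size S -> holds (arrs s aA) S ->
  vars s vR = 4 * n ->
  (forall s' t' r (Cs := unzip2 r), frame phases_cmd s s' -> steps 4 S r [::] -> size r <= n.+1 ->
    vars s' vnz = size r -> vars s' vz = size (flatten Cs) -> holds (arrs s' aZ) (flatten Cs) ->
    (forall i, i < size r -> arrs s' aZl i = size (nth [::] Cs i)) ->
    t' <= t + 3100 * steps_cost 4 r + 20 -> Q s' t') ->
  ex phases_cmd Q s t.
Proof.
move=> Sn Su Ssz EX EA ER QP; apply: ex_framed; rewrite {1}/phases_cmd.
have [M1 M2 M3] := word_facts HW.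
have WW : 10 * n + 100 < W by move: M1 M2 M3; move: (n.+2 * n.+2) => y; clear; lia.
step; step; step.
pose I s' (t' : nat) := exists r X, let Cs := unzip2 r in let be := 4 * 2 ^ size r in
  [/\ [/\ steps 4 S r X, size r <= n.+1 & 0 < size X -> 2 ^ be <= 16 * (n.+2 * n.+2) /\ size r <= n],
    [/\ vars s' vX = size X, vars s' vB = 2 ^ be, holds (arrs s' aA) X & vars s' vR = 4 * n],
    vars s' vnz = size r /\ vars s' vz = size (flatten Cs),
    holds (arrs s' aZ) (flatten Cs) /\
      forall i, i < size r -> arrs s' aZl i = size (nth [::] Cs i)
    & t' <= t + 3010 * steps_cost 4 r + 10].
apply: (ex_while (I := I) (mu := fun s => (vars s vX > 0) * (n.+2 - vars s vnz))).
- exists [::], S; rewrite /= muln1; split=> //; last by lia.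
  by split=> // _; split=> //; move: M2; clear; move: (n.+2 * n.+2) => y; lia.
- move=> s1 t1 fr [r [X [[st rn HB] [EX1 EB1 EA1 ER1] [Enz Ez] [hZ hl] tb]]].
  have pst := steps_perm st.
  have psz : size (flatten (unzip2 r)) + size X = size S by rewrite -(perm_size pst) size_cat.
  rewrite (ev_lt (u := 0) (v := size X)) ?evC ?expn_gt0 //; last by lia.
  rewrite eqb0 negbK => X0; have [{}HB rn'] := HB X0.
  have XS : {subset X <= S} by move=> x xX; rewrite -(perm_mem pst) mem_cat xX orbT.
  have Xu : uniq X by move: Su; rewrite -(perm_uniq pst) cat_uniq => /and3P[].
  have be4 : 4 <= 4 * 2 ^ size r by rewrite leq_pmulr ?expn_gt0.
  apply: (phase_spec ltP rkI HW _ Xu X0 be4 HB EX1 EB1 EA1 ER1 Ez Enz) => //.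
  + by move=> x /XS; apply: Sn.
  + by lia.
  move=> s2 t2 C X' fr2 pr EX2 EB2 EA2 Ez2 Enz2 Z1 Z2 l1 l2 t2b.
  have [pr1 _ _ fin _] := pr.
  have sC : size C + size X' = size X by rewrite -(perm_size pr1) size_cat.
  (* Items are left over only if one block did not cover X. Then the block size is below n, so its
     square still fits into a word, and the number of phases, being doubly logarithmic in the block
     size, is below n. *)
  have more : 0 < size X' -> 2 ^ (2 * (4 * 2 ^ size r)) <= 16 * (n.+2 * n.+2) /\ (size r).+1 <= n.
    move=> X'0; have bX : 2 ^ (4 * 2 ^ size r) < size X.
      by rewrite ltnNge; apply/negP => /fin e; rewrite e in X'0.
    split.
      rewrite mul2n -addnn expnD.
      have := leq_mul (ltnW bX) (ltnW bX); have : size X * size X <= n.+2 * n.+2 by apply: leq_mul; lia.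
      by move: (2 ^ _ * _) (size X * _) (n.+2 * _); clear; lia.
    have := ltn_expl (size r) (isT : 1 < 2).
    have := ltn_expl (4 * 2 ^ size r) (isT : 1 < 2).
    by move: bX sC psz; clear -Ssz; lia.
  split; last by rewrite EX1 EX2 Enz Enz2 X0; case: (0 < size X'); lia.
  exists (rcons r (X, C)), X'; rewrite /unzip2 map_rcons -/(unzip2 r) size_rcons flatten_rcons size_cat /=.
  have be2 : 4 * 2 ^ (size r).+1 = 2 * (4 * 2 ^ size r) by rewrite expnS mulnCA.
  have Fz : 53 \notin mod_vars phase_cmd by [].
  rewrite be2 steps_cost_rcons; split=> //.
  + by split=> //; apply: steps_rcons.
  + by split=> //; case: fr2 => fv _; rewrite fv.
  + split.
      move=> p; rewrite size_cat nth_cat => pl; case: ltnP => pz; first by rewrite Z1 // hZ.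
      have := Z2 (p - size (flatten (unzip2 r))) ltac:(lia).
      by rewrite subnKC.
    move=> i; rewrite ltnS leq_eqVlt nth_rcons size_map => /predU1P[->|ir].
      by rewrite ltnn eqxx.
    by rewrite ir l2 // hl.
  + have : 1 * 1 <= size X * (4 * 2 ^ size r) by apply: leq_mul; lia.
    by move: t2b tb; rewrite /=; move: (size X * _); clear; lia.
- move=> s1 t1 fr [r [X [[st rn HB] [EX1 EB1 EA1 ER1] [Enz Ez] [hZ hl] tb]]].
  have pst := steps_perm st.
  have psz : size (flatten (unzip2 r)) + size X = size S by rewrite -(perm_size pst) size_cat.
  rewrite (ev_lt (u := 0) (v := size X)) ?evC ?expn_gt0 //; last by lia.
  move/eqP; rewrite eqb0 -leqNgt leqn0 size_eq0 => /eqP X0 frm; rewrite X0 in st.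
  by apply: (QP _ _ r) => //; rewrite /=; lia.
Qed.

Lemma adaptive_sort_spec (Q : state -> nat -> Prop) s t (S : seq nat) :
  {in S, forall x, x < n} -> uniq S -> size S <= n -> vars s vX = size S -> holds (arrs s aA) S ->
  vars s vR = 4 * n ->
  (forall s' t' r S', frame adaptive_sort_cmd s s' -> steps 4 S r [::] ->
    vars s' va = size S -> holds (arrs s' aQ) S' -> perm_eq S' S -> sorted (lt_by rk) S' ->
    t' <= t + 4000 * steps_cost 4 r + 50 -> Q s' t') ->
  ex adaptive_sort_cmd Q s t.
Proof.
move=> Sn Su Ssz EX EA ER QP; apply: ex_framed; rewrite {1}/adaptive_sort_cmd.
have [M1 M2 M3] := word_facts HW.
have WW : 10 * n + 100 < W by move: M1 M2 M3; move: (n.+2 * n.+2) => y; clear; lia.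
clear M1 M2 M3.
apply: ex_seq; apply: (phases_spec Sn Su Ssz EX EA ER).
move=> s1 t1 r Cs fr1 st rn Enz Ez hZ hl t1b.
have pst := steps_perm st; rewrite cats0 -/Cs in pst.
have szCs : size Cs = size r by rewrite size_map.
have srtC : forall i, i < size r -> sorted (lt_by rk) (nth [::] Cs i).
  rewrite /Cs; elim: (r) (4) (S) (st) => //= -[Y D] r' IH be X [_ _ [X1 [_ sD _ _ _] st']] [|i] //=.
  exact: (IH _ _ st').
step.
pose I s' (t' : nat) := exists i acc,
  [/\ vars s' vnz = i /\ i <= size r, vars s' vz = size (flatten (take i Cs)),
     vars s' va = size acc /\ holds (arrs s' aQ) acc,
     sorted (lt_by rk) acc /\ perm_eq acc (flatten (drop i Cs))
   & t' <= t1 + 200 * merge_cost (drop i Cs) + 10].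
apply: (ex_while (I := I) (mu := fun s => vars s vnz)).
- exists (size r), [::]; rewrite -szCs take_size drop_size /=; split=> //; last by lia.
  by rewrite szCs.
- move=> s2 t2 fr2 [i [acc [[Ei ir] Ez2 [Ea ha] [sa pa] tb]]].
  have psz : size acc = size (flatten (drop i Cs)) := perm_size pa.
  rewrite (ev_lt (u := 0) (v := i)) ?evC ?expn_gt0 //; last by lia.
  rewrite eqb0 negbK; case: i => [//|i] in Ei ir Ez2 pa tb psz *; move=> _.
  have EZ2 : arrs s2 aZ = arrs s1 aZ by case: fr2 => _ fa; rewrite fa.
  have El2 : arrs s2 aZl = arrs s1 aZl by case: fr2 => _ fa; rewrite fa.
  have iC : i < size Cs by rewrite szCs.
  set C := nth [::] Cs i.
  have tC : take i.+1 Cs = rcons (take i Cs) C by rewrite (take_nth [::]).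
  have dC : drop i Cs = C :: drop i.+1 Cs by rewrite (drop_nth [::]).
  have fC : flatten Cs = flatten (take i Cs) ++ (C ++ flatten (drop i.+1 Cs)).
    by rewrite -{1}(cat_take_drop i Cs) flatten_cat dC.
  rewrite tC flatten_rcons size_cat in Ez2.
  have p2 : perm_eq (C ++ acc) (C ++ flatten (drop i.+1 Cs)) by rewrite perm_cat2l.
  have Fsz : size (flatten Cs) <= n by rewrite (perm_size pst).
  have Fsz' := Fsz; rewrite fC !size_cat in Fsz'.
  apply: (@merge_last_spec _ _ _ i (size (flatten (take i Cs))) C acc) => //.
  + by rewrite El2 hl.
  + move=> p pC; rewrite EZ2 hZ; last by rewrite fC !size_cat; lia.
    by rewrite fC nth_cat ltnNge leq_addr addKn nth_cat pC.
  + by apply: srtC; rewrite -szCs.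
  + rewrite (perm_uniq p2); have : uniq (flatten Cs) by rewrite (perm_uniq pst).
    by rewrite fC cat_uniq => /and3P[].
  + move=> x; rewrite (perm_mem p2) => xC; apply: Sn; rewrite -(perm_mem pst) fC mem_cat xC orbT.
    by [].
  + by rewrite psz; lia.
  + by lia.
  move=> s3 t3 acc' fr3 Enz3 Ez3 Ea3 ha3 sa3 pa3 t3b.
  split; last by rewrite Enz3 Ei.
  exists i, acc'; split=> //; first by split=> //; lia.
    by split=> //; rewrite dC (perm_trans pa3).
  move: t3b tb; rewrite dC /= size_cat psz; clear; lia.
- move=> s2 t2 fr2 [i [acc [[Ei ir] Ez2 [Ea ha] [sa pa] tb]]].
  rewrite (ev_lt (u := 0) (v := i)) ?evC ?expn_gt0 //; last by lia.
  move/eqP; rewrite eqb0 -leqNgt leqn0 => /eqP i0 frm; rewrite i0 drop0 in pa tb.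
  have pS := perm_trans pa pst.
  apply: (QP _ _ r acc) => //; first by rewrite Ea (perm_size pS).
  have := merge_cost_le (be := 4) isT st; rewrite -/Cs.
  by move: tb t1b; rewrite /=; clear; lia.
Qed.

End Merges.

(** * Insertion into the path *)

Notation vh := 70. Notation vn := 71. Notation vr := 72. Notation vlast := 73. Notation vs := 74.
Notation aPath := 23. Notation aLp := 24.

Definition gallop_cmd :=
  vd ::= K 1 ;; probe_cmd aPath vh ;;
  While (V vf ==! K 0) (vd ::= K 2 *! V vd ;; probe_cmd aPath vh) ;;
  descend_cmd aPath vh.

(* [vlast] is 1 + the item after which [vx] goes, and 0 at the head. *)
Definition splice_cmd :=
  If (V vr <! V vg) (vlast ::= Get aPath (V vg -: K 1) +! K 1) Skip ;;
  If (V vg <! V vh) (Put 0 (V vx) (Get aPath (V vg))) (Put 0 (V vx) (V vn)) ;;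
  If (V vlast) (Put 0 (V vlast -: K 1) (V vx)) (0 ::= V vx) ;;
  vlast ::= V vx +! K 1 ;; vr ::= V vg.

Definition insert_cmd :=
  vr ::= K 0 ;; vlast ::= K 0 ;;
  For vs (K 0) (V va) (
    vx ::= Get aQ (V vs) ;;
    vg ::= Get aLp (V vx) ;; If (V vg <! V vr) (vg ::= V vr) Skip ;;
    gallop_cmd ;; splice_cmd).

Lemma linked_list_eq f g nil p l :
  {in l, f =1 g} -> linked_list f nil p l -> linked_list g nil p l.
Proof.
elim: l p => //= x l IH p fg [-> lk]; split=> //; rewrite -fg ?mem_head //.
by apply: IH lk => y yl; apply: fg; rewrite inE yl orbT.
Qed.

Lemma linked_list_head f nil p l : linked_list f nil p l -> p = head nil l.
Proof. by case: l => [|x l] //= []. Qed.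

Lemma linked_list_cons f nil p x B g : linked_list f nil p B -> x \notin B ->
  g x = head nil B -> {in B, g =1 f} -> linked_list g nil x (x :: B).
Proof.
move=> lk xB gx gf /=; split=> //; rewrite gx -(linked_list_head lk).
by apply: linked_list_eq lk => y /gf.
Qed.

Lemma linked_list_splice f nil p A a x B g :
  linked_list f nil p (rcons A a ++ B) -> uniq (x :: rcons A a ++ B) ->
  g a = x -> g x = head nil B -> (forall y, y != a -> y != x -> g y = f y) ->
  linked_list g nil p (rcons A a ++ x :: B).
Proof.
move=> lk /andP[xN u] ga gx gf; elim: A p lk xN u => [|b A IH] p /= [-> lk] xN /andP[bN u]; split=> //.
  rewrite ga; move: xN; rewrite inE negb_or => /andP[xa xB].
  apply: (linked_list_cons lk xB gx) => y yB; apply: gf.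
    by apply: contraNneq bN => <-.
  by apply: contraNneq xB => <-.
move: xN; rewrite inE negb_or => /andP[xb xN].
rewrite gf; [exact: IH| |by rewrite eq_sym].
by apply: contraNneq bN => ->; rewrite mem_cat mem_rcons mem_head.
Qed.

Lemma count_split (T : Type) (P : pred T) (x0 : T) l g : g <= size l ->
  (forall q, q < g -> P (nth x0 l q)) -> (forall q, g <= q -> q < size l -> ~~ P (nth x0 l q)) ->
  count P l = g.
Proof.
move=> gl h1 h2; rewrite -(cat_take_drop g l) count_cat.
have /eqP -> : count P (take g l) == g.
  rewrite -{2}(size_takel gl) -all_count; apply/(all_nthP x0) => q; rewrite size_takel // => qg.
  by rewrite nth_take // h1.
have /eqP -> : count P (drop g l) == 0; last by rewrite addn0.
rewrite eqn0Ngt -has_count; apply/(has_nthP x0) => -[q]; rewrite size_drop nth_drop => ql.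
by apply/negP; apply: h2; lia.
Qed.

Section Insert.
Variables (w : nat) (lt : rel nat) (n : nat) (rk : nat -> nat).
Hypothesis ltP : forall i j, i < n -> j < n -> lt i j = (rk i < rk j).
Hypothesis rkI : forall i j, i < n -> j < n -> rk i = rk j -> i = j.
Hypothesis WW : 10 * n + 100 < 2 ^ w.
Notation ex := (ex w (Some lt)).
Variables (path : seq nat) (lp : nat -> nat).
Hypothesis pathn : {in path, forall x, x < n}.
Hypothesis pathS : sorted (lt_by rk) path.
Hypothesis pathsz : size path <= n.

Lemma lt_by_trans : transitive (lt_by rk).
Proof. by move=> y x z; apply: ltn_trans. Qed.

Lemma path_incr : incr rk (nth 0 path) 0 (size path).
Proof.
by move=> p q _ pq qs; apply: (sorted_ltn_nth lt_by_trans) => //; rewrite inE; lia.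
Qed.

(** The time is logarithmic in the distance travelled, not in the length of the path; only this can
    be paid for by the gaps. *)
Lemma gallop_spec (Q : state -> nat -> Prop) s t g x :
  vars s vg = g -> vars s vx = x -> vars s vh = size path -> holds (arrs s aPath) path ->
  g <= size path -> x < n -> (forall q, q < g -> rk (nth 0 path q) <= rk x) ->
  (forall s' t' g', frame gallop_cmd s s' -> vars s' vg = g' -> g <= g' <= size path ->
    (forall q, q < g' -> rk (nth 0 path q) <= rk x) ->
    (g' < size path -> rk x < rk (nth 0 path g')) ->
    t' <= t + 200 * (trunc_log 2 (g' - g + 1)).+1 -> Q s' t') ->
  ex gallop_cmd Q s t.
Proof.
move=> Eg Ex Eh hp gh xn lo QP; apply: ex_framed; rewrite {1}/gallop_cmd.
have pv : valid n (arrs s aPath) 0 (size path) by move=> p /= pl; rewrite hp //; apply: pathn; apply: mem_nth.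
have pinc : incr rk (arrs s aPath) 0 (size path).
  by move=> p q p0 pq qs; rewrite !hp //; [apply: path_incr|lia].
step; apply: ex_seq; apply: (@probe_spec w lt n rk ltP aPath vh isT _ _ _ g 1 x (size path)) => //=; first by lia.
move=> s1 t1 fr1 Ef1 t1b.
have [F1 F2] : vars s1 vd = 1 /\ vars s1 vg = g by case: fr1 => fv _; rewrite !fv.
have P1 : arrs s1 aPath = arrs s aPath by case: fr1 => _ fa; rewrite fa.
base fr1; framev fr1; apply: ex_seq.
pose f := arrs s aPath.
pose I s' (t' : nat) := exists de, [/\ vars s' vd = 2 ^ de /\ 2 ^ de <= 2 * size path + 1,
  vars s' vf = (g + 2 ^ de <= size path) ==> (rk x < rk (f (g + 2 ^ de).-1)),
  0 < de -> g + 2 ^ de.-1 <= size path /\ rk (f (g + 2 ^ de.-1).-1) <= rk x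
  & t' <= t + 60 * de + 60].
apply: (ex_while (I := I) (mu := fun s => 2 * size path + 1 - vars s vd)).
- by exists 0; rewrite /= in t1b; split=> //; lia.
- move=> s2 t2 fr2 [de [[Ed db] Ef dl tb]]; framev fr2.
  have P2 : arrs s2 aPath = f by case: fr2 => _ fa; rewrite fa.
  rewrite (ev_eq (u := vars s2 vf) (v := 0)) ?evC //; [|lia|lia].
  rewrite eqb0 negbK => /eqP f0; rewrite f0 in Ef.
  have [c1 c2] : g + 2 ^ de <= size path /\ rk (f (g + 2 ^ de).-1) <= rk x.
    by move/esym/eqP: Ef; rewrite eqb0 negb_imply -leqNgt => /andP.
  have d0 : 0 < 2 ^ de by rewrite expn_gt0.
  step; apply: (@probe_spec w lt n rk ltP aPath vh isT _ _ _ g (2 * 2 ^ de) x (size path)) => //=; try lia.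
    by rewrite P2.
  rewrite P2; move=> s3 t3 fr3 Ef3 t3b.
  have F3 : vars s3 vd = 2 * 2 ^ de by case: fr3 => fv _; rewrite !fv.
  split; last by rewrite F3 ?Ed; lia.
  exists de.+1; rewrite !expnS /=; split=> //; last by rewrite /= in t3b; lia.
  by split=> //; lia.
- move=> s2 t2 fr2 [de [[Ed db] Ef dl tb]]; framev fr2.
  have P2 : arrs s2 aPath = f by case: fr2 => _ fa; rewrite fa.
  rewrite (ev_eq (u := vars s2 vf) (v := 0)) ?evC //; [|lia|lia].
  move/eqP; rewrite eqb0 Ef eqb0 negbK => /implyP c.
  apply: (@descend_spec w lt n rk ltP aPath vh isT isT _ _ _ g de x (size path)) => //=; rewrite ?P2 //.
  + by lia.
  + by move=> q qg; rewrite /f hp ?lo //; lia.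
  move=> s3 t3 g' fr3 Eg3 gb lo3 hi3 t3b frm; apply: (QP _ _ g') => //.
  + by move=> q qg; rewrite -hp ?lo3 //; lia.
  + by move=> h; rewrite -hp ?hi3.
  (* The last probe but one still found a rank at most that of x, so g' is at least half the final
     step away from g. *)
  rewrite /= in t3b; suff : de <= (trunc_log 2 (g' - g + 1)).+1 by lia.
  case: de => [//|de] in Ed db Ef dl tb c t3b *.
  rewrite ltnS; apply: trunc_log_max => //.
  have [//|h1 h2] := dl; rewrite /= in h1 h2.
  suff : g + 2 ^ de <= g' by lia.
  rewrite leqNgt; apply/negP => h.
  have g'l : g' < size path by lia.
  have := hi3 g'l; rewrite ltnNge; case/negP; apply: leq_trans h2.
  have [->|ne] := eqVneq g' (g + 2 ^ de).-1; first by [].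
  by apply: ltnW; apply: pinc; lia.
Qed.

Definition last_code (M : seq nat) := if M is y :: M' then (last y M').+1 else 0.

Lemma last_code_rcons M y : last_code (rcons M y) = y.+1.
Proof. by case: M => //= z M; rewrite last_rcons. Qed.

(** M is the finished part of the output, which contains the first r path items. The path items
    between r and g are passed over without a write, since they are linked to each other already;
    this is why the time does not depend on g - r. *)
Lemma splice_spec (Q : state -> nat -> Prop) s t M r g x
    (A := M ++ take (g - r) (drop r path)) (B := drop g path) :
  vars s vr = r -> vars s vg = g -> r <= g <= size path -> vars s vx = x -> x < n ->
  vars s vlast = last_code M -> vars s vn = n -> vars s vh = size path ->
  holds (arrs s aPath) path -> {in M, forall y, y < n} ->
  linked_list (arrs s 0) n (vars s 0) (M ++ drop r path) -> uniq (x :: M ++ drop r path) ->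
  (forall s' t', frame splice_cmd s s' -> vars s' vr = g -> vars s' vlast = x.+1 ->
     linked_list (arrs s' 0) n (vars s' 0) (A ++ x :: B) -> t' <= t + 60 -> Q s' t') ->
  ex splice_cmd Q s t.
Proof.
move=> Er Eg /andP[rg gh] Ex xn El En Eh hp Mn lk u QP; apply: ex_framed; rewrite {1}/splice_cmd.
have AB : M ++ drop r path = A ++ B.
  have -> : B = drop (g - r) (drop r path) by rewrite drop_drop subnK.
  by rewrite /A -catA cat_take_drop.
rewrite AB in lk u.
have An : {in A, forall y, y < n}.
  move=> y; rewrite mem_cat => /orP[/Mn//|/mem_take/mem_drop]; exact: pathn.
apply: ex_seq; step.
have first s1 t1 : same_but [:: vlast] [::] s s1 -> vars s1 vlast = last_code A -> t1 <= t + 20 -> ex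
  (If (V vg <! V vh) (Put 0 (V vx) (Get aPath (V vg))) (Put 0 (V vx) (V vn)) ;;
   If (V vlast) (Put 0 (V vlast -: K 1) (V vx)) (0 ::= V vx) ;;
   vlast ::= V vx +! K 1 ;; vr ::= V vg)
  (fun s' t' => frame splice_cmd s s' -> Q s' t') s1 t1.
  move=> f1 El1 t1b; framev f1; have An' : last_code A < 2 ^ w.
    have [A0|] := eqVneq (last_code A) 0; first by lia.
    case/lastP: (A) An => // A' a An _; rewrite last_code_rcons.
    by have := An a; rewrite mem_rcons mem_head => /(_ isT); lia.
  have P1 : arrs s1 aPath = arrs s aPath by case: f1 => _ fa; rewrite fa.
  have N1 : arrs s1 0 = arrs s 0 by case: f1 => _ fa; rewrite fa.
  have H1 : vars s1 0 = vars s 0 by case: f1 => fa _; rewrite fa.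
  have hB : (if g < size path then nth 0 path g else n) = head n B.
    rewrite /B; case: ltnP => gl; first by rewrite (drop_nth 0).
    by rewrite drop_oversize.
  apply: ex_seq; step.
  have second s2 t2 : s2 = set_arr s1 0 x (head n B) -> t2 <= t + 35 -> ex
    (If (V vlast) (Put 0 (V vlast -: K 1) (V vx)) (0 ::= V vx) ;;
     vlast ::= V vx +! K 1 ;; vr ::= V vg)
    (fun s' t' => frame splice_cmd s s' -> Q s' t') s2 t2.
    move=> -> t2b; apply: ex_seq; step.
    case/lastP EA: A lk u An An' => [|A' a] lk u An An' /=.
      step; step; step => frm; apply: QP => //=; [by rewrite addn1| |by lia].
      rewrite EA; case/andP: u => xB _.
      apply: (linked_list_cons lk xB); first by rewrite eqxx.
      by move=> y yB; rewrite /= N1 ifF //; apply/eqP => e; rewrite -e yB in xB.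
    rewrite EA last_code_rcons /= in El1 An' *; step; step; step => frm; apply: QP => //=; [by rewrite addn1| |by lia].
    rewrite EA ?H1; apply: (linked_list_splice lk u).
    - by rewrite subn1 eqxx.
    - rewrite subn1 eqxx ifF //; apply/negP => /eqP e; move: u.
      by rewrite /= mem_cat mem_rcons inE e eqxx.
    - by move=> y ya yx; rewrite subn1 /= (negbTE ya) (negbTE yx) N1.
  case: ltnP hB => gl hB; rewrite /=.
    step; rewrite ?P1 hp //; apply: second; last by lia.
    by rewrite hB.
  by step; apply: second; [rewrite -hB|lia].
case: (ltnP r g) => rg' /=.
  have vv : arrs s aPath (g - 1) < n.
    have gl : g - 1 < size path by lia.
    by rewrite hp //; apply: pathn; apply: mem_nth.
  step; rewrite subn1 hp; last by lia.
  apply: first; last by lia.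
    by split=> // y; rewrite inE /= => /negbTE->.
  rewrite /= ?eqxx addn1; have -> : A = rcons (M ++ take (g.-1 - r) (drop r path)) (nth 0 path g.-1).
    rewrite /A rcons_cat; congr (_ ++ _).
    have -> : g - r = (g.-1 - r).+1 by lia.
    rewrite (take_nth 0) ?size_drop ?nth_drop; last by lia.
    by congr (rcons _ (nth _ _ _)); lia.
  by rewrite last_code_rcons.
step; apply: first; [by []| |by lia].
rewrite El; have -> : A = M by rewrite /A (_ : g - r = 0) ?take0 ?cats0 //; lia.
by [].
Qed.

Definition path_rank x := count (fun y => rk y < rk x) path.

(** The galloping time up to a constant factor. The search for x starts at the larger of two known
    lower bounds: the last predecessor of x on the path, and the place of the item inserted
    before. *)
Fixpoint insert_cost prev (l : seq nat) :=
  if l is x :: l' then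
    (trunc_log 2 (path_rank x - maxn (lp x) prev + 1)).+1 + insert_cost (path_rank x) l'
  else 0.

Lemma insert_spec (Q : state -> nat -> Prop) s t (S : seq nat) :
  vars s va = size S -> vars s vh = size path -> vars s vn = n -> holds (arrs s aQ) S ->
  holds (arrs s aPath) path -> {in S, forall x, arrs s aLp x = lp x} ->
  linked_list (arrs s 0) n (vars s 0) path ->
  {in S, forall x, x < n} -> sorted (lt_by rk) S -> uniq (path ++ S) -> size S <= n ->
  {in S, forall x, lp x <= size path /\ forall q, q < lp x -> rk (nth 0 path q) < rk x} ->
  (forall s' t' l, frame insert_cmd s s' -> linked_list (arrs s' 0) n (vars s' 0) l ->
    perm_eq l (path ++ S) -> sorted (lt_by rk) l -> t' <= t + 400 * insert_cost 0 S + 50 -> Q s' t') ->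
  ex insert_cmd Q s t.
Proof.
move=> Ea Eh En hQ hp hl lk Sn sS u Ssz lpP QP; apply: ex_framed; rewrite {1}/insert_cmd.
step; step.
pose I (i : nat) s' (t' : nat) := exists M r,
  [/\ [/\ vars s' vr = r, r <= size path & vars s' vlast = last_code M],
      linked_list (arrs s' 0) n (vars s' 0) (M ++ drop r path),
      perm_eq (M ++ drop r path) (path ++ take i S) /\ pairwise (lt_by rk) (M ++ drop r path),
      forall x, x \in drop i S -> all (lt_by rk ^~ x) M /\ forall q, q < r -> rk (nth 0 path q) < rk x
    & t' + 400 * insert_cost r (drop i S) <= t + 400 * insert_cost 0 S + 20].
apply: (ex_for (I := I) (a := 0) (b := size S)); [by ev|lia|lia|by []|..].
- exists [::], 0; rewrite !drop0 take0 cats0 /=; split=> //; last by lia.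
  by split=> //; rewrite -(sorted_pairwise lt_by_trans).
- by move=> s1 i t1 fr _ _; base fr; framev fr; ev.
- move=> s1 i t1 fr ib Ei [M [r [[Er rp El] lk1 [pm pw] lo tb]]]; base fr; framev fr.
  set x := nth 0 S i; have xS : x \in S by apply: mem_nth; case/andP: ib.
  have iS : i < size S by case/andP: ib.
  have xn := Sn x xS; have [lpx lpx'] := lpP x xS.
  have dS : drop i S = x :: drop i.+1 S by rewrite (drop_nth 0).
  have Q1 : arrs s1 aQ = arrs s aQ by case: fr => _ fa; rewrite fa.
  have L1 : arrs s1 aLp = arrs s aLp by case: fr => _ fa; rewrite fa.
  have P1 : arrs s1 aPath = arrs s aPath by case: fr => _ fa; rewrite fa.
  step; rewrite ?Q1 hQ // -/x; step; rewrite ?L1 hl //.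
  have [loM lor] := lo x ltac:(by rewrite dS mem_head).
  set g0 := maxn (lp x) r.
  have g0p : g0 <= size path by rewrite /g0 geq_max lpx rp.
  have go s2 t2 : same_but [:: vx; vg] [::] s1 s2 -> vars s2 vx = x -> vars s2 vg = g0 -> t2 <= t1 + 30 ->
      ex (gallop_cmd ;; splice_cmd)
        (fun s' t' => vars s' vs = i -> I i.+1 (set_var s' vs i.+1) (t' + 4)) s2 t2.
    move=> f2 Ex2 Eg2 t2b; framev f2.
    have P2 : arrs s2 aPath = arrs s aPath by case: f2 => _ fa; rewrite fa ?P1.
    have N2 : arrs s2 0 = arrs s1 0 by case: f2 => _ fa; rewrite fa.
    have N2' : vars s2 0 = vars s1 0 by case: f2 => fv _; rewrite fv.
    apply: ex_seq; apply: (@gallop_spec _ _ _ g0 x) => //; first by rewrite P2.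
      by move=> q; rewrite leq_max => /orP[/lpx'|/lor]; apply: ltnW.
    move=> s3 t3 g fr3 Eg3 gb lo3 hi3 t3b.
    have [G1 G2 G3 G4] : [/\ vars s3 vr = r, vars s3 vx = x, vars s3 vlast = last_code M & vars s3 vn = n].
      by case: fr3 => fv _; rewrite !fv.
    have [G5 G6] : vars s3 vh = size path /\ vars s3 0 = vars s1 0 by case: fr3 => fv _; rewrite !fv.
    have P3 : arrs s3 aPath = arrs s aPath by case: fr3 => _ fa; rewrite fa ?P2.
    have N3 : arrs s3 0 = arrs s1 0 by case: fr3 => _ fa; rewrite fa ?N2.
    have u1 : uniq (x :: M ++ drop r path).
      rewrite cons_uniq (perm_uniq pm) (perm_mem pm).
      have sub : subseq (path ++ take i.+1 S) (path ++ S).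
        by rewrite cat_subseq // -{2}(cat_take_drop i.+1 S) prefix_subseq.
      have := subseq_uniq sub u; rewrite (take_nth 0) // -rcons_cat rcons_uniq.
      exact.
    have nth_ne q : q < size path -> nth 0 path q != x.
      move=> qs; apply: contraTneq u => e; rewrite cat_uniq negb_and; apply/orP; right.
      rewrite negb_and; apply/orP; left; rewrite negbK; apply/hasP; exists x => //.
      by rewrite -e mem_nth.
    have [g0g gsz] := andP gb.
    have lo3' q : q < g -> rk (nth 0 path q) < rk x.
      move=> qg; have qs := leq_trans qg gsz.
      rewrite ltn_neqAle lo3 // andbT; apply: contraNneq (nth_ne q qs) => e; apply/eqP.
      by apply: rkI => //; apply: pathn; apply: mem_nth.
    have rg : r <= g := leq_trans (leq_maxr _ _) g0g.
    have xr : path_rank x = g.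
      apply: (count_split (x0 := 0)); [exact: gsz|exact: lo3'|move=> q gq qs].
      rewrite -leqNgt; apply: leq_trans (ltnW (hi3 (leq_ltn_trans gq qs))) _.
      have [->//|ne] := eqVneq g q; apply: ltnW; apply: path_incr => //.
      by rewrite ltn_neqAle ne.
    apply: (@splice_spec _ _ _ M r g x) => //; rewrite ?P3 ?N3 ?G6 //; first by rewrite rg.
      move=> y yM; have : y \in path ++ take i S by rewrite -(perm_mem pm) mem_cat yM.
      by rewrite mem_cat => /orP[/pathn//|/mem_take/Sn].
    move=> s4 t4 fr4 Er4 El4 lk4 t4b _.
    set A := M ++ take (g - r) (drop r path) in lk4.
    have Ag y : y \in take (g - r) (drop r path) -> exists2 q, q < g & y = nth 0 path q.
      move=> /(nthP 0)[q]; rewrite size_take_min size_drop => ql <-.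
      have qgr : q < g - r by move: ql; clear; lia.
      exists (r + q); first by move: qgr; clear; lia.
      by rewrite nth_take // nth_drop.
    have dg : drop r path = take (g - r) (drop r path) ++ drop g path.
      by rewrite -{1}(cat_take_drop (g - r) (drop r path)) drop_drop subnK.
    have AB : A ++ drop g path = M ++ drop r path by rewrite dg /A catA.
    exists (rcons A x), g; rewrite /= cat_rcons; split=> //.
    + by rewrite last_code_rcons; split.
    + split.
        rewrite -cat1s perm_catCA AB (take_nth 0) // -rcons_cat perm_sym perm_rcons cat1s perm_cons.
        by rewrite perm_sym.
      move: pw; rewrite -AB !pairwise_cat /= => /and3P[h1 h2 h3].
      have xB : all (lt_by rk x) (drop g path).
        apply/allP => y /(nthP 0)[q]; rewrite size_drop => ql' <-; rewrite nth_drop /lt_by.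
        have ql : q < size path - g := ql'.
        apply: leq_trans (hi3 _) _; first by move: ql; clear; lia.
        have [->|q0] := posnP q; first by rewrite addn0.
        by apply: ltnW; apply: path_incr; move: ql q0; clear; lia.
      apply/and4P; split=> //; apply/allrelP => y z yA; rewrite inE => /predU1P[->|zB]; last first.
        exact: (elimT allrelP h1 y z yA zB).
      move: yA; rewrite mem_cat => /orP[yM|/Ag[q qg ->]]; last exact: lo3'.
      exact: (elimT allP loM y yM).
    + move=> y yS.
      have xy : rk x < rk y.
        move: sS; rewrite -{1}(cat_take_drop i S) dS (sorted_pairwise lt_by_trans) pairwise_cat /=.
        by move=> /and3P[_ _ /andP[/allP h _]]; apply: h.
      split; last by move=> q qg; apply: ltn_trans (lo3' q qg) xy.
      rewrite all_rcons /= {1}/lt_by xy /=; apply/allP => z; rewrite mem_cat /lt_by => /orP[|/Ag[q qg ->]].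
        by move/allP: loM => h /h; rewrite /lt_by => zx; apply: ltn_trans zx xy.
      exact: ltn_trans (lo3' q qg) xy.
    + rewrite dS /= xr -/g0 in tb; move: tb t3b t4b t2b; clear; lia.
  step; case: ltnP => cmp /=.
    step; apply: go; rewrite ?Er //=; last by lia.
      by split=> // y; rewrite !inE => /norP[/negbTE h1 /negbTE h2] /=; rewrite h1 h2.
    by rewrite /g0; lia.
  step; apply: go => //=; last by lia.
    by split=> // y; rewrite !inE => /norP[/negbTE h1 /negbTE h2] /=; rewrite h1 h2.
  by rewrite /g0; lia.
- move=> s1 t1 fr _ [M [r [[Er rp El] lk1 [pm pw] lo tb]]] frm.
  apply: (QP _ _ (M ++ drop r path)) => //.
  + by rewrite (perm_trans pm) // take_size.
  + by rewrite (sorted_pairwise lt_by_trans).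
  + by move: tb; rewrite drop_size /=; clear; lia.
Qed.

End Insert.

(** * Topological sorting *)

Notation vm := 75. Notation vu := 80. Notation vv := 81. Notation ve := 82.
Notation vqh := 83. Notation vqt := 84. Notation vbest := 85.
Notation aHd := 25. Notation aNx := 26. Notation aDeg := 27. Notation aQu := 28.
Notation aLev := 29. Notation aPar := 30. Notation aOn := 31.

Definition build_cmd :=
  For ve (K 0) (V vm) (
    vu ::= Get 0 (V ve) ;; vv ::= Get 1 (V ve) ;;
    Put aNx (V ve) (Get aHd (V vu)) ;; Put aHd (V vu) (V ve +! K 1) ;;
    Put aDeg (V vv) (Get aDeg (V vv) +! K 1)).

Definition push_cmd := If (Get aDeg (V vv)) Skip (Put aQu (V vqt) (V vv) ;; vqt ::= V vqt +! K 1).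

Definition roots_cmd := vqt ::= K 0 ;; For vv (K 0) (V vn) push_cmd.

Definition edge_cmd :=
  vv ::= Get 1 (V ve -: K 1) ;;
  If (Get aLev (V vv) <! Get aLev (V vu) +! K 1)
     (Put aLev (V vv) (Get aLev (V vu) +! K 1) ;; Put aPar (V vv) (V vu +! K 1)) Skip ;;
  Put aDeg (V vv) (Get aDeg (V vv) -: K 1) ;;
  push_cmd ;;
  ve ::= Get aNx (V ve -: K 1).

Definition kahn_cmd :=
  vqh ::= K 0 ;;
  While (V vqh <! V vqt) (
    vu ::= Get aQu (V vqh) ;; ve ::= Get aHd (V vu) ;;
    While (V ve) edge_cmd ;;
    vqh ::= V vqh +! K 1).

Section Kahn.
Variables (w : nat) (orc : option (rel nat)) (n m : nat) (src dst : nat -> nat).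
Hypothesis srcn : forall e, e < m -> src e < n.
Hypothesis dstn : forall e, e < m -> dst e < n.
Hypothesis WW : 10 * n + 10 * m + 100 < 2 ^ w.
Notation ex := (ex w orc).

(* In the linked lists of edges, e is coded by e.+1 and the end by 0. *)
Definition adj u i := [seq e.+1 | e <- rev [seq e <- iota 0 i | src e == u]].

Lemma adjS u i : adj u i.+1 = if src i == u then i.+1 :: adj u i else adj u i.
Proof.
rewrite /adj -[in LHS]addn1 iotaD filter_cat /= add0n; case: eqP => _; last by rewrite cats0.
by rewrite rev_cat map_cat /=.
Qed.

Lemma mem_adj u i e : (e.+1 \in adj u i) = (e < i) && (src e == u).
Proof. by rewrite mem_map ?mem_rev ?mem_filter ?mem_iota 1?andbC //; apply: succn_inj. Qed.

Definition adjacency (s : state) i :=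
  forall u, linked_list (fun c => arrs s aNx c.-1) 0 (arrs s aHd u) (adj u i).

Lemma build_spec (Q : state -> nat -> Prop) s t :
  vars s vm = m -> (forall e, e < m -> arrs s 0 e = src e /\ arrs s 1 e = dst e) ->
  (forall u, arrs s aHd u = 0) -> (forall u, arrs s aDeg u = 0) ->
  (forall s' t', frame build_cmd s s' -> adjacency s' m ->
    (forall v, arrs s' aDeg v = count (fun e => dst e == v) (iota 0 m)) ->
    t' <= t + 40 * m + 10 -> Q s' t') ->
  ex build_cmd Q s t.
Proof.
move=> Em Es Z1 Z2 QP; apply: ex_framed; rewrite {1}/build_cmd.
pose I (i : nat) s' (t' : nat) := [/\ adjacency s' i,
  forall v, arrs s' aDeg v = count (fun e => dst e == v) (iota 0 i) & t' <= t + 40 * i + 2].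
apply: (ex_for (I := I) (a := 0) (b := m)); [by ev|lia|lia|by []|..].
- by split; [move=> u; rewrite /= Z1|move=> v; rewrite /= Z2|rewrite /=; lia].
- by move=> s1 i t1 fr _ _; base fr; framev fr; ev.
- move=> s1 i t1 fr ib Ei [h1 h2 tb]; base fr; framev fr.
  have [E0 E1] : arrs s1 0 = arrs s 0 /\ arrs s1 1 = arrs s 1 by case: fr => _ fa; rewrite !fa.
  have im : i < m by case/andP: ib.
  have [e1 e2] := Es i im.
  have cb : arrs s1 aDeg (dst i) <= i by rewrite h2 -[leqRHS](size_iota 0) count_size.
  step; rewrite ?E0 e1; step; rewrite ?E1 e2; step; step; step.
  move=> _; split; last by rewrite /=; lia.
    move=> u; rewrite adjS /= [u == _]eq_sym; case: eqP => [<-|ne].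
      rewrite /= addn1; split=> //; rewrite eqxx.
      apply: linked_list_eq (h1 (src i)) => c cI; rewrite /= ifF //.
      by case: c cI => [|c]; rewrite ?mem_adj /=; [case/mapP|move=> /andP[ci _]; apply/eqP; lia].
    apply: linked_list_eq (h1 u) => c cI; rewrite /= ifF //.
    by case: c cI => [|c]; rewrite ?mem_adj /=; [case/mapP|move=> /andP[ci _]; apply/eqP; lia].
  move=> v; rewrite -[i.+1]addn1 iotaD count_cat add0n /= addn0 [v == _]eq_sym.
  by case: eqP => [<-|] /=; rewrite ?addn0 ?h2.
- move=> s1 t1 fr _ [h1 h2 tb] frm; apply: QP => //=; lia.
Qed.

Definition queued (s : state) (q : seq nat) :=
  [/\ vars s vqt = size q, holds (arrs s aQu) q, uniq q & {in q, forall v, v < n}].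

Lemma queued_size s q : queued s q -> size q <= n.
Proof.
move=> [_ _ u qn]; rewrite -[leqRHS](size_iota 0); apply: uniq_leq_size => // v /qn.
by rewrite mem_iota.
Qed.

Lemma push_spec (Q : state -> nat -> Prop) s t q v :
  vars s vv = v -> v < n -> queued s q -> v \notin q ->
  (forall s' t' q', q' = (if arrs s aDeg v == 0 then rcons q v else q) ->
    frame push_cmd s s' -> queued s' q' -> t' <= t + 15 -> Q s' t') ->
  ex push_cmd Q s t.
Proof.
move=> Ev vn Hq vq QP; apply: ex_framed; rewrite {1}/push_cmd.
have [Eq hq uq qn] := Hq; have qsz := queued_size Hq.
step; case: eqP (QP) => _ QP' /=; last first.
  by step => frm; apply: QP' => //; lia.
step; step => frm; apply: QP' => //; last by lia.
split=> /=.
- by rewrite size_rcons addn1.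
- move=> p; rewrite size_rcons ltnS leq_eqVlt nth_rcons => /predU1P[->|pq].
    by rewrite eqxx ltnn.
  by rewrite pq ifF ?hq //; apply/eqP; lia.
- by rewrite rcons_uniq vq.
- by move=> x; rewrite mem_rcons inE => /predU1P[->|/qn].
Qed.

Lemma roots_spec (Q : state -> nat -> Prop) s t :
  vars s vn = n ->
  (forall s' t' q, frame roots_cmd s s' -> queued s' q ->
     (forall v, v < n -> (v \in q) = (arrs s aDeg v == 0)) ->
     t' <= t + 30 * n + 20 -> Q s' t') ->
  ex roots_cmd Q s t.
Proof.
move=> En QP; apply: ex_framed; rewrite {1}/roots_cmd; step.
pose I (i : nat) s' (t' : nat) := exists q, [/\ queued s' q,
  forall v, (v \in q) = (v < i) && (arrs s aDeg v == 0) & t' <= t + 30 * i + 4].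
apply: (ex_for (I := I) (a := 0) (b := n)); [by ev|lia|lia|by []|..].
- by exists [::]; split=> //=; lia.
- by move=> s1 i t1 fr _ _; base fr; framev fr; ev.
- move=> s1 i t1 fr ib Ei [q [Hq h tb]]; base fr; framev fr.
  have ED : arrs s1 aDeg = arrs s aDeg by case: fr => _ fa; rewrite fa.
  have im : i < n by case/andP: ib.
  apply: (push_spec Ei im Hq); first by rewrite h ltnn.
  rewrite ED => s2 t2 q' Eq' fr2 Hq' t2b _; exists q'; split.
  + by case: Hq' => ? ? ? ?; split.
  + move=> v; rewrite Eq' ltnS leq_eqVlt; case: (eqVneq v i) => [->|ne] /=.
      by case: eqP => [_|_]; rewrite ?mem_rcons ?mem_head // h ltnn.
    by case: eqP => _; rewrite ?mem_rcons ?inE ?(negbTE ne) h.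
  + by move: t2b tb; rewrite /=; clear; lia.
- move=> s1 t1 fr _ [q [Hq h tb]] frm; apply: (QP _ _ q) => //=; last by lia.
  by move=> v vn; rewrite h vn.
Qed.

Lemma count_add (T : Type) (P P1 P2 : pred T) l :
  (forall x, P x = P1 x + P2 x :> nat) -> count P l = count P1 l + count P2 l.
Proof. by move=> h; elim: l => //= x l ->; rewrite h addnACA. Qed.

(* [q] is the queue and [D] the edges processed so far; [aPar] is 1 + a vertex of
   the previous level, and 0 at level 0. *)
Definition kahn_inv (s : state) (q D : seq nat) :=
  [/\ queued s q,
      [/\ uniq D, {in D, forall e, e < m /\ src e \in q}
        & forall v, arrs s aDeg v = count (fun e => (e \notin D) && (dst e == v)) (iota 0 m)],
      forall v, v < n -> (v \in q) = (arrs s aDeg v == 0),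
      forall e, e < m -> dst e \in q -> index (src e) q < index (dst e) q
    & [/\ {in D, forall e, arrs s aLev (src e) < arrs s aLev (dst e)},
          forall v, arrs s aLev v <= size D
        & forall v, (arrs s aPar v = 0 /\ arrs s aLev v = 0) \/
            exists2 e, e \in D & [/\ dst e = v, arrs s aPar v = (src e).+1
                                   & arrs s aLev v = (arrs s aLev (src e)).+1]]].

Lemma kahn_inv_size s q D : kahn_inv s q D -> size D <= m.
Proof.
move=> [_ [u h _] _ _ _]; rewrite -[leqRHS](size_iota 0); apply: uniq_leq_size => // e /h[em _].
by rewrite mem_iota.
Qed.

Lemma edge_spec (Q : state -> nat -> Prop) s t q D e :
  vars s vu = src e -> vars s ve = e.+1 -> e < m -> arrs s 1 e = dst e ->
  src e \in q -> e \notin D -> kahn_inv s q D ->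
  (forall s' t' q1, frame edge_cmd s s' -> kahn_inv s' (q ++ q1) (rcons D e) ->
    vars s' ve = arrs s aNx e -> t' <= t + 70 -> Q s' t') ->
  ex edge_cmd Q s t.
Proof.
move=> Eu Ee em E1 uq eD inv QP; have Dm := kahn_inv_size inv.
have [Hq [uD Ds deg] qdeg qe [lv lvs par]] := inv; have qsz := queued_size Hq.
apply: ex_framed; rewrite {1}/edge_cmd.
set v := dst e in E1; set u := src e in Eu uq.
have vn : v < n by apply: dstn.
have un : u < n by apply: srcn.
pose D' := rcons D e.
(* The degree array counts unprocessed edges, so processing e affects only the entry of its
   target. *)
have degS x : arrs s aDeg x = count (fun e' => (e' \notin D') && (dst e' == x)) (iota 0 m) + (v == x).
  rewrite deg (count_add (P1 := fun e' => (e' \notin D') && (dst e' == x))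
                         (P2 := fun e' => (e' == e) && (v == x))).
    congr (_ + _); case: eqP => _; last by rewrite (eq_count (a2 := pred0)) ?count_pred0 // => y; rewrite andbF.
    rewrite (eq_count (a2 := pred1 e)); last by move=> y /=; rewrite andbT.
    by rewrite count_uniq_mem ?iota_uniq // mem_iota em.
  move=> e'; rewrite /D' mem_rcons inE negb_or.
  by case: (eqVneq e' e) => [->|_] /=; rewrite ?eD ?addn0.
(* As long as e is unprocessed it keeps the degree of v positive, and queued vertices have degree
   0. *)
have vq : v \notin q by rewrite qdeg // degS eqxx addn1.
have uv : u != v by apply: contraNneq vq => <-.
have D'm : size D' <= m.
  rewrite /D' -[leqRHS](size_iota 0); apply: uniq_leq_size; first by rewrite rcons_uniq eD.
  by move=> x; rewrite mem_rcons inE mem_iota => /predU1P[->|/Ds[]].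
rewrite size_rcons in D'm.
have lub := lvs u.
have cm : count (fun e' => (e' \notin D') && (dst e' == v)) (iota 0 m) <= m.
  by rewrite -[leqRHS](size_iota 0) count_size.
step; rewrite subn1 E1 -/v; apply: ex_seq; step.
have next s1 t1 : frame (If (Get aLev (V vv) <! Get aLev (V vu) +! K 1)
     (Put aLev (V vv) (Get aLev (V vu) +! K 1) ;; Put aPar (V vv) (V vu +! K 1)) Skip) (set_var s vv v) s1 ->
    [/\ {in D', forall e, arrs s1 aLev (src e) < arrs s1 aLev (dst e)},
          forall v, arrs s1 aLev v <= size D'
        & forall v, (arrs s1 aPar v = 0 /\ arrs s1 aLev v = 0) \/
            exists2 e, e \in D' & [/\ dst e = v, arrs s1 aPar v = (src e).+1
                                   & arrs s1 aLev v = (arrs s1 aLev (src e)).+1]] ->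
    t1 <= t + 30 ->
    ex (Put aDeg (V vv) (Get aDeg (V vv) -: K 1) ;; push_cmd ;; ve ::= Get aNx (V ve -: K 1))
      (fun s' t' => frame edge_cmd s s' -> Q s' t') s1 t1.
  move=> f1 L1 t1b.
  have Ev1 : vars s1 vv = v by case: f1 => fv _; rewrite fv.
  have ED1 : arrs s1 aDeg = arrs s aDeg by case: f1 => _ fa; rewrite fa.
  have EN1 : arrs s1 aNx = arrs s aNx by case: f1 => _ fa; rewrite fa.
  have EQ1 : arrs s1 aQu = arrs s aQu by case: f1 => _ fa; rewrite fa.
  have qv1 : vars s1 vqt = vars s vqt by case: f1 => fv _; rewrite fv.
  have dv : arrs s aDeg v <= m.+1 by rewrite degS eqxx addn1 ltnS.
  base f1; framev f1; step.
  rewrite ?ED1 degS eqxx addn1 subn1 /=.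
  set s2 := set_arr s1 _ _ _.
  have Hq2 : queued s2 q by case: Hq => h1 h2 h3 h4; split=> //=; rewrite ?qv1 ?EQ1.
  apply: ex_seq; apply: (@push_spec _ s2 _ q v) => // s3 t3 q' Eq' fr3 Hq' t3b.
  rewrite /= !eqxx addn1 /= in Eq' t3b.
  have Ee3 : vars s3 ve = e.+1 by case: fr3 => fv _; rewrite fv.
  step; rewrite subn1 /= => frm.
  have EN3 : arrs s3 aNx = arrs s aNx by case: fr3 => _ fa; rewrite fa //= EN1.
  have ED3 x : arrs s3 aDeg x = count (fun e' => (e' \notin D') && (dst e' == x)) (iota 0 m).
    case: fr3 => _ fa; rewrite fa // /s2 /=; case: (eqVneq x v) => [->|ne]; first by rewrite addn1.
    by rewrite ?ED1 degS [v == _]eq_sym (negbTE ne) addn0.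
  have EL3 : arrs s3 aLev = arrs s1 aLev by case: fr3 => _ fa; rewrite fa.
  have EP3 : arrs s3 aPar = arrs s1 aPar by case: fr3 => _ fa; rewrite fa.
  pose q1 := if count (fun e' => (e' \notin D') && (dst e' == v)) (iota 0 m) == 0 then [:: v] else [::].
  have Eq1 : q' = q ++ q1 by rewrite Eq' /q1; case: eqP; rewrite ?cats1 ?cats0.
  apply: (QP _ _ q1) => //=; last by move: t1b t3b; clear; lia.
    rewrite -/D' -Eq1; split=> //=.
    - split=> //; first by rewrite rcons_uniq eD.
      move=> e'; rewrite mem_rcons inE Eq1 mem_cat => /predU1P[->|/Ds[-> ->] //].
      by rewrite em uq.
    - move=> x xn; rewrite ED3 Eq1 mem_cat /q1; case: (eqVneq x v) => [->|ne].
        by rewrite (negbTE vq); case: eqP; rewrite ?mem_head.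
      rewrite qdeg // degS [v == _]eq_sym (negbTE ne) addn0; case: ifP => _; last by rewrite orbF.
      by rewrite mem_seq1 (negbTE ne) orbF.
    - move=> e' e'm; rewrite Eq1 mem_cat => /orP[dq|].
        have h := qe e' e'm dq; have sq : src e' \in q.
          by rewrite -index_mem; apply: ltn_trans h _; rewrite index_mem.
        by rewrite !index_cat dq sq.
      (* v is appended once all its incoming edges are processed, and the source of a processed edge
         is already in the queue; this makes the queue order topological. *)
      rewrite /q1; case: eqP => //= c0; rewrite inE => /eqP ev.
      suff sq : src e' \in q by rewrite !index_cat sq ev (negbTE vq) ltn_addr // index_mem.
      have : e' \in D'.
        apply: contra_eqT c0 => ne; rewrite -lt0n -has_count; apply/hasP.
        by exists e'; rewrite ?mem_iota // ne ev eqxx.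
      by rewrite mem_rcons inE => /predU1P[->//|/Ds[]].
    by rewrite EL3 EP3.
  by rewrite EN3.
have inD' : e \in D' by rewrite mem_rcons mem_head.
have sv e' : e' \in D' -> src e' != v.
  rewrite mem_rcons inE => /predU1P[->//|/Ds[_ sq]].
  by apply: contraNneq vq => <-.
case: ltnP => lt_; rewrite /=.
  have uvF := negbTE uv.
  step; step; apply: next.
  - split=> // x; rewrite !inE /= => /norP[/negbTE h1 h2] /=; rewrite h1 //.
    by move: h2; rewrite ?orbF => /negbTE->.
  - rewrite /= !addn1; split.
    + move=> e' e'D; rewrite (negbTE (sv e' e'D)).
      move: e'D; rewrite mem_rcons inE => /predU1P[->|e'D]; first by rewrite -/v eqxx.
      by case: eqP => [ev|_]; [rewrite addn1 in lt_; apply: ltn_trans (lv e' e'D) _; rewrite ev|apply: lv].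
    + move=> x; rewrite size_rcons; case: eqP => _; first by rewrite ltnS.
      exact: leqW.
    + move=> x; case: eqP => [->|ne].
        by right; exists e; rewrite // uvF.
      have [h|[e' e'D [h1 h2 h3]]] := par x; first by left.
      have e'D' : e' \in D' by rewrite mem_rcons inE e'D orbT.
      by right; exists e' => //; rewrite (negbTE (sv e' e'D')).
  - by rewrite /=; clear; lia.
step; apply: next; first by [].
- split=> /=.
  + move=> e'; rewrite mem_rcons inE => /predU1P[->|]; last exact: lv.
    by rewrite addn1 in lt_.
  + by move=> x; rewrite size_rcons leqW.
  + move=> x; have [h|[e' e'D h]] := par x; first by left.
    by right; exists e' => //; rewrite mem_rcons inE e'D orbT.
- by rewrite /=; clear; lia.
Qed.

Lemma adj_sorted u i : sorted gtn (adj u i).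
Proof.
rewrite sorted_map rev_sorted; apply: (@sub_sorted _ ltn) => // .
by apply: sorted_filter (iota_ltn_sorted _ _); apply: ltn_trans.
Qed.

(** The form in which acyclicity is used: the vertices outside q, if there are any, include one
    without predecessors among them. *)
Definition sourced := forall q : seq nat, has (fun v => v \notin q) (iota 0 n) ->
  exists v, [/\ v < n, v \notin q & forall e, e < m -> dst e = v -> src e \in q].

Lemma kahn_step (Q : state -> nat -> Prop) s t q D i :
  kahn_inv s q D -> vars s vqh = i -> i < size q -> adjacency s m ->
  (forall e, e < m -> arrs s 1 e = dst e) ->
  (forall e, e < m -> (e \in D) = (src e \in take i q)) ->
  (forall s' t' q' D', kahn_inv s' q' D' -> vars s' vqh = i.+1 -> i.+1 <= size q' ->
     (forall e, e < m -> (e \in D') = (src e \in take i.+1 q')) ->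
     t' <= t + 40 + 80 * (size D' - size D) -> size D <= size D' -> Q s' t') ->
  ex (vu ::= Get aQu (V vqh) ;; ve ::= Get aHd (V vu) ;; While (V ve) edge_cmd ;;
      vqh ::= V vqh +! K 1) Q s t.
Proof.
move=> inv Ei iq ad E1 Dt QP; have Dm := kahn_inv_size inv.
have [[Eq hq uqq qn] [uD Ds deg] qdeg qe lvl] := inv.
have qsz : size q <= n by apply: (queued_size (s := s)).
set u := nth 0 q i; have uq : u \in q by apply: mem_nth.
have tk : take i.+1 q = rcons (take i q) u by rewrite (take_nth 0).
have utk : u \notin take i q.
  by have := take_uniq i.+1 uqq; rewrite tk rcons_uniq => /andP[].
step; rewrite hq // -/u; step; apply: ex_seq.
pose I s' (t' : nat) := exists q' D' l, [/\ kahn_inv s' q' D' /\ size D <= size D',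
   i < size q' /\ take i.+1 q' = take i.+1 q,
   [/\ linked_list (fun c => arrs s aNx c.-1) 0 (vars s' ve) l, sorted gtn l, {subset l <= adj u m}
     & {in l, forall c, c.-1 \notin D'}],
   forall e, e < m -> (e \in D') || (e.+1 \in l) = (src e \in take i.+1 q)
   & t' <= t + 20 + 80 * (size D' - size D)].
(* Each new edge was put in front of its adjacency list, so the codes decrease along the list and
   the current code is itself a measure. *)
apply: (ex_while (I := I) (mu := fun s => vars s ve)).
- exists q, D, (adj u m); split=> //=; last by clear; lia.
    split=> //; first exact: adj_sorted.
    case=> [/mapP[]//|e]; rewrite mem_adj => /andP[em /eqP su] /=.
    by rewrite Dt // su.
  by move=> e em; rewrite tk mem_rcons inE mem_adj em Dt // orbC.
- move=> s1 t1 fr [q1 [D1 [l [[inv1 DD] [iq1 tk1] [lk sl lsub lD] De tb]]]].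
  have A1 : arrs s1 aNx = arrs s aNx by case: fr => _ fa; rewrite fa.
  have B1 : arrs s1 1 = arrs s 1 by case: fr => _ fa; rewrite fa.
  have U1 : vars s1 vu = u by case: fr => fv _; rewrite fv.
  case: l lk sl lsub lD De => [|c l]; first by move=> /= ->.
  move=> [Ec lk] sl lsub lD De _.
  have := lsub c (mem_head _ _); case: c => [|e] in Ec lk sl lsub lD De *; first by case/mapP.
  rewrite mem_adj => /andP[em /eqP su].
  have uq1 : u \in q1.
    by apply: (@mem_take i.+1); rewrite tk1 tk mem_rcons mem_head.
  have eD1 : e \notin D1 by exact: (lD e.+1 (mem_head _ _)).
  apply: (edge_spec (q := q1) (D := D1) (e := e)) => //; rewrite ?su ?B1 //; first exact: E1.
  move=> s2 t2 qa fr2 inv2 Ec2 t2b.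
  have hl : vars s2 ve = head 0 l by rewrite Ec2 A1; exact: (linked_list_head lk).
  split; last by rewrite hl Ec; move: sl; case: (l) => //= c l' /andP[].
  exists (q1 ++ qa), (rcons D1 e), l; rewrite size_rcons; split.
  + by split=> //; apply: leqW.
  + by rewrite size_cat takel_cat // ltn_addr.
  + split; [by rewrite Ec2 A1|exact: path_sorted sl|by move=> c cl; apply: lsub; rewrite inE cl orbT|].
    move=> c cl; rewrite mem_rcons inE negb_or lD ?inE ?cl ?orbT // andbT.
    move: sl; rewrite /= (path_sortedE (rev_trans ltn_trans)) => /andP[/allP/(_ c cl) /= ce _].
    have : c \in adj u m by apply: lsub; rewrite inE cl orbT.
    by case: c cl ce => [|c] _ ce; [case/mapP|move=> _; apply/eqP; move: ce; clear; lia].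
  + move=> e' e'm; rewrite -De // mem_rcons !inE eqSS.
    by case: (e' == e); rewrite ?orbT.
  + by move: t2b tb DD; rewrite /=; clear; lia.
- move=> s1 t1 fr [q1 [D1 [l [[inv1 DD] [iq1 tk1] [lk sl lsub lD] De tb]]]] /= Ev.
  have l0 : l = [::].
    case: l lk lsub {sl lD De} => // c l [ec _] /(_ c (mem_head _ _)).
    by rewrite -ec Ev; case/mapP.
  have I1 : vars s1 vqh = i by case: fr => fv _; rewrite fv.
  step; apply: (QP _ _ q1 D1) => //=.
  + by rewrite addn1.
  + by move=> e em; rewrite tk1 -De // l0 in_nil orbF.
  + by move: tb; clear; lia.
Qed.

Lemma kahn_spec (Q : state -> nat -> Prop) s t q0 :
  sourced -> queued s q0 -> (forall v, v < n -> (v \in q0) = (arrs s aDeg v == 0)) ->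
  adjacency s m -> (forall e, e < m -> arrs s 1 e = dst e) ->
  (forall v, arrs s aDeg v = count (fun e => dst e == v) (iota 0 m)) ->
  (forall v, arrs s aLev v = 0) -> (forall v, arrs s aPar v = 0) ->
  (forall s' t' q D, frame kahn_cmd s s' -> kahn_inv s' q D -> perm_eq q (iota 0 n) ->
     (forall e, e < m -> e \in D) -> t' <= t + 80 * (n + m) + 30 -> Q s' t') ->
  ex kahn_cmd Q s t.
Proof.
move=> src_ Hq0 q0deg ad E1 deg L0 P0 QP; apply: ex_framed; rewrite {1}/kahn_cmd; step.
pose I s' (t' : nat) := exists q D i, [/\ kahn_inv s' q D, vars s' vqh = i /\ i <= size q,
  forall e, e < m -> (e \in D) = (src e \in take i q) & t' <= t + 50 * i + 80 * size D + 5].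
apply: (ex_while (I := I) (mu := fun s => n - vars s vqh)).
- exists q0, [::], 0; rewrite take0 /=; split=> //; last by clear; lia.
  split=> //=.
  + move=> e em; rewrite q0deg ?dstn // deg => /eqP c0.
    have : has (fun e' => dst e' == dst e) (iota 0 m) by apply/hasP; exists e; rewrite ?mem_iota.
    by rewrite has_count c0.
  + by split=> // v; rewrite ?L0 //; left.
- move=> s1 t1 fr [q [D [i [inv [Ei iq] De tb]]]].
  have [Hq _ _ _ _] := inv; have qsz := queued_size Hq; have [Eq _ _ _] := Hq.
  rewrite (ev_lt (u := i) (v := size q)) //; last by move: WW; clear; lia.
  rewrite eqb0 negbK => iq'.
  have ad1 : adjacency s1 m by move=> u; case: (fr) => _ fa; rewrite !fa //; apply: ad.
  apply: (kahn_step inv Ei iq' ad1) => //.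
    by move=> e em; case: fr => _ fa; rewrite fa // E1.
  move=> s2 t2 q2 D2 inv2 Ei2 iq2 De2 t2b DD.
  split; last by rewrite Ei Ei2; move: iq' qsz; clear; lia.
  exists q2, D2, i.+1; split=> //.
  by move: tb t2b DD; rewrite /=; clear; lia.
- move=> s1 t1 fr [q [D [i [inv [Ei iq] De tb]]]].
  have Dm := kahn_inv_size inv.
  have [Hq [_ Ds degD] qdeg _ _] := inv; have qsz := queued_size Hq; have [Eq _ uq qn] := Hq.
  rewrite (ev_lt (u := i) (v := size q)) //; last by move: WW; clear; lia.
  move/eqP; rewrite eqb0 -leqNgt => qi frm.
  have iE : i = size q by apply/eqP; rewrite eqn_leq iq.
  rewrite iE take_size in De.
  (* If a vertex were missing, [sourced] would give a missing one with all predecessors queued. The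
     queue is exhausted, so all its incoming edges are processed and its degree is 0, which means
     that it is queued. *)
  have all_ v : v < n -> v \in q.
    move=> vn; apply/negPn/negP => vq.
    have /src_[x [xn xq xs]] : has (fun v => v \notin q) (iota 0 n).
      by apply/hasP; exists v; rewrite ?mem_iota.
    move/negP: xq; apply; rewrite qdeg // degD; apply/eqP/eqP; rewrite eqn0Ngt -has_count.
    apply/hasPn => e; rewrite mem_iota => em; apply/negP => /andP[eD /eqP ex_].
    by rewrite De // xs in eD.
  have pq : perm_eq q (iota 0 n).
    apply: uniq_perm; rewrite ?iota_uniq // => v; rewrite mem_iota /=.
    by apply/idP/idP => [/qn|/all_].
  apply: (QP _ _ q D) => //.
    by move=> e em; rewrite De // all_ // srcn.
  by move: tb Dm qsz; rewrite iE /=; clear; lia.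
Qed.

End Kahn.

(** * The longest path *)

Definition best_cmd :=
  vbest ::= K 0 ;;
  For vv (K 0) (V vn) (If (Get aLev (V vbest) <! Get aLev (V vv)) (vbest ::= V vv) Skip).

Definition chain_cmd :=
  vh ::= K 0 ;; If (V vn) (vh ::= Get aLev (V vbest) +! K 1) Skip ;;
  vu ::= V vbest ;; vp ::= V vh ;;
  While (V vp) (
    vp ::= V vp -: K 1 ;; Put aPath (V vp) (V vu) ;; Put aOn (V vu) (V vp +! K 1) ;;
    vu ::= Get aPar (V vu) -: K 1).

Definition preds_cmd :=
  For ve (K 0) (V vm) (
    vu ::= Get 0 (V ve) ;; vv ::= Get 1 (V ve) ;;
    If (Get aLp (V vv) <! Get aOn (V vu)) (Put aLp (V vv) (Get aOn (V vu))) Skip).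

Definition rest_cmd :=
  vX ::= K 0 ;;
  For vp (K 0) (V vn) (
    vx ::= Get aQu (V vp) ;;
    If (Get aOn (V vx)) Skip (Put aA (V vX) (V vx) ;; vX ::= V vX +! K 1)).

(* The null pointer is stored behind the path, as the successor of its end. *)
Definition link_cmd :=
  Put aPath (V vh) (V vn) ;;
  For vp (K 0) (V vh) (Put 0 (Get aPath (V vp)) (Get aPath (V vp +! K 1))) ;;
  0 ::= Get aPath (K 0).

(** The buckets start at cell 4 n of [aA], above the sampled levels, which need at most 2 n
    cells. *)
Definition layout_cmd :=
  vn ::= V 0 ;; vm ::= V 1 ;; build_cmd ;; roots_cmd ;; kahn_cmd ;;
  best_cmd ;; chain_cmd ;; preds_cmd ;; rest_cmd ;; link_cmd ;; vR ::= K 4 *! V vn.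

Section Layout.
Variables (w : nat) (orc : option (rel nat)) (n m : nat) (src dst : nat -> nat).
Hypothesis srcn : forall e, e < m -> src e < n.
Hypothesis dstn : forall e, e < m -> dst e < n.
Hypothesis WW : 10 * n + 10 * m + 100 < 2 ^ w.
Notation ex := (ex w orc).

Lemma best_spec (Q : state -> nat -> Prop) s t :
  vars s vn = n ->
  (forall s' t' b, frame best_cmd s s' -> vars s' vbest = b -> (0 < n -> b < n) ->
    (forall x, x < n -> arrs s aLev x <= arrs s aLev b) -> t' <= t + 20 * n + 10 -> Q s' t') ->
  ex best_cmd Q s t.
Proof.
move=> En QP; apply: ex_framed; rewrite {1}/best_cmd; step.
pose I (i : nat) s' (t' : nat) := exists b, [/\ vars s' vbest = b, 0 < n -> b < n,
  forall x, x < i -> arrs s aLev x <= arrs s aLev b & t' <= t + 20 * i + 4].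
apply: (ex_for (I := I) (a := 0) (b := n)); [by ev|lia|lia|by []|..].
- by exists 0; split=> //=; lia.
- by move=> s1 i t1 fr _ _; base fr; framev fr; ev.
- move=> s1 i t1 fr ib Ei [b [Eb bn h tb]]; base fr; framev fr.
  have EL : arrs s1 aLev = arrs s aLev by case: fr => _ fa; rewrite fa.
  have im : i < n by case/andP: ib.
  step; rewrite ?EL; case: ltnP => c /=; step => _.
    exists i; split=> //=; last by lia.
    move=> x; rewrite ltnS leq_eqVlt => /predU1P[->//|/h xb].
    exact: leq_trans xb (ltnW c).
  exists b; split=> //=; last by lia.
  by move=> x; rewrite ltnS leq_eqVlt => /predU1P[->|/h].
- by move=> s1 t1 fr _ [b [Eb bn h tb]] frm; apply: (QP _ _ b) => //=; lia.
Qed.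

Definition on_path (path : seq nat) x := if x \in path then (index x path).+1 else 0.

(** Each parent is one level lower, so following the parents from a vertex of the highest level
    meets every level once. The path is written from its end. *)
Lemma chain_spec (Q : state -> nat -> Prop) s t b :
  vars s vn = n -> vars s vbest = b -> (0 < n -> b < n) ->
  (forall x, x < n -> arrs s aLev x <= arrs s aLev b) -> arrs s aLev b <= m ->
  (forall x, arrs s aOn x = 0) ->
  (forall v, (arrs s aPar v = 0 /\ arrs s aLev v = 0) \/
     exists2 e, e < m & [/\ dst e = v, arrs s aPar v = (src e).+1
                          & arrs s aLev v = (arrs s aLev (src e)).+1]) ->
  (forall s' t' path, frame chain_cmd s s' -> vars s' vh = size path -> holds (arrs s' aPath) path ->
     {in path, forall x, x < n} -> (forall i, i < size path -> arrs s aLev (nth 0 path i) = i) ->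
     (forall i, i.+1 < size path -> exists2 e, e < m &
        src e = nth 0 path i /\ dst e = nth 0 path i.+1) ->
     (forall x, x < n -> arrs s aLev x < size path) -> size path <= n ->
     (forall x, arrs s' aOn x = on_path path x) ->
     t' <= t + 30 * n + 40 -> Q s' t') ->
  ex chain_cmd Q s t.
Proof.
move=> En Eb bn bm Lm O0 par QP; apply: ex_framed; rewrite {1}/chain_cmd; step.
(* Without vertices [vbest] is 0, which is not a vertex, and the path has to be empty. *)
pose h := if n == 0 then 0 else (arrs s aLev b).+1.
have hm : h <= m.+1 by rewrite /h; case: eqP.
apply: ex_seq; step.
pose I s' (t' : nat) := exists pth, [/\ [/\ vars s' vp + size pth = h,
    0 < vars s' vp -> vars s' vu < n /\ arrs s aLev (vars s' vu) = (vars s' vp).-1 & vars s' vh = h],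
  forall i, i < size pth -> [/\ arrs s' aPath (vars s' vp + i) = nth 0 pth i, nth 0 pth i < n
    & arrs s aLev (nth 0 pth i) = vars s' vp + i],
  (forall i, i.+1 < size pth -> exists2 e, e < m & src e = nth 0 pth i /\ dst e = nth 0 pth i.+1) /\
  (0 < vars s' vp -> 0 < size pth -> exists2 e, e < m & src e = vars s' vu /\ dst e = nth 0 pth 0),
  forall x, arrs s' aOn x = if x \in pth then (vars s' vp + index x pth).+1 else 0
  & t' <= t + 25 * size pth + 30].
suff main s1 t1 : same_but [:: vh] [::] s s1 -> vars s1 vh = h -> t1 <= t + 15 ->
    ex (vu ::= V vbest ;; vp ::= V vh ;;
      While (V vp) (
      vp ::= V vp -: K 1 ;; Put aPath (V vp) (V vu) ;; Put aOn (V vu) (V vp +! K 1) ;;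
      vu ::= Get aPar (V vu) -: K 1)) (fun s' t' => frame chain_cmd s s' -> Q s' t') s1 t1.
  case: eqP main => [n0|/eqP nN] main /=.
    step; apply: main => //; last by clear; lia.
      by split=> // x; rewrite inE /= => /negbTE->.
    by rewrite /= /h n0.
  step; apply: main => //; last by rewrite /=; clear; lia.
    by split=> // x; rewrite inE /= => /negbTE->.
  by rewrite /= /h (negbTE nN) addn1.
move=> f1 Eh t1b; framev f1.
have EO1 : arrs s1 aOn = arrs s aOn by case: f1 => _ fa; rewrite fa.
have EP1 : arrs s1 aPar = arrs s aPar by case: f1 => _ fa; rewrite fa.
step; step; base f1.
apply: (ex_while (I := I) (mu := fun s => vars s vp)).
- exists [::]; rewrite /= ?addn0; split=> //; last by move: t1b; clear; lia.
    split=> //; rewrite /h; case: eqP => // /eqP nN _; split=> //; apply: bn.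
    by rewrite lt0n.
  by move=> x; rewrite EO1 O0.
- move=> s2 t2 fr [pth [[Ep Eu Eh2] h1 [h2 h2'] h3 tb]] /=; rewrite -lt0n => p0.
  have [un ul] := Eu p0.
  have EP2 : arrs s2 aPar = arrs s aPar by case: fr => _ fa; rewrite fa // ?EP1.
  have ph : vars s2 vp <= h by rewrite -Ep leq_addr.
  set p := vars s2 vp in Ep Eu h1 h2' h3 p0 ul ph *.
  set u := vars s2 vu in Eu h2' un ul *.
  have Ep1 : vars s2 vp = p by []. have Eu1 : vars s2 vu = u by [].
  have parb : arrs s aPar u <= n.
    by case: (par u) => [[-> _]//|[e em [_ -> _]]]; apply: srcn.
  have unp : u \notin pth.
    apply/negP => upth; have [_ _] := h1 (index u pth) ltac:(by rewrite index_mem).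
    by rewrite nth_index // ul; move: p0; clear; lia.
  step; rewrite /= -/p; step; step; step; rewrite ?EP2; split; last by rewrite /= subn1; move: p0; clear; lia.
  exists (u :: pth); rewrite /= !subn1.
  have pS : p.-1 + (size pth).+1 = h by rewrite -Ep; move: p0; clear; lia.
  split.
  + split=> // pp; have [[e0 l0]|[e em [de pe le_]]] := par u.
      by move: ul pp; rewrite l0; clear; lia.
    rewrite pe /=; split; first exact: srcn.
    by move: ul; rewrite le_; clear; lia.
  + move=> [|i] /=; first by rewrite addn0 eqxx ul.
    rewrite ltnS => ip; have [q1 q2 q3] := h1 i ip.
    have e : p.-1 + i.+1 = p + i by move: p0; clear; lia.
    by rewrite e ifF ?q1 ?q3 //; apply/eqP; move: p0; clear; lia.
  + split.
      by move=> [|i] /= ip; [apply: h2'|apply: h2].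
    move=> pp _; have [[e0 l0]|[e em [de pe le_]]] := par u.
      by move: ul pp; rewrite l0; clear; lia.
    by exists e => //; rewrite pe.
  + move=> x; rewrite inE [u == x]eq_sym; case: eqP => [->|ne] /=.
      by rewrite addn0; move: p0; clear; lia.
    by rewrite h3; case: ifP => // _; move: p0; clear; lia.
  + by move: tb; rewrite /=; clear; lia.
- move=> s2 t2 fr [pth [[Ep Eu Eh2] h1 [h2 h2'] h3 tb]] /= p0 frm.
  rewrite p0 in Ep h1 h3.
  have lvh x : x < n -> arrs s aLev x < size pth.
    move=> xn; rewrite -[size pth]add0n Ep /h; case: eqP => [n0|_]; first by rewrite n0 in xn.
    by rewrite ltnS bm.
  have pn : size pth <= n.
    rewrite -[leqRHS](size_iota 0); apply: uniq_leq_size.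
      apply/(uniqP 0) => i j; rewrite !inE => /h1[_ _ ei] /h1[_ _ ej] eij.
      by have := congr1 (arrs s aLev) eij; rewrite ei ej !add0n.
    by move=> x /(nthP 0)[i /h1[_ xn _] <-]; rewrite mem_iota.
  apply: (QP _ _ pth) => //.
  + by rewrite Eh2 -Ep.
  + by move=> i /h1[].
  + by move=> x /(nthP 0)[i /h1[_ xn _] <-].
  + by move=> i /h1[_ _ ->].
  + by move: tb pn; clear; lia.
Qed.

(** With [on] counting from 1 along the path, [lp x] is a number of path vertices known in advance
    to precede x: those up to its last direct predecessor on the path, as the path itself consists
    of edges. *)
Definition last_pred (on lp : nat -> nat) := forall x,
  (forall e, e < m -> dst e = x -> on (src e) <= lp x) /\
  (lp x = 0 \/ exists2 e, e < m & dst e = x /\ lp x = on (src e)).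

Lemma preds_spec (Q : state -> nat -> Prop) s t :
  vars s vm = m -> (forall e, e < m -> arrs s 0 e = src e /\ arrs s 1 e = dst e) ->
  (forall x, arrs s aLp x = 0) ->
  (forall s' t', frame preds_cmd s s' -> last_pred (arrs s aOn) (arrs s' aLp) ->
     t' <= t + 40 * m + 10 -> Q s' t') ->
  ex preds_cmd Q s t.
Proof.
move=> Em Es Z QP; apply: ex_framed; rewrite {1}/preds_cmd.
pose on := arrs s aOn.
pose I (i : nat) s' (t' : nat) := (forall x,
  (forall e, e < i -> dst e = x -> on (src e) <= arrs s' aLp x) /\
  (arrs s' aLp x = 0 \/ exists2 e, e < m & dst e = x /\ arrs s' aLp x = on (src e))) /\ t' <= t + 40 * i + 2.
apply: (ex_for (I := I) (a := 0) (b := m)); [by ev|lia|lia|by []|..].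
- by split=> //=; [move=> x; split=> //; left; rewrite Z|lia].
- by move=> s1 i t1 fr _ _; base fr; framev fr; ev.
- move=> s1 i t1 fr ib Ei [h tb]; base fr; framev fr.
  have [A0 A1] : arrs s1 0 = arrs s 0 /\ arrs s1 1 = arrs s 1 by case: fr => _ fa; rewrite !fa.
  have EO : arrs s1 aOn = on by case: fr => _ fa; rewrite fa.
  have im : i < m by case/andP: ib.
  have [e1 e2] := Es i im.
  step; rewrite ?A0 e1; step; rewrite ?A1 e2; step; rewrite ?EO.
  have [hd hd'] := h (dst i).
  case: ltnP => c /=.
    step => _; split; last by rewrite /=; lia.
    move=> x /=; case: (eqVneq x (dst i)) => [->|ne]; last first.
      have [h1 h2] := h x; split=> // e; rewrite ltnS leq_eqVlt => /predU1P[->|]; last exact: h1.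
      by move=> xd; rewrite xd eqxx in ne.
    rewrite ?EO; split; last by right; exists i.
    move=> e; rewrite ltnS leq_eqVlt => /predU1P[->//|ei dx].
    by apply: leq_trans (hd e ei dx) (ltnW c).
  step => _; split; last by rewrite /=; lia.
  move=> x /=; have [h1 h2] := h x; split=> // e.
  by rewrite ltnS leq_eqVlt => /predU1P[->|]; [move=> <-|exact: h1].
- by move=> s1 t1 fr _ [h tb] frm; apply: QP => //=; lia.
Qed.

Lemma rest_spec (Q : state -> nat -> Prop) s t q :
  vars s vn = n -> size q = n -> holds (arrs s aQu) q ->
  (forall s' t' (S := [seq x <- q | arrs s aOn x == 0]), frame rest_cmd s s' ->
    vars s' vX = size S -> holds (arrs s' aA) S -> t' <= t + 40 * n + 20 -> Q s' t') ->
  ex rest_cmd Q s t.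
Proof.
move=> En qn hq QP; apply: ex_framed; rewrite {1}/rest_cmd; step.
pose S i := [seq x <- take i q | arrs s aOn x == 0].
have szS i : i <= n -> size (S i) <= i.
  by rewrite -qn => iq; rewrite size_filter (leq_trans (count_size _ _)) // size_take_min geq_minl.
pose I (i : nat) s' (t' : nat) := [/\ vars s' vX = size (S i), holds (arrs s' aA) (S i)
  & t' <= t + 40 * i + 4].
apply: (ex_for (I := I) (a := 0) (b := n)); [by ev|lia|lia|by []|..].
- by rewrite /I /S take0; split=> //=; lia.
- by move=> s1 i t1 fr _ _; base fr; framev fr; ev.
- move=> s1 i t1 fr ib Ei [h1 h2 tb]; base fr; framev fr.
  have EO : arrs s1 aOn = arrs s aOn by case: fr => _ fa; rewrite fa.
  have EQ1 : arrs s1 aQu = arrs s aQu by case: fr => _ fa; rewrite fa.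
  have im : i < n by case/andP: ib.
  have Si : S i.+1 = if arrs s aOn (nth 0 q i) == 0 then rcons (S i) (nth 0 q i) else S i.
    by rewrite /S (take_nth 0) ?filter_rcons ?qn.
  have sz := szS i (ltnW im).
  step; rewrite ?EQ1 hq ?qn //; step; rewrite ?EO; case: eqP Si => _ Si /=.
    step; step => _; rewrite /I Si size_rcons; split=> /=; rewrite ?h1 ?addn1 //.
      move=> p; rewrite size_rcons ltnS leq_eqVlt nth_rcons => /predU1P[->|pi].
        by rewrite !eqxx ltnn.
      by rewrite pi ifF ?h2 //; apply/eqP; lia.
    by lia.
  by step => _; rewrite /I Si; split=> //=; lia.
move=> s1 t1 fr _ [h1 h2 tb] frm; apply: QP => //=.
- by rewrite h1 /S -qn take_size.
- by move: h2; rewrite /S -qn take_size.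
- by lia.
Qed.

Lemma linked_list_nth f nil l : (forall i, i < size l -> f (nth 0 l i) = nth nil l i.+1) ->
  linked_list f nil (head nil l) l.
Proof.
elim: l => //= x l IH h; split=> //; have := h 0 isT; rewrite /= nth0 => ->.
by apply: IH => i il; exact: (h i.+1).
Qed.

Lemma link_spec (Q : state -> nat -> Prop) s t path :
  vars s vn = n -> vars s vh = size path -> holds (arrs s aPath) path -> uniq path -> size path <= n ->
  (forall s' t', frame link_cmd s s' -> holds (arrs s' aPath) path ->
    linked_list (arrs s' 0) n (vars s' 0) path -> t' <= t + 20 * n + 20 -> Q s' t') ->
  ex link_cmd Q s t.
Proof.
move=> En Eh hp u pn QP; apply: ex_framed; rewrite {1}/link_cmd; step.
set P := fun j => if j == size path then n else arrs s aPath j.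
have Pn i : i <= size path -> P i = nth n path i.
  rewrite leq_eqVlt /P => /predU1P[->|ip]; first by rewrite eqxx nth_default.
  by rewrite ltn_eqF // hp // (set_nth_default n).
pose I (i : nat) s' (t' : nat) := (forall j, j < i -> arrs s' 0 (nth 0 path j) = nth n path j.+1) /\
  t' <= t + 20 * i + 6.
apply: ex_seq; apply: (ex_for (I := I) (a := 0) (b := size path)); [by ev|lia|lia|by []|..].
- by split=> //=; lia.
- by move=> s1 i t1 fr _ _; base fr; framev fr; ev.
- move=> s1 i t1 fr ib Ei [h tb].
  have im : i < size path by case/andP: ib.
  have EP j : arrs s1 aPath j = P j by case: fr => _ fa; rewrite fa.
  base fr; framev fr.
  step => _; split; last by rewrite /=; lia.
  rewrite !EP addn1 !Pn ?(ltnW im) // => j; rewrite ltnS leq_eqVlt /= => /predU1P[->|ji].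
    by rewrite (set_nth_default 0) // eqxx.
  have jm := ltn_trans ji im.
  rewrite (set_nth_default 0 n im) nth_uniq //; case: eqP => [e|_]; last exact: h.
  by rewrite e ltnn in ji.
- move=> s1 t1 fr _ [h tb].
  have EP j : arrs s1 aPath j = P j by case: fr => _ fa; rewrite fa.
  base fr; framev fr; step => frm.
  apply: QP => //=; last by move: tb pn; clear; lia.
  + by move=> p pp; rewrite EP Pn ?(ltnW pp) // (set_nth_default 0).
  + by rewrite EP Pn // nth0; apply: linked_list_nth.
Qed.

Definition laid_out (s : state) (q path : seq nat) (lev : nat -> nat) :=
  [/\ perm_eq q (iota 0 n) /\ (forall e, e < m -> index (src e) q < index (dst e) q),
      [/\ forall e, e < m -> lev (src e) < lev (dst e), forall x, x < n -> lev x < size path,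
          forall i, i < size path -> lev (nth 0 path i) = i & {in path, forall x, x < n}],
      forall i, i.+1 < size path -> exists2 e, e < m & src e = nth 0 path i /\ dst e = nth 0 path i.+1,
      last_pred (on_path path) (arrs s aLp)
    & let S := [seq x <- q | x \notin path] in
      [/\ vars s vX = size S /\ holds (arrs s aA) S, vars s vh = size path /\ holds (arrs s aPath) path,
          vars s vn = n /\ vars s vR = 4 * n & linked_list (arrs s 0) n (vars s 0) path]].

Lemma layout_spec (Q : state -> nat -> Prop) s t :
  sourced n m src dst ->
  vars s 0 = n -> vars s 1 = m -> (forall e, e < m -> arrs s 0 e = src e /\ arrs s 1 e = dst e) ->
  (forall a x, 2 <= a -> arrs s a x = 0) ->
  (forall s' t' q path lev, laid_out s' q path lev -> t' <= t + 400 * (n + m + 1) -> Q s' t') ->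
  ex layout_cmd Q s t.
Proof.
move=> acyc E0 E1 Es Z QP; rewrite /layout_cmd; step; step.
have Es' s' : arrs s' 0 = arrs s 0 -> arrs s' 1 = arrs s 1 ->
    forall e, e < m -> arrs s' 0 e = src e /\ arrs s' 1 e = dst e.
  by move=> -> ->.
apply: ex_seq; apply: (@build_spec w orc n m src dst WW) => //=; try by move=> u; apply: Z.
move=> s1 t1 f1 ad1 deg1 t1b.
have [n1 m1] : vars s1 vn = n /\ vars s1 vm = m by case: f1 => fv _; rewrite !fv.
have [A1 B1] : arrs s1 0 = arrs s 0 /\ arrs s1 1 = arrs s 1 by case: f1 => _ fa; rewrite !fa.
have Z1 a x : a \in [:: aLev; aPar; aOn; aLp] -> arrs s1 a x = 0.
  by move=> ai; case: f1 => _ fa; rewrite fa /= ?Z //; move: ai; rewrite !inE => /or4P[] /eqP ->.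
apply: ex_seq; apply: (roots_spec orc WW n1) => s2 t2 q0 f2 Hq0 q0d t2b.
have [n2 m2] : vars s2 vn = n /\ vars s2 vm = m by case: f2 => fv _; rewrite !fv.
have [A2 B2] : arrs s2 0 = arrs s 0 /\ arrs s2 1 = arrs s 1 by case: f2 => _ fa; rewrite !fa.
have D2 : arrs s2 aDeg = arrs s1 aDeg by case: f2 => _ fa; rewrite fa.
have ad2 : adjacency src s2 m by move=> u; case: f2 => _ fa; rewrite !fa //; apply: ad1.
have Z2 a x : a \in [:: aLev; aPar; aOn; aLp] -> arrs s2 a x = 0.
  by move=> ai; case: f2 => _ fa; rewrite fa ?Z1 //; move: ai; rewrite !inE => /or4P[] /eqP ->.
apply: ex_seq; apply: (@kahn_spec w orc n m src dst srcn dstn WW _ _ _ _ acyc Hq0) => //; rewrite ?D2 //.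
- by move=> e em; case: (Es' s2 A2 B2 e em).
- by move=> v; apply: Z2.
- by move=> v; apply: Z2.
move=> s3 t3 q D f3 inv pq allD t3b.
have [n3 m3] : vars s3 vn = n /\ vars s3 vm = m by case: f3 => fv _; rewrite !fv.
have [A3 B3] : arrs s3 0 = arrs s 0 /\ arrs s3 1 = arrs s 1 by case: f3 => _ fa; rewrite !fa.
have Z3 a x : a \in [:: aOn; aLp] -> arrs s3 a x = 0.
  move=> ai; case: f3 => _ fa; rewrite fa ?Z2 //.
    by move: ai; rewrite !inE => /orP[] ->; rewrite ?orbT.
  by move: ai; rewrite !inE => /orP[] /eqP ->.
have Dm := kahn_inv_size inv.
have [[_ hq uq _] [_ Ds _] qdeg qe [lv lvs par]] := inv.
apply: ex_seq; apply: best_spec => // s4 t4 b f4 Eb bn bm t4b.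
have [n4 m4] : vars s4 vn = n /\ vars s4 vm = m by case: f4 => fv _; rewrite !fv.
have A4 a : arrs s4 a = arrs s3 a by case: f4 => _ fa; rewrite fa.
apply: ex_seq; apply: (chain_spec n4 Eb bn); rewrite ?A4 //.
- by apply: leq_trans (lvs b) Dm.
- by move=> x; apply: Z3.
- by move=> v; case: (par v) => [h|[e /Ds[em _] h]]; [left|right; exists e].
move=> s5 t5 path f5 Eh hp pn plev pe lvh psz On t5b; rewrite ?A4 in plev lvh.
have [n5 m5] : vars s5 vn = n /\ vars s5 vm = m by case: f5 => fv _; rewrite !fv.
have A5 : arrs s5 0 = arrs s 0 by case: f5 => _ fa; rewrite fa // A4.
have B5 : arrs s5 1 = arrs s 1 by case: f5 => _ fa; rewrite fa // A4.
have Z5 x : arrs s5 aLp x = 0 by case: f5 => _ fa; rewrite fa // A4 Z3.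
have hq5 : holds (arrs s5 aQu) q by case: f5 => _ fa; rewrite fa // A4.
apply: ex_seq; apply: preds_spec => //; first exact: Es'.
move=> s6 t6 f6 lp6 t6b.
have [n6 h6] : vars s6 vn = n /\ vars s6 vh = size path by case: f6 => fv _; rewrite !fv.
have hq6 : holds (arrs s6 aQu) q by case: f6 => _ fa; rewrite fa.
have hp6 : holds (arrs s6 aPath) path by case: f6 => _ fa; rewrite fa.
have O6 : arrs s6 aOn = arrs s5 aOn by case: f6 => _ fa; rewrite fa.
have qsz : size q = n by rewrite (perm_size pq) size_iota.
apply: ex_seq; apply: (rest_spec n6 qsz hq6) => s7 t7 S f7 S7 hS t7b.
have [n7 h7] : vars s7 vn = n /\ vars s7 vh = size path by case: f7 => fv _; rewrite !fv.
have hp7 : holds (arrs s7 aPath) path by case: f7 => _ fa; rewrite fa.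
have lp7 : arrs s7 aLp = arrs s6 aLp by case: f7 => _ fa; rewrite fa.
have pu : uniq path.
  by apply/(uniqP 0) => i j; rewrite !inE => /plev ei /plev ej eij; rewrite -ei -ej eij.
apply: ex_seq; apply: (link_spec n7 h7 hp7 pu psz) => s8 t8 f8 hp8 lk8 t8b.
have [n8 h8] : vars s8 vn = n /\ vars s8 vh = size path by case: f8 => fv _; rewrite !fv.
have S8 : vars s8 vX = size S by case: f8 => fv _; rewrite fv.
have hS8 : holds (arrs s8 aA) S by case: f8 => _ fa; rewrite fa.
have lp8 : arrs s8 aLp = arrs s6 aLp by case: f8 => _ fa; rewrite fa.
have SE : S = [seq x <- q | x \notin path].
  by apply: eq_filter => x; rewrite O6 On /on_path; case: ifP.
step; apply: (QP _ _ q path (arrs s3 aLev)).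
- split=> /=.
  + split=> // e em; apply: qe => //.
    by rewrite (perm_mem pq) mem_iota dstn.
  + by split=> // e em; apply: lv; apply: allD.
  + exact: pe.
  + rewrite lp8 => x; have [h1 h2] := lp6 x; split=> [e em ed|]; first by rewrite -On; apply: h1.
    by case: h2 => [|[e em h]]; [left|right; exists e; rewrite -?On].
  + by rewrite -SE.
- by move: t1b t2b t3b t4b t5b t6b t7b t8b; rewrite /=; clear; lia.
Qed.

End Layout.

(** * Counting extensions *)

Section LowerBounds.
Variables (T : finType) (G L : {set T * T}).
Hypothesis linL : linear_order L.
Hypothesis comL : compatible G L.

(** Sorts by F and breaks ties by L. If F weakly increases along the edges of G, the result is
    compatible with G; all lower bounds on e(G) count orders of this form. *)
Definition lexo (F : T -> nat) : {set T * T} :=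
  [set p | (F p.1 < F p.2) || (F p.1 == F p.2) && (p \in L)].

Lemma L_irr x : (x, x) \notin L.
Proof. by case/and3P: linL => /forallP. Qed.

Lemma L_trans y x z : (x, y) \in L -> (y, z) \in L -> (x, z) \in L.
Proof.
case/and3P: linL => _ /forallP/(_ x)/forallP/(_ y)/forallP/(_ z)/implyP h _ xy yz.
by apply: h; rewrite xy.
Qed.

Lemma L_total x y : x != y -> ((x, y) \in L) || ((y, x) \in L).
Proof. by move=> ne; case/and3P: linL => _ _ /forallP/(_ x)/forallP/(_ y)/implyP; apply. Qed.

Lemma L_asym x y : (x, y) \in L -> (y, x) \notin L.
Proof. by move=> xy; apply/negP => /(L_trans xy); apply/negP/L_irr. Qed.

Lemma GL x y : (x, y) \in G -> (x, y) \in L.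
Proof. by move=> xy; move/forallP/(_ x)/forallP/(_ y)/implyP: comL; apply. Qed.

Definition extensions := [set L' : {set T * T} | linear_order L' && compatible G L'].

Lemma lexo_extension F : (forall x y, (x, y) \in G -> F x <= F y) -> lexo F \in extensions.
Proof.
move=> FG; rewrite inE; apply/andP; split; first (apply/and3P; split).
- by apply/forallP => x; rewrite inE /= ltnn eqxx (negbTE (L_irr x)).
- apply/forallP => x; apply/forallP => y; apply/forallP => z; apply/implyP; rewrite !inE /=.
  case/andP=> /orP[xy|/andP[/eqP-> xy]] /orP[yz|/andP[/eqP<- yz]].
  + by rewrite (ltn_trans xy yz).
  + by rewrite xy.
  + by rewrite yz.
  + by rewrite eqxx (L_trans xy yz) orbT.
- apply/forallP => x; apply/forallP => y; apply/implyP => ne; rewrite !inE /=.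
  by case: ltngtP => //= _; apply: L_total.
apply/forallP => x; apply/forallP => y; apply/implyP => xy; rewrite inE /=.
by have := FG x y xy; rewrite leq_eqVlt => /orP[->|->] //; rewrite GL ?orbT.
Qed.

Lemma num_ext_ge (I : finType) (D : {pred I}) (F : I -> T -> nat) :
  (forall i x y, i \in D -> (x, y) \in G -> F i x <= F i y) ->
  {in D &, injective (fun i => lexo (F i))} -> #|D| <= num_ext G.
Proof.
move=> FG inj; rewrite -(card_in_imset inj); apply: subset_leq_card.
by apply/subsetP => _ /imsetP[i iD ->]; apply: lexo_extension => x y; apply: FG.
Qed.

Lemma num_ext_levels (P : {set T}) (lev : T -> nat) :
  (forall x y, (x, y) \in G -> lev x < lev y) ->
  (forall x, x \notin P -> exists2 p, p \in P & lev p = lev x) ->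
  2 ^ #|~: P| <= num_ext G.
Proof.
move=> levG levP; rewrite -card_powerset.
(* Each level gets three places with P in the middle one, so whether x comes before the element of P
   of its level shows whether x is in A. *)
pose F (A : {set T}) x := 3 * lev x + (if x \in P then 1 else if x \in A then 0 else 2).
apply: (@num_ext_ge _ _ F) => [A x y _ /levG|A B].
  by rewrite /F; case: (x \in P); case: (y \in P); case: (x \in A); case: (y \in A); lia.
rewrite !powersetE => /subsetP AP /subsetP BP eAB; apply/setP => x.
case: (boolP (x \in P)) => [xP|xP].
  apply/idP/idP => [/AP|/BP]; by rewrite inE xP.
have [p pP lp] := levP x xP.
have key (C : {set T}) : ((x, p) \in lexo (F C)) = (x \in C).
  rewrite inE /= /F pP (negbTE xP) lp; case: (x \in C); first by rewrite ltn_add2l.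
  by rewrite ltn_add2l eqn_add2l.
by rewrite -!key eAB.
Qed.

(** The elements of P take odd places 2 idx + 1 and each other s an even place 2 c, that is the gap
    c of the path, for any c from [lo s] to [r s]. The ranges of different s share at most an end
    point, where L breaks the tie, so all choices are independent. *)
Lemma num_ext_gaps (P : {set T}) (idx r lo : T -> nat) M :
  {in P &, forall x y, (x, y) \in G -> idx x < idx y} ->
  (forall p s, p \in P -> s \notin P -> (p, s) \in G -> idx p < lo s) ->
  (forall p s, p \in P -> s \notin P -> (s, p) \in G -> r s <= idx p) ->
  (forall s u, s \notin P -> u \notin P -> (s, u) \in L -> r s <= lo u) ->
  (forall s, s \notin P -> lo s <= r s <= M) ->
  (forall s c, s \notin P -> c < r s -> exists2 p, p \in P & idx p = c) ->
  \prod_(s | s \notin P) (r s - lo s).+1 <= num_ext G.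
Proof.
move=> hPP hPs hsP hss lor hidx.
pose D (s : T) : {pred 'I_M.+1} :=
  if s \in P then pred1 ord0 else [pred c : 'I_M.+1 | lo s <= c <= r s].
have cD s : #|D s| = if s \in P then 1 else (r s - lo s).+1.
  rewrite /D; case: ifP => sP; first by rewrite card1.
  have /andP[h1 h2] := lor s (negbT sP).
  pose g (i : 'I_(r s - lo s).+1) : 'I_M.+1 := inord (lo s + i).
  have gv i : val (g i) = lo s + i.
    by rewrite /= inordK // ltnS; apply: leq_trans h2; have := ltn_ord i; lia.
  have gi : injective g.
    by move=> i j /(congr1 val); rewrite !gv => /addnI/val_inj.
  rewrite -[RHS]card_ord -(card_codom gi); apply: eq_card => c; rewrite inE.
  apply/idP/codomP => [/andP[c1 c2]|[i ->]]; last first.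
    by rewrite gv leq_addr /=; have := ltn_ord i; lia.
  have ci : c - lo s < (r s - lo s).+1 by rewrite ltnS leq_sub2r.
  by exists (Ordinal ci); apply: val_inj; rewrite gv /= subnKC.
have -> : \prod_(s | s \notin P) (r s - lo s).+1 = #|family D|.
  rewrite card_family foldrE big_map big_enum /= big_mkcond; apply: eq_bigr => s _.
  by rewrite cD; case: (s \in P).
pose F (f : {ffun T -> 'I_M.+1}) x := if x \in P then (2 * idx x).+1 else 2 * f x.
have fD f s : f \in family D -> s \notin P -> lo s <= f s <= r s.
  by move/familyP/(_ s); rewrite /D => + sP; rewrite (negbTE sP) inE.
apply: (@num_ext_ge _ _ F) => [f x y fi xy|f f' fi fi' e].
  rewrite /F; case: ifPn => xP; case: ifPn => yP.
  - by have := hPP x y xP yP xy; lia.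
  - by have := hPs x y xP yP xy; have := fD f y fi yP; lia.
  - by have := hsP y x yP xP xy; have := fD f x fi xP; lia.
  - have := hss x y xP yP (GL xy); have := fD f x fi xP; have := fD f y fi yP; lia.
have half g g' s : g \in family D -> g' \in family D -> lexo (F g) = lexo (F g') ->
    s \notin P -> g s < g' s -> False.
  move=> gi gi' eg sP lt_.
  (* The path vertex whose index is the smaller choice comes after s under g and before s under g',
     so the two orders differ. *)
  have [p pP ip] := hidx s (g s) sP ltac:(have := fD g' s gi' sP; lia).
  have : (s, p) \in lexo (F g) by rewrite inE /= /F pP (negbTE sP) ip; apply/orP; left; lia.
  rewrite eg inE /= /F pP (negbTE sP) ip; lia.
apply/ffunP => s; case: (boolP (s \in P)) => sP.
  move/familyP/(_ s): fi; move/familyP/(_ s): fi'; rewrite /D sP.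
  by rewrite !inE => /eqP-> /eqP->.
apply: val_inj; case: (ltngtP (f s) (f' s)) => // h; first by case: (half f f' s).
by case: (half f' f s).
Qed.

End LowerBounds.

Section Weights.
Variables (T : finType) (G L : {set T * T}) (pos : T -> nat) (S : {set T}) (v : T -> nat) (N : nat).
Hypothesis linL : linear_order L.
Hypothesis comL : compatible G L.
Hypothesis posG : forall x y, (x, y) \in G -> pos x < pos y.

Definition before x y := (pos x < pos y) && ((x, y) \in L).

Lemma before_trans y x z : before x y -> before y z -> before x z.
Proof.
case/andP=> p1 l1 /andP[p2 l2]; by rewrite /before (ltn_trans p1 p2) (L_trans linL l1 l2).
Qed.

Definition chain_set (K : {set T}) :=
  [forall a in K, forall b in K, (a != b) ==> before a b || before b a].

Hypothesis vN : forall K : {set T}, K \subset S -> chain_set K -> \sum_(x in K) v x <= N.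

Definition chain_to x : pred {set T} :=
  [pred K : {set T} | [&& K \subset S, x \in K, chain_set K & [forall a in K, (a != x) ==> before a x]]].

(** The weight of the heaviest chain of S with top x. Appending x to a chain with top y shows that
    the interval (height x - v x, height x] lies above the one of every y before x. *)
Definition height x := \max_(K | chain_to x K) \sum_(a in K) v a.

Lemma chain_to1 x : x \in S -> chain_to x [set x].
Proof.
move=> xS; rewrite /chain_to /= sub1set xS set11 /=; apply/andP; split.
  by apply/forall_inP => a /set1P->; apply/forall_inP => b /set1P->; rewrite eqxx.
by apply/forall_inP => a /set1P->; rewrite eqxx.
Qed.

Lemma height_ge x : x \in S -> v x <= height x.
Proof.
by move=> xS; apply: (leq_trans _ (leq_bigmax_cond _ (chain_to1 xS))); rewrite big_set1.
Qed.

Lemma height_le x : height x <= N.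
Proof. by apply/bigmax_leqP => K /and4P[KS _ cK _]; apply: vN. Qed.

Lemma height_step x y : x \in S -> y \in S -> before y x -> height y + v x <= height x.
Proof.
move=> xS yS yx.
have [|K] := @eq_bigmax_cond _ (chain_to y) (fun K => \sum_(a in K) v a).
  by apply/card_gt0P; exists [set y]; apply: chain_to1.
rewrite inE => /and4P[KS yK cK toy]; rewrite -/(height y) => ->.
have tox a : a \in K -> before a x.
  move=> aK; have [->//|ne] := eqVneq a y.
  by apply: before_trans yx; move/forall_inP/(_ a aK)/implyP: toy; apply.
have xK : x \notin K by apply/negP => /tox; rewrite /before ltnn.
have cto : chain_to x (x |: K).
  rewrite /chain_to /= subUset sub1set xS KS setU11 /=; apply/andP; split.
    apply/forall_inP => a; rewrite !inE => /predU1P[->|aK]; apply/forall_inP => b; rewrite !inE.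
      move=> /predU1P[->|bK]; first by rewrite eqxx.
      by rewrite (tox b bK) orbT implybT.
    move=> /predU1P[->|bK]; first by rewrite (tox a aK) implybT.
    by move/forall_inP/(_ a aK)/forall_inP/(_ b bK): cK.
  apply/forall_inP => a; rewrite !inE => /predU1P[->|aK]; first by rewrite eqxx.
  by rewrite tox ?implybT.
apply: (leq_trans _ (leq_bigmax_cond _ cto)).
by rewrite big_setU1 //= addnC.
Qed.

(* Any choice of f(x) in (height x - v x, height x] extends to a monotone F with
   F = f on S.  The extension [lexo F] and the set of all f(s) + rank(s) for s in
   S, a subset of [0, N + |S|], determine f. *)
Lemma num_ext_weights : \prod_(x in S) v x <= num_ext G * 2 ^ (N + #|S|).+1.
Proof.
pose D (s : T) : {pred 'I_N.+1} :=
  if s \in S then [pred c : 'I_N.+1 | height s < c + v s <= height s + v s] else pred1 ord0.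
have cD s : #|D s| = if s \in S then v s else 1.
  rewrite /D; case: ifP => sS; last by rewrite card1.
  have h1 := height_ge sS; have h2 := height_le s.
  pose g (i : 'I_(v s)) : 'I_N.+1 := inord (height s - i).
  have gv i : val (g i) = height s - i by rewrite /= inordK //; lia.
  have gi : injective g.
    by move=> i j /(congr1 val); rewrite !gv => e; apply: ord_inj; have := ltn_ord i; have := ltn_ord j; lia.
  rewrite -[RHS]card_ord -(card_codom gi); apply: eq_card => c; rewrite inE.
  apply/idP/codomP => [/andP[c1 c2]|[i ->]]; last first.
    by rewrite gv; have := ltn_ord i; lia.
  have ci : height s - c < v s by lia.
  by exists (Ordinal ci); apply: val_inj; rewrite gv /=; lia.
have -> : \prod_(s in S) v s = #|family D|.
  rewrite card_family foldrE big_map big_enum /= big_mkcond; apply: eq_bigr => s _.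
  by rewrite cD; case: (s \in S).
pose F (f : {ffun T -> 'I_N.+1}) u := \max_(x | (x \in S) && ((x == u) || before x u)) (f x : nat).
have FG f x y : (x, y) \in G -> F f x <= F f y.
  move=> xy; have bxy : before x y by rewrite /before posG // (GL comL).
  apply/bigmax_leqP => z /andP[zS zx]; apply: (@leq_bigmax_cond _ _ (fun x => f x : nat)).
  rewrite zS /=; case/predU1P: zx => [->|zx]; first by rewrite bxy orbT.
  by rewrite (before_trans zx bxy) orbT.
have fD f s : f \in family D -> s \in S -> height s < f s + v s /\ f s <= height s.
  by move/familyP/(_ s); rewrite /D => + sS; rewrite sS inE leq_add2r => /andP.
(* For y before s one has f y <= height y <= height s - v s < f s, so the maximum is attained at
   s. *)
have Fs f s : f \in family D -> s \in S -> F f s = f s.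
  move=> fi sS; apply/eqP; rewrite eqn_leq; apply/andP; split; last first.
    by apply: (@leq_bigmax_cond _ _ (fun x => f x : nat)); rewrite sS eqxx.
  apply/bigmax_leqP => y /andP[yS /predU1P[->//|ys]].
  have := height_step sS yS ys; have := fD f s fi sS; have := fD f y fi yS; lia.
pose rank f s := #|[set y in S | (y, s) \in lexo L (F f)]|.
pose g (f : {ffun T -> 'I_N.+1}) s := (f s : nat) + rank f s.
have ext f : lexo L (F f) \in extensions G by apply: lexo_extension => // x y; apply: FG.
have lin f : linear_order (lexo L (F f)) by have := ext f; rewrite inE => /andP[].
have rk_le f s : rank f s <= #|S|.
  by apply: subset_leq_card; apply/subsetP => y; rewrite inE => /andP[].
have gN f s : g f s < (N + #|S|).+1.
  by rewrite ltnS; apply: leq_add; [rewrite -ltnS|apply: rk_le].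
pose A f : {set 'I_(N + #|S|).+1} := [set inord (g f s) | s in S].
have gmono f y s : f \in family D -> y \in S -> s \in S -> (y, s) \in lexo L (F f) -> g f y < g f s.
  move=> fi yS sS ys; rewrite -addnS; apply: leq_add.
    by move: ys; rewrite inE /= !Fs // => /orP[/ltnW//|/andP[/eqP->]].
  apply: proper_card; apply/properP; split.
    by apply/subsetP => z /setIdP[zS zy]; apply/setIdP; split=> //; exact: (L_trans (lin f) zy ys).
  exists y; first by apply/setIdP.
  by apply/setIdP => -[_]; apply/negP/(L_irr (lin f)).
have gord f y s : f \in family D -> y \in S -> s \in S -> (g f y < g f s) = ((y, s) \in lexo L (F f)).
  move=> fi yS sS; apply/idP/idP; last exact: gmono.
  apply: contraTT => nys; rewrite -leqNgt; have [->//|ne] := eqVneq y s.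
  have := L_total (lin f) ne; rewrite (negbTE nys) /= => sy.
  by apply: ltnW; apply: gmono.
have cnt f s : f \in family D -> s \in S -> #|[set b in A f | b < g f s]| = rank f s.
  move=> fi sS; rewrite /rank.
  have inj : {in [set y in S | (y, s) \in lexo L (F f)] &, injective (fun y => inord (g f y) : 'I_(N + #|S|).+1)}.
    move=> y z /setIdP[yS _] /setIdP[zS _] /(congr1 val); rewrite /= !inordK // => e.
    have [//|ne] := eqVneq y z.
    by have := L_total (lin f) ne; rewrite -!gord // e ltnn.
  rewrite -(card_in_imset inj); apply: eq_card => b; rewrite inE; apply/andP/imsetP.
    move=> [/imsetP[y yS ->]]; rewrite inordK // gord // => ys.
    by exists y; rewrite // inE yS.
  move=> [y /setIdP[yS ys] ->]; split; first exact: imset_f.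
  by rewrite inordK // gord.
(* g strictly increases along the extension, so [g f s] is the element of [A f] with exactly
   [rank f s] elements below it, and the ranks can be read off the extension. Adding the rank is
   what makes the values distinct, so that a mere set of them can encode f. *)
pose Phi f := (lexo L (F f), A f).
have inj : {in family D &, injective Phi}.
  move=> f f' fi fi' [eL eA]; apply/ffunP => s; apply: val_inj.
  case: (boolP (s \in S)) => sS; last first.
    move/familyP/(_ s): fi; move/familyP/(_ s): fi'; rewrite /D (negbTE sS).
    by rewrite !inE => /eqP-> /eqP->.
  have er : rank f s = rank f' s by rewrite /rank eL.
  suff half h h' : h \in family D -> h' \in family D -> A h = A h' -> rank h s = rank h' s -> g h' s <= g h s.
    have e1 := half f f' fi fi' eA er; have e2 := half f' f fi' fi (esym eA) (esym er).
    by apply/eqP; rewrite -(eqn_add2r (rank f s)) {2}er eqn_leq e1 e2.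
  move=> hi hi' eh erh; rewrite leqNgt; apply/negP => lt_.
  suff : rank h s < rank h' s by rewrite erh ltnn.
  rewrite -!cnt //; apply: proper_card; apply/properP; split.
    by apply/subsetP => b; rewrite !inE -eh => /andP[-> /= bl]; apply: ltn_trans bl lt_.
  exists (inord (g h s)); rewrite !inE -?eh inordK ?ltnn ?andbF // lt_ andbT.
  by apply: imset_f.
rewrite -(card_in_imset inj).
have -> : 2 ^ (N + #|S|).+1 = #|powerset [set: 'I_(N + #|S|).+1]|.
  by rewrite card_powerset cardsT card_ord.
rewrite -cardsX; apply: subset_leq_card; apply/subsetP => _ /imsetP[f fi ->].
by rewrite inE /= ext powersetE subsetT.
Qed.

End Weights.

(** * Paying for the phases *)

(** The logarithm of the weight in the overview: for c = 1 and the phases after the first, an item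
    that survives j phases gets 1 + 2 + ... + 2^(j-1) = 2^j - 1. *)
Fixpoint weight c (r : seq (seq nat * seq nat)) x :=
  if r is (Y, _) :: r' then (x \in Y) * c + weight (2 * c) r' x else 0.

(** A linear majorant of the exponential of the weight. Since 2^c 2^(c + u) = 2^(2c) 2^u, every
    phase that x enters turns the leading term 2^c into 2^(2c), and adding up these terms replaces a
    product over phases by a sum. *)
Fixpoint excess c (r : seq (seq nat * seq nat)) x :=
  if r is (Y, _) :: r' then (x \in Y) * 2 ^ (2 * c) + excess (2 * c) r' x else 0.

(** 2^(4c) is the block size of the phase before the one that Y enters, because Y is what that phase
    lost. *)
Fixpoint sparse c (r : seq (seq nat * seq nat)) (K : seq nat) M :=
  if r is (Y, _) :: r' then size [seq x <- K | x \in Y] * 2 ^ (4 * c) <= M /\ sparse (2 * c) r' K M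
  else True.

Lemma weight_excess c r x : 2 ^ c * 2 ^ weight c r x <= 2 ^ c + excess c r x.
Proof.
elim: r c => [|[Y C] r IH] c /=; first by rewrite muln1 addn0.
have h := IH (2 * c).
have e2 : 2 ^ (2 * c) = 2 ^ c * 2 ^ c by rewrite mul2n -addnn expnD.
have c0 : 0 < 2 ^ c by rewrite expn_gt0.
case: (x \in Y); rewrite ?mul1n ?mul0n ?add0n.
  by rewrite expnD mulnA -e2 (leq_trans h) // leq_addl.
rewrite -(leq_pmul2l c0) mulnA -e2 (leq_trans h) // mulnDr -e2 leq_add2l.
by rewrite leq_pmull.
Qed.

(** An item of Y contributes 2^(2c) and K has at most M / 2^(4c) of them, so a phase contributes M /
    2^(2c). Doubling c at least halves this, which gives the factor 2. *)
Lemma excess_sum c r (K : seq nat) M : 0 < c -> sparse c r K M ->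
  (\sum_(x <- K) excess c r x) * 2 ^ (2 * c) <= 2 * M.
Proof.
elim: r c => [|[Y C] r IH] c c0 /=; first by rewrite big1 // mul0n.
move=> [h1 h2]; rewrite big_split /= mulnDl [2 * M]mul2n -addnn; apply: leq_add.
  rewrite -big_distrl /= -mulnA -expnD.
  have -> : \sum_(x <- K) (x \in Y) = size [seq x <- K | x \in Y].
    by rewrite size_filter -sum1_count [RHS]big_mkcond /=; apply: eq_bigr => x _; case: (x \in Y).
  by have -> : 2 * c + 2 * c = 4 * c by lia.
have := IH (2 * c) ltac:(lia) h2; set D := \sum_(x <- K) _ => h.
have h4 : 2 <= 2 ^ (2 * c) by rewrite (@leq_exp2l 2 1) //; lia.
have e4 : 2 ^ (2 * (2 * c)) = 2 ^ (2 * c) * 2 ^ (2 * c) by rewrite -expnD; congr (2 ^ _); lia.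
rewrite e4 mulnA in h; rewrite -(@leq_pmul2l 2) //.
by apply: leq_trans h; rewrite mulnC leq_mul2l h4 orbT.
Qed.

Section Steps.
Variables (rk : nat -> nat).

Lemma phase_sub be X C X' : phase_result rk be X C X' -> uniq X -> uniq X' /\ {subset X' <= X}.
Proof.
move=> [p _ _ _ _]; rewrite -(perm_uniq p) cat_uniq => /and3P[_ _ u]; split=> // x xX.
by rewrite -(perm_mem p) mem_cat xX orbT.
Qed.

Lemma steps_sparse c X C r X' K M : uniq X -> uniq K ->
  steps rk (4 * c) X ((X, C) :: r) X' -> consistent rk X [seq x <- K | x \in X] ->
  22 * size X <= M -> sparse c r K M.
Proof.
elim: r c X C => [//|[Y D] r IH] c X C uX uK /= [_ X0 [X1 pr [eY X10 st]]] con XM.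
have [uX1 sX1] := phase_sub pr uX; have [pX _ agr _ loss] := pr.
subst Y; have con1 : consistent rk X1 [seq x <- K | x \in X1].
  move=> x y; rewrite !mem_filter => /andP[x1 xK] /andP[y1 yK] rxy.
  by apply: agr => //; apply: con => //; rewrite mem_filter ?sX1.
split.
  apply: leq_trans XM; apply: loss => //; first by rewrite filter_uniq.
  by move=> x; rewrite mem_filter => /andP[].
apply: (IH (2 * c) X1 D) => //.
  have -> : 4 * (2 * c) = 2 * (4 * c) by lia.
  by split.
apply: leq_trans XM; rewrite leq_mul2l /=.
by rewrite -(perm_size pX) size_cat leq_addl.
Qed.

Lemma steps_cost_weight c X r X' (S : seq nat) : uniq X -> uniq S -> {subset X <= S} ->
  steps rk (8 * c) X r X' -> steps_cost (8 * c) r = 8 * \sum_(x <- S) weight c r x.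
Proof.
elim: r c X => [|[Y D] r IH] c X uX uS XS /=; first by rewrite big1.
move=> [-> X0 [X1 pr st]]; have [uX1 sX1] := phase_sub pr uX.
have e : 2 * (8 * c) = 8 * (2 * c) by lia.
rewrite e in st *; rewrite (IH _ X1) //; last by move=> x /sX1/XS.
rewrite big_split /= mulnDr; congr (_ + _).
rewrite -big_distrl /=.
have -> : \sum_(x <- S) (x \in X) = size X; last by rewrite mulnCA.
have -> : \sum_(x <- S) (x \in X) = size [seq x <- S | x \in X].
  by rewrite size_filter -sum1_count [RHS]big_mkcond /=; apply: eq_bigr => x _; case: (x \in X).
apply: perm_size; apply: uniq_perm; rewrite ?filter_uniq // => x.
by rewrite mem_filter; case xX: (x \in X) => //=; rewrite XS.
Qed.

Lemma chain_weight r (S K : seq nat) : uniq S -> uniq K -> {subset K <= S} ->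
  steps rk 4 S r [::] -> consistent rk S K ->
  \sum_(x <- K) 2 ^ weight 1 (behead r) x <= 7 * size S.
Proof.
move=> uS uK KS st con; have KS' : size K <= size S by apply: uniq_leq_size.
case: r st => [|[Y C] r] st.
  rewrite /= (eq_bigr (fun => 1)) // sum1_size; move: KS'; clear; lia.
have YS : Y = S by case: st.
rewrite YS in st; rewrite /=.
have fK : [seq x <- K | x \in S] = K by apply/all_filterP/allP.
have sp : sparse 1 r K (22 * size S).
  by apply: (steps_sparse uS uK (c := 1) (C := C) (X' := [::])); rewrite ?fK.
have h1 := excess_sum (c := 1) isT sp.
have e2 : \sum_(x <- K) 2 = 2 * size K by rewrite -sum1_size big_distrr.
have h2 : 2 * \sum_(x <- K) 2 ^ weight 1 r x <= 2 * size K + \sum_(x <- K) excess 1 r x.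
  rewrite -e2 -big_split big_distrr /=; apply: leq_sum => x _; exact: (weight_excess 1).
(* The excess is at most 2 * 22 |S| / 4 = 11 |S|, so the weights sum to at most |K| + 5.5 |S|. *)
move: h1 h2; rewrite (_ : 2 ^ (2 * 1) = 4) //.
by move: (\sum_(x <- K) _) (\sum_(x <- K) _) KS'; clear; lia.
Qed.

Lemma steps_cost_total r (S : seq nat) : uniq S -> steps rk 4 S r [::] ->
  steps_cost 4 r <= 4 * size S + 8 * \sum_(x <- S) weight 1 (behead r) x.
Proof.
move=> uS; case: r => [//|[Y C] r] /= [-> S0 [X1 pr st]]; rewrite mulnC leq_add2l.
have [uX1 sX1] := phase_sub pr uS.
by rewrite (steps_cost_weight (c := 1) uX1 uS sX1 st).
Qed.

End Steps.

(** * Ranks of items, and the bounds by e(G) for the computed order and path *)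

Section Vals.
Variable n : nat.

Lemma vals_perm (s : seq nat) : uniq s -> {in s, forall x, x < n} ->
  perm_eq s [seq val y | y <- enum [pred y : 'I_n | val y \in s]].
Proof.
move=> us sn; apply: uniq_perm => //; first by rewrite (map_inj_uniq val_inj) enum_uniq.
move=> x; apply/idP/mapP => [xs|[y]]; last by rewrite mem_enum => ys ->.
by exists (Ordinal (sn x xs)); rewrite // mem_enum.
Qed.

Lemma sum_vals (s : seq nat) (f : nat -> nat) : uniq s -> {in s, forall x, x < n} ->
  \sum_(x <- s) f x = \sum_(y : 'I_n | val y \in s) f (val y).
Proof. by move=> us sn; rewrite (perm_big _ (vals_perm us sn)) big_map big_enum. Qed.

Lemma card_vals (s : seq nat) : uniq s -> {in s, forall x, x < n} ->
  #|[pred y : 'I_n | val y \in s]| = size s.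
Proof. by move=> us sn; rewrite (perm_size (vals_perm us sn)) size_map cardE. Qed.
End Vals.

Section Rank.
Variables (n : nat) (L : {set 'I_n * 'I_n}).
Hypothesis linL : linear_order L.

(** The number of items below i in L. It reduces the oracle to a comparison of numbers, which is all
    that the analysis of the programs knows about L. *)
Definition rank_of (i : nat) := #|[set y : 'I_n | [exists x : 'I_n, (val x == i) && ((y, x) \in L)]]|.

Lemma rank_of_val (x : 'I_n) : rank_of x = #|[set y : 'I_n | (y, x) \in L]|.
Proof.
apply: eq_card => y; rewrite !inE; apply/existsP/idP => [[z /andP[/eqP/val_inj->]]//|yx].
by exists x; rewrite eqxx.
Qed.

Lemma rank_of_lt (x y : 'I_n) : (rank_of x < rank_of y) = ((x, y) \in L).
Proof.
have lt_ (a b : 'I_n) : (a, b) \in L -> rank_of a < rank_of b.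
  move=> ab; rewrite !rank_of_val; apply: proper_card; apply/properP; split.
    by apply/subsetP => z; rewrite !inE => za; apply: (L_trans linL za ab).
  by exists a; rewrite inE // (L_irr linL).
apply/idP/idP => [h|]; last exact: lt_.
have [e|ne] := eqVneq x y; first by rewrite e ltnn in h.
by case/orP: (L_total linL ne) => // /lt_; rewrite ltnNge (ltnW h).
Qed.

Lemma oracle_rank i j : i < n -> j < n -> oracle L i j = (rank_of i < rank_of j).
Proof.
move=> hi hj; rewrite -[i]/(val (Ordinal hi)) -[j]/(val (Ordinal hj)) rank_of_lt.
apply/existsP/idP => [[x /existsP[y /and3P[/eqP/val_inj-> /eqP/val_inj->]]]//|h].
by exists (Ordinal hi); apply/existsP; exists (Ordinal hj); rewrite !eqxx.
Qed.

Lemma rank_of_inj i j : i < n -> j < n -> rank_of i = rank_of j -> i = j.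
Proof.
move=> hi hj e; have [//|ne] := eqVneq (Ordinal hi) (Ordinal hj); first by case.
have := L_total linL ne; rewrite -!rank_of_lt /= e ltnn; by [].
Qed.
End Rank.

Section Bounds.
Variables (n : nat) (G L : {set 'I_n * 'I_n}).
Hypothesis linL : linear_order L.
Hypothesis comL : compatible G L.
Notation rk := (rank_of L).
Notation l := (trunc_log 2 (num_ext G)).
Variables (q path : seq nat) (lev lp : nat -> nat).
Hypothesis pq : perm_eq q (iota 0 n).
Hypothesis posG : forall x y : 'I_n, (x, y) \in G -> index (val x) q < index (val y) q.
Hypothesis levG : forall x y : 'I_n, (x, y) \in G -> lev x < lev y.
Hypothesis levh : forall x, x < n -> lev x < size path.
Hypothesis plev : forall i, i < size path -> lev (nth 0 path i) = i.
Hypothesis pathn : {in path, forall x, x < n}.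
Hypothesis pathS : sorted (lt_by rk) path.
Hypothesis lpG : forall x y : 'I_n, (x, y) \in G -> val x \in path -> index (val x) path < lp y.
Hypothesis lpL : forall y : 'I_n, lp y <= size path /\ forall i, i < lp y -> rk (nth 0 path i) < rk y.
Let S := [seq x <- q | x \notin path].

Lemma num_ext_gt0 : 0 < num_ext G.
Proof. by apply/card_gt0P; exists L; rewrite inE linL. Qed.

Lemma q_lt x : x \in q -> x < n.
Proof. by rewrite (perm_mem pq) mem_iota. Qed.

Lemma S_lt : {in S, forall x, x < n}.
Proof. by move=> x; rewrite mem_filter => /andP[_ /q_lt]. Qed.

Lemma S_uniq : uniq S.
Proof. by rewrite filter_uniq // (perm_uniq pq) iota_uniq. Qed.

Lemma mem_S (x : 'I_n) : (val x \in S) = (val x \notin path).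
Proof. by rewrite mem_filter (perm_mem pq) mem_iota /= ltn_ord andbT. Qed.

Lemma path_uniq_of_levels : uniq path.
Proof. by apply/(uniqP 0) => i j; rewrite !inE => /plev ei /plev ej eij; rewrite -ei -ej eij. Qed.

Lemma size_S_le : size S <= l.
Proof.
apply: trunc_log_max => //; pose P := [set x : 'I_n | val x \in path].
have -> : size S = #|~: P|.
  rewrite -(card_vals S_uniq S_lt); apply: eq_card => x.
  by rewrite !inE mem_S.
apply: (num_ext_levels linL comL (lev := fun x => lev x)); first exact: levG.
move=> x _; have h := levh (ltn_ord x).
have pn : nth 0 path (lev x) < n by apply: pathn; apply: mem_nth.
by exists (Ordinal pn); rewrite ?inE /= ?mem_nth ?plev.
Qed.

Notation r := (path_rank rk path).

Lemma path_rank_mono x y : rk x <= rk y -> r x <= r y.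
Proof. by move=> xy; apply: sub_count => z /= zx; apply: leq_trans zx xy. Qed.

Lemma path_rank_lt i x : i < size path -> (rk (nth 0 path i) < rk x) = (i < r x).
Proof.
move=> ip.
have -> : r x = count (fun i => rk (nth 0 path i) < rk x) (iota 0 (size path)).
  by rewrite -[path in LHS](mkseq_nth 0) /path_rank count_map.
apply: (count_prefix (P := fun i => rk (nth 0 path i) < rk x)) => // a b ab bp.
apply: leq_ltn_trans; have [->//|ne] := eqVneq a b.
by apply: ltnW; apply: (sorted_ltn_nth (@lt_by_trans rk)) => //; rewrite ?inE; lia.
Qed.

(** The start of the search for x, put without reference to the order of insertion: path ranks are
    monotone in L, so the maximum is the path rank of the item inserted just before x. *)
Definition gap_low (S' : seq nat) x := maxn (lp x) (\max_(u <- S' | rk u < rk x) r u).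

Lemma insert_cost_sum (S0 S1 : seq nat) : pairwise (lt_by rk) (S0 ++ S1) ->
  insert_cost rk path lp (\max_(u <- S0) r u) S1 =
  \sum_(x <- S1) (trunc_log 2 (r x - gap_low (S0 ++ S1) x + 1)).+1.
Proof.
elim: S1 S0 => [|x S1 IH] S0 pw /=; first by rewrite big_nil.
move: (pw); rewrite pairwise_cat /= => /and3P[/allrelP h1 h2 /andP[/allP h3 h4]].
have lo u : u \in S0 -> rk u < rk x by move=> uS; apply: (h1 u x uS (mem_head _ _)).
rewrite big_cons; congr (_ + _).
  congr (trunc_log 2 (_ - _ + 1)).+1; congr maxn.
  rewrite [RHS]big_cat /= big_cons ltnn [X in _ = maxn _ X]big1_seq ?maxn0.
    by rewrite big_seq [RHS]big_seq_cond; apply: eq_bigl => u; case: (boolP (u \in S0)) => //= /lo->.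
  by move=> u /andP[ux uS]; have := h3 u uS; rewrite /lt_by ltnNge (ltnW ux).
have := IH (rcons S0 x); rewrite cat_rcons => /(_ pw) <-.
congr (insert_cost _ _ _ _ _); rewrite -cats1 big_cat big_seq1 /=; apply/esym/maxn_idPr.
by apply/bigmax_leqP_seq => u uS _; apply: path_rank_mono; apply: ltnW; apply: lo.
Qed.

Lemma insert_cost_le (S' : seq nat) : perm_eq S' S -> sorted (lt_by rk) S' ->
  insert_cost rk path lp 0 S' <= size S + l.
Proof.
move=> pS sS; have uS' : uniq S' by rewrite (perm_uniq pS) S_uniq.
have Sn' : {in S', forall x, x < n} by move=> x; rewrite (perm_mem pS); apply: S_lt.
have := @insert_cost_sum [::] S'; rewrite big_nil => ->; last first.
  by rewrite -(sorted_pairwise (@lt_by_trans rk)).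
rewrite (eq_bigr (fun x => 1 + trunc_log 2 (r x - gap_low S' x + 1))); last by move=> x _; rewrite add1n.
rewrite big_split /= sum1_size (perm_size pS) leq_add2l.
apply: trunc_log_max => //; pose P := [set x : 'I_n | val x \in path].
have rl (s : 'I_n) : gap_low S' s <= r s.
  rewrite geq_max; apply/andP; split; last first.
    by apply/bigmax_leqP_seq => u _ us; apply: path_rank_mono; apply: ltnW.
  have [h1 h2] := lpL s; case E: (lp s) => [//|i]; rewrite -path_rank_lt; first by apply: h2; rewrite E.
  by rewrite -E.
have := @num_ext_gaps _ G L linL comL P (fun x => index (val x) path) (fun x => r x)
  (fun x => gap_low S' x) (size path).
move=> bound; apply: leq_trans (bound _ _ _ _ _ _) => {bound}.
- rewrite (sum_vals _ uS' Sn') expn_sum; apply: (@leq_trans (\prod_(y : 'I_n | val y \in S') (r y - gap_low S' y).+1)).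
    by apply: leq_prod => y _; rewrite -[X in _ <= X]addn1; apply: trunc_logP; rewrite // addn1.
  by apply: eq_leq; apply: eq_bigl => y; rewrite (perm_mem pS) mem_S inE.
- move=> x y; rewrite !inE => xp yp xy; rewrite ltnNge leq_eqVlt; apply/negP => /predU1P[e|h].
    have /val_inj exy : val x = val y by rewrite -(nth_index 0 xp) -e nth_index.
    by have := GL comL xy; rewrite exy (negbTE (L_irr linL _)).
  have := sorted_ltn_nth (@lt_by_trans rk) 0 pathS; move/(_ (index (val y) path) (index (val x) path)).
  rewrite !inE !index_mem !nth_index // => /(_ yp xp h); rewrite /lt_by rank_of_lt // => yx.
  by have := L_asym linL yx; rewrite (GL comL xy).
- by move=> p s; rewrite !inE => pp _ ps; apply: leq_trans (leq_maxl _ _); apply: lpG.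
- move=> p s; rewrite !inE => pp sp sG; rewrite leqNgt; apply/negP => h.
  have := path_rank_lt (val s) (i := index (val p) path); rewrite index_mem pp h => /(_ isT).
  by rewrite nth_index // rank_of_lt // => ps; have := L_asym linL ps; rewrite (GL comL sG).
- move=> s u sP uP su; apply: leq_trans (leq_maxr _ _).
  apply: (@leq_bigmax_seq _ S' (fun v => rk v < rk u) r (val s)).
    by rewrite (perm_mem pS) mem_S; rewrite inE in sP.
  by rewrite rank_of_lt.
- by move=> s _; rewrite rl /path_rank count_size.
- move=> s c _ cr; have cp : c < size path by apply: leq_trans cr _; apply: count_size.
  have pn : nth 0 path c < n by apply: pathn; apply: mem_nth.
  exists (Ordinal pn); first by rewrite inE mem_nth.
  by rewrite /= index_uniq // path_uniq_of_levels.
Qed.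

Lemma steps_cost_le rs : steps rk 4 S rs [::] -> steps_cost 4 rs <= 4 * size S + 8 * (l + 8 * size S + 1).
Proof.
move=> st; apply: leq_trans (steps_cost_total S_uniq st) _; rewrite leq_add2l leq_mul2l /=.
pose w := weight 1 (behead rs).
pose SS := [set x : 'I_n | val x \in S].
have cSS : #|SS| = size S by rewrite -(card_vals S_uniq S_lt); apply: eq_card => x; rewrite !inE.
(* With positions in q as [pos], chain sets inside S become consistent lists, and [chain_weight]
   bounds their weight by 7 |S|. *)
have := @num_ext_weights _ G L (fun x => index (val x) q) SS (fun x => 2 ^ w x) (7 * size S) linL comL posG.
move=> bound; have {bound} : \prod_(x in SS) 2 ^ w x <= num_ext G * 2 ^ (7 * size S + #|SS|).+1.
  apply: bound => K KS cK.
  pose Kn := [seq val x | x <- enum K].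
  have uK : uniq Kn by rewrite (map_inj_uniq val_inj) enum_uniq.
  have KnS : {subset Kn <= S}.
    by move=> x /mapP[y]; rewrite mem_enum => /(subsetP KS); rewrite inE => yS ->.
  have con : consistent rk S Kn.
    move=> x y /mapP[a]; rewrite mem_enum => aK -> /mapP[b]; rewrite mem_enum => bK ->.
    rewrite rank_of_lt // => ab; have ne : a != b by apply: contraTneq ab => ->; apply: (L_irr linL).
    have aS := subsetP KS a aK; have bS := subsetP KS b bK; rewrite !inE !mem_S in aS bS.
    rewrite index_filter_lt //.
    move/forall_inP/(_ a aK)/forall_inP/(_ b bK)/implyP/(_ ne): cK => /orP[/andP[]//|/andP[_ ba]].
    by rewrite (negbTE (L_asym linL ab)) in ba.
  have := chain_weight S_uniq uK KnS st con; rewrite -/w big_map big_enum; exact.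
have -> : \prod_(x in SS) 2 ^ w x = 2 ^ \sum_(x <- S) w x.
  by rewrite (sum_vals _ S_uniq S_lt) expn_sum; apply: eq_bigl => x; rewrite inE.
rewrite cSS => h; have lt_ : num_ext G < 2 ^ l.+1 by apply: trunc_log_ltn.
have : 2 ^ (\sum_(x <- S) w x) < 2 ^ (l.+1 + (7 * size S + size S).+1).
  by rewrite expnD; apply: leq_ltn_trans h _; rewrite ltn_pmul2r // expn_gt0.
have gen a b c : a < b.+1 + (7 * c + c).+1 -> a <= b + 8 * c + 1 by clear; lia.
by rewrite ltn_exp2l //; apply: gen.
Qed.

End Bounds.

(** * The two programs, the input graph, and correctness of the sorting phase *)

Definition sort_rest_cmd := If (V vX) (adaptive_sort_cmd ;; insert_cmd) Skip.
(* If n exceeds 4m + 4, then O(n) time is too much for preprocessing, but most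
   vertices are off the path, so that the sorting phase can afford it. *)
Definition preprocess_cmd := 76 ::= (V 0 <! K 4 *! V 1 +! K 5) ;; If (V 76) layout_cmd Skip.
Definition sorting_cmd := If (V 76) Skip layout_cmd ;; sort_rest_cmd.

Section Input.
Variables (n : nat) (G : {set 'I_n * 'I_n}) (E : seq ('I_n * 'I_n)).
Hypothesis EG : perm_eq E (enum G).
Notation m := (size E).
Definition source e := nth 0 [seq val x.1 | x <- E] e.
Definition target e := nth 0 [seq val x.2 | x <- E] e.

Lemma edge_num e : e < m -> exists x y : 'I_n, [/\ (x, y) \in G, source e = val x & target e = val y].
Proof.
move=> em; case Ee: (nth (tnth (in_tuple E) (Ordinal em)) E e) => [x y]; exists x, y.
have h d : nth d E e = (x, y) by rewrite -Ee; apply: set_nth_default.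
split; last by rewrite /target (nth_map (x, y)) // h.
  by rewrite -mem_enum -(perm_mem EG) -(h (x, y)) mem_nth.
by rewrite /source (nth_map (x, y)) // h.
Qed.

Lemma num_edge (x y : 'I_n) : (x, y) \in G -> exists e, [/\ e < m, source e = val x & target e = val y].
Proof.
rewrite -mem_enum -(perm_mem EG) => xy; exists (index (x, y) E).
have im : index (x, y) E < m by rewrite index_mem.
by split=> //; rewrite /source /target (nth_map (x, y)) // nth_index.
Qed.

Lemma source_lt e : e < m -> source e < n.
Proof. by case/edge_num => x [y [_ -> _]]; apply: ltn_ord. Qed.

Lemma target_lt e : e < m -> target e < n.
Proof. by case/edge_num => x [y [_ _ ->]]; apply: ltn_ord. Qed.

Lemma size_edges : m = #|G|.
Proof. by rewrite (perm_size EG) cardE. Qed.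

Lemma size_edges_le : m <= n * n.
Proof.
have -> : n * n = #|{: 'I_n * 'I_n}| by rewrite card_prod card_ord.
by rewrite size_edges max_card.
Qed.

(** Otherwise every vertex outside q has a predecessor outside q. Iterating such a choice must
    revisit a vertex, which closes a cycle; the walk runs against the edges, hence the reversal. *)
Lemma acyclic_sourced : acyclic G -> sourced n m source target.
Proof.
move=> acy q /hasP[v0]; rewrite mem_iota add0n /= => v0n v0q.
case: (boolP [exists v : 'I_n, (val v \notin q) && [forall u : 'I_n, ((u, v) \in G) ==> (val u \in q)]]).
  case/existsP => v /andP[vq /forallP vG]; exists v; split=> // e em ev.
  have [x [y [xy sx ty]]] := edge_num em; have yv : y = v by apply: val_inj; rewrite -ty.
  by rewrite sx; move: (vG x); rewrite -yv xy.
rewrite negb_exists => /forallP noS; exfalso.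
pose f (v : 'I_n) := odflt v [pick u : 'I_n | ((u, v) \in G) && (val u \notin q)].
have fP v : val v \notin q -> (f v, v) \in G /\ val (f v) \notin q.
  move=> vq; rewrite /f; case: pickP => [u /andP[]//|none].
  have := noS v; rewrite vq /= => /forallPn[u]; rewrite negb_imply => h.
  by have := none u; rewrite h.
pose v := Ordinal v0n.
have iterq i : val (iter i f v) \notin q by elim: i => //= i /fP[].
have : ~~ uniq (traject f v #|'I_n|.+1).
  by apply/negP => /card_uniqP; rewrite size_traject => h; have := max_card (mem (traject f v #|'I_n|.+1)); rewrite h ltnn.
rewrite looping_uniq negbK => /trajectP[i il e].
pose y := iter i f v; pose d := #|'I_n| - i.
have dy : iter d f y = y by rewrite /y -iterD subnK // ltnW.
have yq j : val (iter j f y) \notin q by rewrite -iterD.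
have d0 : 0 < d by rewrite subn_gt0.
have := acy (rev (traject f y d)); rewrite rev_cycle.
case: d d0 dy => // d _ dy.
have pth j z : val z \notin q -> path (fun z' x : 'I_n => (x, z') \in G) z (traject f (f z) j).
  by elim: j z => //= j IH z /fP[-> /IH].
suff -> : cycle (fun z : 'I_n => (fun x y => (x, y) \in G)^~ z) (traject f y d.+1).
  by move/(_ isT) => /(congr1 size); rewrite size_rev size_traject.
have := pth d.+1 y (yq 0); rewrite trajectSr -iterSr dy trajectS /=; exact.
Qed.
End Input.

Lemma vals_lift n (s : seq nat) : {in s, forall x, x < n} -> exists l : seq 'I_n, [seq val x | x <- l] = s.
Proof.
elim: s => [|x s IH] sn; first by exists [::].
have [|l <-] := IH; first by move=> y ys; apply: sn; rewrite inE ys orbT.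
by exists (Ordinal (sn x (mem_head _ _)) :: l).
Qed.

Lemma outputs_from n (L : {set 'I_n * 'I_n}) s l : linear_order L ->
  linked_list (arrs s 0) n (vars s 0) l -> perm_eq l (iota 0 n) -> sorted (lt_by (rank_of L)) l ->
  outputs_sorted L s.
Proof.
move=> linL lk pl sl; have [|l' e] := @vals_lift n l.
  by move=> x; rewrite (perm_mem pl) mem_iota.
exists l'; rewrite e; split=> //; split.
  apply: uniq_perm; rewrite ?enum_uniq //.
    by rewrite -(map_inj_uniq val_inj) e (perm_uniq pl) iota_uniq.
  by move=> x; rewrite mem_enum inE -(mem_map val_inj) e (perm_mem pl) mem_iota /= ltn_ord.
by move: sl; rewrite -e sorted_map; apply: sub_sorted => x y; rewrite /= /lt_by rank_of_lt.
Qed.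

Section Sorting.
Variables (w n : nat) (G L : {set 'I_n * 'I_n}) (E : seq ('I_n * 'I_n)).
Hypothesis EG : perm_eq E (enum G).
Hypothesis linL : linear_order L.
Hypothesis comL : compatible G L.
Hypothesis HW : 5000 * (n.+2 * n.+2 * (n.+2 * n.+2)) < 2 ^ w.
Notation l := (trunc_log 2 (num_ext G)).
Notation rk := (rank_of L).

(** The last conjunct justifies deferring the layout: at most l vertices lie off the path, and the
    path has at most one vertex more than G has edges. *)
Lemma sort_rest_spec s q path lev :
  laid_out n (size E) (source E) (target E) s q path lev ->
  exists s' t k, [/\ run w (Some (oracle L)) sort_rest_cmd s s' t k, outputs_sorted L s',
     t <= 1000 * 320 * l.+1, num_ext G <= 1 -> k = 0 & n <= l + (size E).+1].
Proof.
move=> [[pq posE] [levE levh plev pathn] pathE lpP [[EX hA] [Eh hp] [En ER] lk]].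
set S := [seq x <- q | x \notin path] in EX hA.
have toE (x y : 'I_n) (xy : (x, y) \in G) := num_edge EG xy.
have posG (x y : 'I_n) : (x, y) \in G -> index (val x) q < index (val y) q.
  by case/toE => e [em <- <-]; apply: posE.
have levG (x y : 'I_n) : (x, y) \in G -> lev x < lev y.
  by case/toE => e [em <- <-]; apply: levE.
have pathS : sorted (lt_by rk) path.
  apply/(sortedP 0) => i ip; have [e em [<- <-]] := pathE i ip.
  have [x [y [xy -> ->]]] := edge_num EG em.
  by rewrite /lt_by rank_of_lt // (GL comL xy).
set lp := arrs s aLp in lpP.
have lpG (x y : 'I_n) : (x, y) \in G -> val x \in path -> index (val x) path < lp y.
  case/toE => e [em sx ty] xp; have [h _] := lpP y.
  by have := h e em ty; rewrite sx /on_path xp.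
have lpL (y : 'I_n) : lp y <= size path /\ forall i, i < lp y -> rk (nth 0 path i) < rk y.
  have [_ [->//|[e em [ty ->]]]] := lpP y.
  rewrite /on_path; case: ifP => [xp|//]; split; first by rewrite index_mem.
  have [x [z [xz sx tz]]] := edge_num EG em.
  have zy : z = y by apply: val_inj; rewrite -tz.
  move=> i; rewrite ltnS => ix; apply: (@leq_ltn_trans (rk (source E e))).
    rewrite -[in X in _ <= X](nth_index 0 xp).
    have [->//|ne] := eqVneq i (index (source E e) path); apply: ltnW.
    apply: (sorted_ltn_nth (@lt_by_trans rk)) => //; rewrite ?inE ?index_mem //.
      by apply: leq_ltn_trans ix _; rewrite index_mem.
    by rewrite ltn_neqAle ne.
  by rewrite sx rank_of_lt // -zy (GL comL xz).
have uq : uniq q by rewrite (perm_uniq pq) iota_uniq.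
have qn x : x \in q -> x < n by rewrite (perm_mem pq) mem_iota.
have Sn : {in S, forall x, x < n} by move=> x; rewrite mem_filter => /andP[_ /qn].
have uS : uniq S by rewrite filter_uniq.
have up : uniq path := path_uniq_of_levels plev.
have pS : perm_eq (path ++ S) (iota 0 n).
  apply: uniq_perm; rewrite ?iota_uniq //.
    rewrite cat_uniq up uS andbT; apply/hasPn => x; rewrite mem_filter => /andP[]; done.
  move=> x; rewrite mem_cat mem_filter (perm_mem pq) mem_iota /=.
  by case: (boolP (x \in path)) => //= /pathn ->.
have szn : size path + size S = n by rewrite -size_cat (perm_size pS) size_iota.
have kl : size S <= l := size_S_le linL comL pq levG levh plev pathn.
have hE : size path <= (size E).+1.
  case Ep: path => [//|x p]; rewrite ltnS.
  have -> : size E = size (map (target E) (iota 0 (size E))) by rewrite size_map size_iota.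
  apply: uniq_leq_size; first by move: up; rewrite Ep => /andP[].
  move=> z /(nthP 0)[i ip <-]; have [|e em [_ te]] := pathE i; first by rewrite Ep.
  have -> : nth 0 p i = target E e by rewrite te Ep.
  by rewrite map_f // mem_iota.
have nl : n <= l + (size E).+1 by have := leq_add kl hE; rewrite addnC szn.
have ltP : forall i j, i < n -> j < n -> oracle L i j = (rk i < rk j).
  by move=> i j; apply: oracle_rank.
have rkI := rank_of_inj linL.
have [M1 M2 M3] := word_facts HW.
have WW : 10 * n + 100 < 2 ^ w by move: M1 M2 M3; move: (n.+2 * n.+2) => y; clear; lia.
have psz : size path <= n by rewrite -[X in _ <= X]szn leq_addr.
have Ssz : size S <= n by rewrite -[X in _ <= X]szn leq_addl.
(* With S empty the path is the answer and nothing is compared. As |S| <= l, this is the case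
   whenever e(G) = 1, where the bound on comparisons is 0, without an additive constant. *)
have [S0|S0] := posnP (size S).
  exists s, 3, 0; split=> //.
  - apply: (@RunIf _ _ _ _ _ _ _ 1 0); rewrite /= EX S0 /=; exact: RunSkip.
  - apply: (outputs_from linL lk) => //.
    by move: pS; rewrite (size0nil S0) cats0.
  - by apply: (@leq_trans (1000 * 320 * 1)); [clear|rewrite leq_mul2l orbT].
have [s' [t [k [rn [out tb]]]]] : ex w (Some (oracle L)) sort_rest_cmd
    (fun s' t' => outputs_sorted L s' /\ t' <= 1000 * 320 * l.+1) s 0.
  rewrite /sort_rest_cmd; step.
  rewrite -lt0n S0; apply: ex_seq.
  apply: (adaptive_sort_spec ltP rkI HW Sn uS Ssz EX hA ER) => s1 t1 r S' f1 st va1 hQ1 pS1 sS1 t1b.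
  have c1 := steps_cost_le linL comL pq posG st.
  have c2 := insert_cost_le linL comL pq plev pathn pathS lpG lpL pS1 sS1.
  have [h1 n1] : vars s1 vh = size path /\ vars s1 vn = n by case: f1 => fv _; rewrite !fv.
  have hp1 : holds (arrs s1 aPath) path by case: f1 => _ fa; rewrite fa.
  have lp1 : arrs s1 aLp = lp by case: f1 => _ fa; rewrite fa.
  have lk1 : linked_list (arrs s1 0) n (vars s1 0) path by case: f1 => fv fa; rewrite fv ?fa.
  have sS' := perm_size pS1.
  apply: (@insert_spec w (oracle L) n rk ltP rkI WW path lp pathn pathS psz _ s1 _ S') => //.
  - by rewrite va1 sS'.
  - by move=> x _; rewrite lp1.
  - by move=> x; rewrite (perm_mem pS1); apply: Sn.
  - have p1 : perm_eq (path ++ S') (path ++ S) by rewrite perm_cat2l.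
    by rewrite (perm_uniq p1) (perm_uniq pS) iota_uniq.
  - by rewrite sS'.
  - move=> x; rewrite (perm_mem pS1) => /Sn xn; exact: (lpL (Ordinal xn)).
  move=> s2 t2 lst f2 lk2 pl sl t2b; split.
    apply: (outputs_from linL lk2) => //; apply: perm_trans pl _.
    by apply: perm_trans pS; rewrite perm_cat2l.
  move: c1 c2 t1b t2b kl; rewrite /=.
  move: (steps_cost 4 r) (insert_cost _ _ _ _ _) (size S) l => a b c d; clear; lia.
exists s', t, k; split=> //.
move=> e1; have : l <= 0 by rewrite leqn0 trunc_log_eq0 ltnS e1 orbT.
by move: kl S0; case: (size S) => // c; case: l.
Qed.

End Sorting.

(** * Real logarithms, word size, and the theorem *)

Lemma INR_exp2 l : INR (2 ^ l) = (2 ^ l)%coqR.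
Proof.
elim: l => [|l IH]; first by rewrite expn0.
by rewrite expnS -[(2 * 2 ^ l)%N]/(Nat.mul 2 (2 ^ l)) mult_INR IH.
Qed.

Lemma ln2_gt0 : (0 < ln 2)%coqR.
Proof. by rewrite -ln_1; apply: ln_increasing; [exact: Rlt_0_1|exact: Rlt_plus_1]. Qed.

Lemma trunc_log_log2 e : 0 < e -> (INR (trunc_log 2 e) <= log2 (INR e))%coqR.
Proof.
move=> e0; have h : (INR (2 ^ trunc_log 2 e) <= INR e)%coqR.
  by apply: le_INR; apply/leP; apply: trunc_logP.
have p0 : (0 < 2 ^ trunc_log 2 e)%coqR by apply: pow_lt; exact: Rlt_0_2.
rewrite INR_exp2 in h.
have hl : (ln (2 ^ trunc_log 2 e) <= ln (INR e))%coqR.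
  by case: h => [h|->]; [left; apply: ln_increasing|right].
rewrite ln_pow in hl; last exact: Rlt_0_2.
rewrite /log2; apply: (Rmult_le_reg_r (ln 2)); first exact: ln2_gt0.
rewrite /Rdiv Rmult_assoc Rinv_l ?Rmult_1_r //.
by apply: Rgt_not_eq; exact: ln2_gt0.
Qed.

Lemma INR_le_log2 C t e : 0 < e -> t <= C * trunc_log 2 e -> (INR t <= INR C * log2 (INR e))%coqR.
Proof.
move=> e0 tC; apply: (Rle_trans _ (INR C * INR (trunc_log 2 e))).
  by rewrite -mult_INR; apply: le_INR; apply/leP.
by apply: Rmult_le_compat_l; [exact: pos_INR|exact: trunc_log_log2].
Qed.

Lemma INR_le_log2S C t e : 0 < e -> t <= C * (trunc_log 2 e).+1 ->
  (INR t <= INR C * (log2 (INR e) + 1))%coqR.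
Proof.
move=> e0 tC; apply: (Rle_trans _ (INR C * INR (trunc_log 2 e).+1)).
  by rewrite -mult_INR; apply: le_INR; apply/leP.
apply: Rmult_le_compat_l; first exact: pos_INR.
by rewrite S_INR; apply: Rplus_le_compat_r; exact: trunc_log_log2.
Qed.

(** A fourth power is needed; the other 16 factors are at least 2 and absorb the constant, even for
    n = 0. *)
Lemma word_size n w : n.+2 ^ 20 <= 2 ^ w -> 5000 * (n.+2 * n.+2 * (n.+2 * n.+2)) < 2 ^ w.
Proof.
apply: leq_trans; have -> : n.+2 * n.+2 * (n.+2 * n.+2) = n.+2 ^ 4 by rewrite !expnS expn0 muln1 !mulnA.
have -> : n.+2 ^ 20 = n.+2 ^ 16 * n.+2 ^ 4 by rewrite -expnD.
rewrite ltn_pmul2r ?expn_gt0 //; apply: (@leq_trans (2 ^ 16)); last by rewrite leq_exp2r.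
by rewrite (@leq_trans (2 ^ 13)) // leq_exp2l.
Qed.

Theorem theorem5 :
  exists (preprocess sorting : cmd) (C c : nat),
  forall (n : nat) (G : {set 'I_n * 'I_n}) (E : seq ('I_n * 'I_n)) (w : nat),
    acyclic G -> perm_eq E (enum G) -> n.+2 ^ c <= 2 ^ w ->
  exists (s1 : state) (t1 : nat),
    [/\ run w None preprocess (input E) s1 t1 0,
        t1 <= C * (#|G|).+1
      & forall L : {set 'I_n * 'I_n}, linear_order L -> compatible G L ->
        exists (s2 : state) (t2 k : nat),
          [/\ run w (Some (oracle L)) sorting s1 s2 t2 k,
              outputs_sorted L s2,
              (INR t2 <= INR C * (log2 (INR (num_ext G)) + 1))%coqR
            & (INR k <= INR C * log2 (INR (num_ext G)))%coqR]].
Proof.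
(* Twice the constant of the time bound: for e(G) >= 2 one has l + 1 <= 2 l, so the time also bounds
   the comparisons without an additive term. The equation keeps the unary numeral folded. *)
have [C CE] : exists C, C = 2 * (1000 * 400) by eexists.
exists preprocess_cmd, sorting_cmd, C, 20 => n G E w acy EG /word_size HW.
have [M1 M2 M3] := word_facts HW.
have mE := size_edges EG; have mle := size_edges_le EG.
have WW : 10 * n + 10 * size E + 100 < 2 ^ w.
  have h : size E <= n.+2 * n.+2 by apply: leq_trans mle _; apply: leq_mul; apply: leqW.
  by move: h M1 M2 M3; move: (n.+2 * n.+2) (size E) => y z; clear; lia.
have srcd := acyclic_sourced EG acy.
pose s0 := set_var (input E) 76 (n < 4 * size E + 5).
(* Stated for every [orc], because the layout may run in either phase. *)
have lay orc (Q : state -> nat -> Prop) t :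
    (forall s' t' q path lev, frame layout_cmd s0 s' ->
       laid_out n (size E) (source E) (target E) s' q path lev ->
       t' <= t + 400 * (n + size E + 1) -> Q s' t') -> ex w orc layout_cmd Q s0 t.
  move=> QP; apply: ex_framed.
  apply: (layout_spec orc (source_lt EG) (target_lt EG) WW srcd) => //.
    by move=> a x; case: a => [|[|a]].
  by move=> s' t' q path lev h tb fr; apply: QP fr h tb.
have [s1 [t1 [k1 [rn1 [t1b after]]]]] : ex w None preprocess_cmd (fun s1 t1 =>
    t1 <= 1000 * 400 * (size E).+1 /\
    forall orc, ex w orc (If (V 76) Skip layout_cmd) (fun s' t' => exists q path lev,
       laid_out n (size E) (source E) (target E) s' q path lev /\
       (t' <= 10 \/ 4 * size E + 5 <= n /\ t' <= 400 * (n + size E + 1) + 10)) s1 0) (input E) 0.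
  rewrite /preprocess_cmd; step; rewrite -/s0.
  have Ef : vars s0 76 = (n < 4 * size E + 5) by [].
  step; rewrite -/s0; case: ltnP Ef => nm Ef /=.
    apply: lay => s' t' q path lev fr h tb; split.
      by move: tb nm; rewrite /=; clear; lia.
    move=> orc; have Ef' : vars s' 76 = 1 by case: fr => fv _; rewrite fv.
    step; step; exists q, path, lev; split; first by [].
    by left.
  step; split; first by clear; lia.
  move=> orc; step.
  rewrite ltnNge nm /=; apply: lay => s' t' q path lev fr h tb; exists q, path, lev; split=> //.
  by right; split; [by []|move: tb; rewrite /=; clear; lia].
have k10 : k1 = 0 by apply: (run_no_compare rn1).
rewrite k10 in rn1.
exists s1, t1; split=> //.
  by move: t1b CE; rewrite mE; move: #|G| => g; clear; lia.
move=> L linL comL; have e0 := num_ext_gt0 linL comL.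
have [s2 [t2 [k2 [rn2 [q [path [lev [h tb]]]]]]]] := after (Some (oracle L)).
have k20 : k2 = 0 by apply: (run_no_compare rn2).
have [s3 [t3 [k3 [rn3 out t3b k3z nl]]]] := sort_rest_spec EG linL comL HW h.
exists s3, (t2 + t3), (k2 + k3); rewrite k20 add0n in tb *.
(* If the layout was deferred, 4 m + 5 <= n <= l + m + 1, so 3 m + 4 <= l and its time O(n + m) is
   O(l). *)
have tt : t2 + t3 <= 1000 * 400 * (trunc_log 2 (num_ext G)).+1.
  move: tb t3b nl; move: (trunc_log 2 _) (size E) => l m; clear; lia.
split=> //.
- by have := RunSeq rn2 rn3; rewrite k20 add0n.
- by apply: (INR_le_log2S e0); move: tt CE; move: (trunc_log 2 _) => l; clear; lia.
- apply: (INR_le_log2 e0).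
  have [e1|e2] := leqP (num_ext G) 1; first by rewrite k3z.
  have l1 : 0 < trunc_log 2 (num_ext G) by rewrite trunc_log_gt0.
  by have := run_compares rn3; move: tt l1 CE; move: (trunc_log 2 _) => l; clear; lia.
Qed.
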